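(* Let $(t_e)_{e\in\mathbb{E}^2}$ be i.i.d. nonnegative random variables with distribution function $F$ such that $F(0)=1/2$ and $\sum_{k=2}^\infty a_k=\infty$, where $a_k=F^{-1}(1/2+1/2^k)$. Let $E\subset[0,\infty)^{\mathbb{E}^2}$ be a cylinder event. Then for any $L\ge 0$, \[\lim_{n\to\infty}\mathbb{P}\big((t_e)\in E\mid T(0,\partial B(n))\le L\big)=\widetilde{\nu}(E).\]
   Context: $\mathbb{E}^2$ is the set of nearest-neighbor edges of $\mathbb{Z}^2$. $F^{-1}(t)=\inf\{x\in\mathbb{R}:F(x)\ge t\}$ for $t\in(0,1)$. A path from $x$ to $y$ is an alternating sequence of vertices and edges $x=x_0,e_0,x_1,\dots,e_{n-1},x_n=y$ with $e_i$ joining $x_i,x_{i+1}$; its passage time is $T(\gamma)=\sum_i t_{e_i}$. For vertex sets $A,B$, $T(A,B)$ is the infimum of $T(\gamma)$ over paths from a vertex of $A$ to a vertex of $B$. $B(n)=[-n,n]^2$, $\partial B(n)=\{x\in B(n):\|x\|_\infty=n\}$. A cylinder event is a product-measurable set depending on finitely many coordinates. When $F(0)=1/2$, for every cylinder event $E$ the limit $\widetilde{\nu}(E)=\lim_{n\to\infty}\mathbb{P}((t_e)\in E\mid T(0,\partial B(n))=0)$ exists; this defines $\widetilde\nu$. (Equivalently, $\widetilde\nu$ is the law of $(\sigma_e s_e)$ where $(\sigma_e)$ has Kesten's incipient infinite cluster law for critical Bernoulli$(1/2)$ bond percolation and, independently, $(s_e)$ are i.i.d. with $\mathbb{P}(s_e\in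 A)=\mathbb{P}(t_e\in A\mid t_e>0)$.) *)

(* Defs.v *)
From HB Require Import structures.
From mathcomp Require Import all_boot all_order all_algebra.
From mathcomp Require Import all_classical all_reals all_analysis.
Set Implicit Arguments.
Unset Strict Implicit.
Unset Printing Implicit Defensive.
Import Order.TTheory GRing.Theory Num.Theory.
Import numFieldNormedType.Exports.
Local Open Scope classical_set_scope.
Local Open Scope ring_scope.

Definition vertex := (int * int)%type.

(* Nearest-neighbour edges of Z^2: (x, false) is the edge {x, x + (1,0)},
   (x, true) is the edge {x, x + (0,1)}.  This is a bijection with E^2. *)
Definition edge := (vertex * bool)%type.

Definition adj : rel vertex := fun x y =>
  (`|x.1 - y.1| + `|x.2 - y.2| == 1 :> int).

Definition edge_of (x y : vertex) : edge :=
  if y == (x.1 + 1, x.2) then (x, false)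
  else if x == (y.1 + 1, y.2) then (y, false)
  else if y == (x.1, x.2 + 1) then (x, true)
  else (y, true).

Fixpoint ptime {R : realType} (w : edge -> R) (x : vertex) (s : seq vertex) : R :=
  match s with
  | [::] => 0
  | y :: s' => w (edge_of x y) + ptime w y s'
  end.

Definition passage_time {R : realType} (w : edge -> R) (A B : set vertex) : R :=
  inf [set r | exists (x : vertex) (s : seq vertex),
        [/\ A x, path adj x s, B (last x s) & r = ptime w x s]].

Definition bdbox (n : nat) : set vertex :=
  [set x | Num.max `|x.1| `|x.2| = n%:Z].

Definition Finv {R : realType} (F : R -> R) (t : R) : R :=
  inf [set x | t <= F x].

Definition prod_measurable {R : realType} : set (set (edge -> R)) :=
  <<s \bigcup_(e in [set: edge])
        preimage_set_system [set: edge -> R] (fun w => w e)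
          (measurable : set (set R)) >>.

Definition cylinder {R : realType} (E : set (edge -> R)) : Prop :=
  prod_measurable E /\
  exists S : seq edge, forall w w' : edge -> R,
    (forall e, e \in S -> w e = w' e) -> (E w <-> E w').

Definition mutually_independent {R : realType} {d} {Omega : measurableType d}
  (P : probability Omega R) (t : edge -> Omega -> R) : Prop :=
  forall (S : seq edge) (B : edge -> set R), uniq S ->
    (forall e, measurable (B e)) ->
    P (\bigcap_(e in [set e | e \in S]) (t e @^-1` B e)) =
    (\prod_(e <- S) P (t e @^-1` B e))%E.

Definition config {R : realType} {Omega : Type} (t : edge -> Omega -> R)
  (omega : Omega) : edge -> R := fun e => t e omega.

Definition condP {R : realType} {d} {Omega : measurableType d}
  (P : probability Omega R) (A C : set Omega) : R :=
  fine (P (A `&` C)) / fine (P C).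

Definition origin : vertex := (0, 0).

Definition nu_tilde {R : realType} {d} {Omega : measurableType d}
  (P : probability Omega R) (t : edge -> Omega -> R) (E : set (edge -> R)) : R :=
  limn (fun n : nat => condP P (config t @^-1` E)
          [set omega | passage_time (config t omega) [set origin] (bdbox n) = 0]).

(* Main.v *)
Require Import Defs.
From HB Require Import structures.
From mathcomp Require Import all_boot all_order all_algebra.
From mathcomp Require Import all_classical all_reals all_analysis.
From mathcomp Require Import measurable_realfun.
From mathcomp Require Import zify ring lra.
Set Implicit Arguments.
Unset Strict Implicit.
Unset Printing Implicit Defensive.
Import Order.TTheory GRing.Theory Num.Theory.
Import numFieldNormedType.Exports.
Local Open Scope classical_set_scope.
Local Open Scope ring_scope.

(* Call an edge open when its passage time is zero; open edges form critical
   bond percolation, and U(n, L) = {T(0, bd B(n)) <= L} is decreasing in the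
   passage times.
   The first step is P(U(n, L - s)) = o(P(U(n, L))) for s = a_j.  At every scale
   r = 4^k, by RSW and FKG, with probability bounded below some open cluster K
   separates the spheres of radius r and 2r and does not reach the sphere of
   radius 4r.  When moreover U(n, L - s) holds, resample the closed edges through
   which one leaves K: with probability bounded below they all cost more than
   a_{4k+12} / 2, while the one used by a cheap path costs at most s.  Then
   U(n, L) holds and every path pays a_{4k+12} / 2 at scale k.  On U(n, L) these
   payments add up to at most L, whereas sum_k a_k = oo.
   Consequently, given U(n, L), the origin is joined by open edges to any fixed
   distance: the first closed edge on a cheap path costs at least a_j with high
   probability, and what is left of the path costs at most L - a_j.
   So, given U(n, L), the origin is joined with high probability to an open
   circuit, the hub, in an annulus l < |x| <= u.  Given the hub, E and the rest of
   the cheap path are independent, and P(E | U(n, L)) is close to a mixture of the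
   probabilities P(E | 0 <-> hub).  As in Kesten's construction of the incipient
   infinite cluster, these depend on the hub less and less as l grows, because
   the connection probabilities between circuits at successive scales nearly
   factorise.  Hence P(E | U(n, L)) converges, to a limit that is the same for
   all L >= 0.  RSW is proved following Bollobas and Riordan. *)

(** * Paths in the lattice *)

(** The obstacle in the first step is that keeping K away from radius 4r is unfavourable to cheap
    paths, so FKG goes the wrong way. Independence takes its place: K is explored from its circuit,
    the edges so revealed are made free for the cheap path, and only the outer exits of K are
    resampled. Every path across pays there, while the cheap path loses one edge of cost at most s,
    since it travels inside K for nothing. The index 4k+12 comes from a union bound: of order 16^k
    edges lie within radius 4^(k+1), and a passage time lies strictly between 0 and a_m with
    probability at most 2^(-m). As a_m is nonincreasing, the sum over every fourth index still
    diverges. Splitting a path at the hub takes nothing from the budget L, because the origin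
    reaches the hub at cost zero. The ratios P(E | 0 <-> hub) therefore do not involve L, and one
    limit serves all L. The case L = 0 is the sequence that defines the limit measure, so its
    convergence is proved along the way and not assumed. *)

Definition src (e : edge) : vertex := e.1.
Definition tgt (e : edge) : vertex :=
  if e.2 then (e.1.1, e.1.2 + 1) else (e.1.1 + 1, e.1.2).

Definition nm (x : vertex) : nat := maxn `|x.1|%N `|x.2|%N.

Definition conn (r : rel vertex) (x y : vertex) : Prop :=
  exists s, path r x s /\ last x s = y.

Definition restr (r : rel vertex) (F : pred vertex) : rel vertex :=
  fun a b => [&& r a b, F a & F b].

Lemma adjP x y : adj x y ->
  [\/ y = (x.1 + 1, x.2), x = (y.1 + 1, y.2),
      y = (x.1, x.2 + 1) | x = (y.1, y.2 + 1)].
Proof.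
case: x y => [x1 x2] [y1 y2]; rewrite /adj /= => h.
have : [|| (y1 == x1 + 1) && (y2 == x2), (x1 == y1 + 1) && (x2 == y2),
   (y1 == x1) && (y2 == x2 + 1) | (x1 == y1) && (x2 == y2 + 1)] by lia.
case/or4P => /andP[/eqP e1 /eqP e2]; rewrite e1 e2;
  [exact: Or41|exact: Or42|exact: Or43|exact: Or44].
Qed.

Lemma adj_sym : symmetric adj.
Proof. by move=> x y; rewrite /adj distrC [`|x.2 - _|]distrC. Qed.

Lemma adj_right (i j : int) : adj (i, j) (i + 1, j).
Proof. rewrite /adj /=; lia. Qed.

Lemma adj_up (i j : int) : adj (i, j) (i, j + 1).
Proof. rewrite /adj /=; lia. Qed.

Lemma edge_of_right (i j : int) : edge_of (i, j) (i + 1, j) = ((i, j), false).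
Proof. by rewrite /edge_of /= eqxx. Qed.

Lemma edge_of_left (i j : int) : edge_of (i + 1, j) (i, j) = ((i, j), false).
Proof.
rewrite /edge_of /= eqxx !xpair_eqE.
by have -> : (i == i + 1 + 1) = false by lia.
Qed.

Lemma edge_of_up (i j : int) : edge_of (i, j) (i, j + 1) = ((i, j), true).
Proof.
rewrite /edge_of /= eqxx !xpair_eqE.
by have -> : (i == i + 1) = false by lia.
Qed.

Lemma edge_of_down (i j : int) : edge_of (i, j + 1) (i, j) = ((i, j), true).
Proof.
rewrite /edge_of /= !xpair_eqE.
have -> : (i == i + 1) = false by lia.
have -> : (j == j + 1 + 1) = false by lia.
by rewrite andbF.
Qed.

Lemma edge_ofP x y : adj x y ->
  (src (edge_of x y) = x /\ tgt (edge_of x y) = y) \/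
  (src (edge_of x y) = y /\ tgt (edge_of x y) = x).
Proof.
case: x y => [x1 x2] [y1 y2] /adjP /= [] [-> ->].
- by rewrite edge_of_right; left.
- by rewrite edge_of_left; right.
- by rewrite edge_of_up; left.
- by rewrite edge_of_down; right.
Qed.

Lemma edge_ofC x y : adj x y -> edge_of x y = edge_of y x.
Proof.
case: x y => [x1 x2] [y1 y2] /adjP /= [] [-> ->];
by rewrite ?edge_of_right ?edge_of_left ?edge_of_up ?edge_of_down.
Qed.

Lemma adj_src_tgt e : adj (src e) (tgt e).
Proof. by case: e => [[i j] []]; rewrite /src /tgt /= ?adj_up ?adj_right. Qed.

Lemma edge_of_src_tgt e : edge_of (src e) (tgt e) = e.
Proof.
by case: e => [[i j] []]; rewrite /src /tgt /= ?edge_of_up ?edge_of_right.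
Qed.

Lemma edge_of_ends (F : pred vertex) x y : adj x y ->
  F (src (edge_of x y)) && F (tgt (edge_of x y)) = F x && F y.
Proof. by move=> /edge_ofP[[-> ->]|[-> ->]] //; rewrite andbC. Qed.

Lemma edge_of_touch (F : pred vertex) x y : adj x y ->
  F (src (edge_of x y)) || F (tgt (edge_of x y)) = F x || F y.
Proof. by move=> /edge_ofP[[-> ->]|[-> ->]] //; rewrite orbC. Qed.

Lemma nm_adj x y : adj x y -> (nm y <= (nm x).+1)%N.
Proof. case: x y => [x1 x2] [y1 y2]; rewrite /adj /nm /=; lia. Qed.

Lemma nm0 : nm origin = 0%N.
Proof. by []. Qed.

Lemma bdboxE n x : bdbox n x <-> nm x = n.
Proof.
rewrite /bdbox /nm /=; case: x => a b /=; split => h.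
  by move: h; lia.
by lia.
Qed.

Lemma conn_refl (r : rel vertex) x : conn r x x.
Proof. by exists [::]. Qed.

Lemma conn_step (r : rel vertex) x y : r x y -> conn r x y.
Proof. by move=> h; exists [:: y]; rewrite /= h. Qed.

Lemma conn_trans (r : rel vertex) y x z : conn r x y -> conn r y z -> conn r x z.
Proof.
move=> [s [ps <-]] [s' [ps' <-]]; exists (s ++ s').
by rewrite cat_path ps ps' last_cat.
Qed.

Lemma conn_sub (r r' : rel vertex) x y :
  (forall a b, r a b -> r' a b) -> conn r x y -> conn r' x y.
Proof. by move=> h [s [ps ls]]; exists s; split=> //; apply: sub_path ps. Qed.

Lemma conn_map (f : vertex -> vertex) (r r' : rel vertex) x y :
  (forall a b, r a b -> r' (f a) (f b)) -> conn r x y -> conn r' (f x) (f y).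
Proof.
move=> h [s [ps <-]]; exists (map f s); rewrite last_map; split => //.
by rewrite path_map; apply: sub_path ps.
Qed.

Lemma conn_closed (F : vertex -> Prop) (r : rel vertex) x y :
  (forall u v, F u -> r u v -> F v) -> F x -> conn r x y -> F y.
Proof.
move=> h Fx [s [ps <-]]; elim: s x Fx ps => //= z s IH x Fx /andP[rxz].
by apply: IH; apply: h rxz.
Qed.

Lemma conn_sym (r : rel vertex) x y : symmetric r -> conn r x y -> conn r y x.
Proof.
move=> hr; apply: (conn_closed (F := fun z => conn r z x)); last exact: conn_refl.
move=> u v cu ruv; apply: conn_trans cu; apply: conn_step.
by rewrite hr.
Qed.

Lemma path_first_exit (r : rel vertex) (F : pred vertex) x s :
  path r x s -> F x -> ~~ F (last x s) ->
  exists s1 y s2, [/\ s = s1 ++ y :: s2, all F (x :: s1) & ~~ F y].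
Proof.
elim: s x => [|z s IH] x /=; first by move=> _ ->.
move=> /andP[rxz ps] Fx nl; case: (boolP (F z)) => Fz; last first.
  by exists [::], z, s; rewrite /= Fx.
have [s1 [y [s2 [-> h ny]]]] := IH z ps Fz nl.
by exists (z :: s1), y, s2; split => //; rewrite /= Fx.
Qed.

Lemma path_last_exit (r : rel vertex) (F : pred vertex) x s :
  path r x s -> F x -> ~~ F (last x s) ->
  exists s1 y s2, [/\ s = s1 ++ y :: s2, F (last x s1) & all (predC F) (y :: s2)].
Proof.
move=> + Fx; elim/last_ind: s => [|s z IH]; first by move=> _ /=; rewrite Fx.
rewrite rcons_path last_rcons => /andP[ps rz] nz.
case: (boolP (F (last x s))) => Fl.
  by exists s, z, [::]; rewrite cats1 /= nz.
have [s1 [y [s2 [-> h1 h2]]]] := IH ps Fl.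
exists s1, y, (rcons s2 z); split => //; first by rewrite rcons_cat.
by move: h2 => /= /andP[-> h2]; rewrite all_rcons /= nz h2.
Qed.

Lemma path_restr (r : rel vertex) (F : pred vertex) x s :
  path r x s -> all F (x :: s) -> path (restr r F) x s.
Proof.
elim: s x => //= z s IH x /andP[rxz ps] /and3P[Fx Fz Fs].
by rewrite /restr rxz Fx Fz /=; apply: IH => //=; rewrite Fz.
Qed.

Lemma conn_first_exit (r : rel vertex) (F : pred vertex) x y :
  conn r x y -> F x -> ~~ F y ->
  exists u v, [/\ conn (restr r F) x u, F u, ~~ F v, r u v & conn r v y].
Proof.
move=> [s [ps <-]] Fx ny.
have [s1 [z [s2 [es h nz]]]] := path_first_exit ps Fx ny.
move: ps; rewrite es cat_path /= => /and3P[p1 rz p2].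
exists (last x s1), z; split => //.
- by exists s1; split => //; apply: path_restr.
- by move/allP: h; apply; rewrite mem_last.
- by exists s2; rewrite last_cat.
Qed.

Lemma conn_last_exit (r : rel vertex) (F : pred vertex) x y :
  conn r x y -> F x -> ~~ F y ->
  exists u v, [/\ conn r x u, F u, ~~ F v, r u v & conn (restr r (predC F)) v y].
Proof.
move=> [s [ps <-]] Fx ny.
have [s1 [z [s2 [es h nz]]]] := path_last_exit ps Fx ny.
move: ps; rewrite es cat_path /= => /and3P[p1 rz p2].
exists (last x s1), z; split => //.
- by exists s1.
- by move: nz => /= /andP[].
- by exists s2; rewrite last_cat /=; split => //; apply: path_restr.
Qed.

(** * Planar duality *)

(* [true] means open, that is, of passage time zero. *)
Definition cfg := edge -> bool.

Definition rect (x1 x2 y1 y2 : int) : pred vertex :=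
  fun v => (x1 <= v.1 <= x2) && (y1 <= v.2 <= y2).

Definition ostep (b : cfg) (V : pred vertex) : rel vertex :=
  fun x y => [&& adj x y, b (edge_of x y), V x & V y].

(* The vertex (i, j) of the dual lattice stands for the point
   (i + 1/2, j + 1/2), so that the dual lattice is again indexed by [vertex];
   [dedge e] is the dual edge that crosses [e]. *)
Definition dedge (e : edge) : edge :=
  if e.2 then ((e.1.1 - 1, e.1.2), false) else ((e.1.1, e.1.2 - 1), true).

Definition undual (e : edge) : edge :=
  if e.2 then ((e.1.1, e.1.2 + 1), false) else ((e.1.1 + 1, e.1.2), true).

Lemma dedgeK : cancel dedge undual.
Proof. by case=> [[i j] []]; rewrite /dedge /undual /= subrK. Qed.

Lemma undualK : cancel undual dedge.
Proof. by case=> [[i j] []]; rewrite /dedge /undual /= addrK. Qed.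

Lemma ostep_sym b V : symmetric (ostep b V).
Proof.
move=> x y; rewrite /ostep adj_sym; case: (boolP (adj y x)) => //= axy.
by rewrite (edge_ofC axy) [V x && _]andbC.
Qed.

Lemma conn_osym b V x y : conn (ostep b V) x y -> conn (ostep b V) y x.
Proof. exact/conn_sym/ostep_sym. Qed.

Section Parity.
Implicit Types chi : vertex -> vertex -> bool.

(** Crossing numbers modulo 2 along the path [v :: q]; they take the place of the Jordan curve
    theorem. *)
Fixpoint par chi (v : vertex) (q : seq vertex) : bool :=
  if q is u :: q' then chi v u (+) par chi u q' else false.

Lemma par_eq (r : rel vertex) chi chi' v q :
  (forall a b, r a b -> chi a b = chi' a b) -> path r v q ->
  par chi v q = par chi' v q.
Proof. by move=> h; elim: q v => //= u q IH v /andP[/h -> /IH ->]. Qed.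

Lemma par_add chi chi' v q :
  par (fun a b => chi a b (+) chi' a b) v q = par chi v q (+) par chi' v q.
Proof. by elim: q v => //= u q IH v; rewrite IH -!addbA; congr addb; rewrite addbCA. Qed.

Lemma par_flip (F : pred vertex) v q :
  par (fun a b => F a (+) F b) v q = F v (+) F (last v q).
Proof.
by elim: q v => [|u q IH] v /=; rewrite ?addbb // IH -addbA addKb.
Qed.

End Parity.

(* The number of times a path of the dual lattice crosses the horizontal ray
   going left from a primal vertex changes along a primal edge exactly when
   that edge is crossed. *)
Lemma no_crossing_dual (b d : cfg) (x1 x2 y1 y2 : int) (D : pred vertex) x y u v :
  (forall e, b e -> ~~ d (dedge e)) ->
  (forall w, D w -> x1 <= w.1 < x2) ->
  conn (ostep b (rect x1 x2 y1 y2)) x y ->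
  rect x1 x2 y1 y2 x -> x.1 = x1 -> y.1 = x2 ->
  conn (ostep d D) u v -> u.2 < y1 -> y2 <= v.2 -> False.
Proof.
move=> bd hD cxy rx ex ey [q [pq lq]] hu hv.
pose chi (p a c : vertex) := (a.1 < p.1) && ((a.2 < p.2) (+) (c.2 < p.2)).
pose g p := par (chi p) u q.
have gright i j : b ((i, j), false) -> g (i, j) = g (i + 1, j).
  move=> be; apply: par_eq pq => -[a1 a2] [c1 c2] /and3P[ac dac _].
  have nd := bd _ be; rewrite /chi /=.
  case: (eqVneq a1 i) => [ea|na]; last first.
    by congr (_ && _); lia.
  case/adjP: ac => /= -[ec1 ec2]; subst.
  - by rewrite addbb !andbF.
  - by rewrite addbb !andbF.
  - have n : a2 != j - 1.
      apply/negP => /eqP e; move: dac nd; rewrite e edge_of_up.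
      by rewrite /dedge /= => ->.
    have -> : (a2 < j) = (a2 + 1 < j) by lia.
        by rewrite addbb !andbF.
  - have n : c2 != j - 1.
      apply/negP => /eqP e; move: dac nd; rewrite e edge_of_down.
      by rewrite /dedge /= => ->.
    have -> : (c2 < j) = (c2 + 1 < j) by lia.
        by rewrite addbb !andbF.
have gup i j : y1 <= j -> j + 1 <= y2 -> b ((i, j), true) ->
    g (i, j) = g (i, j + 1).
  move=> j1 j2 be.
  (* Raising the ray by one row changes the crossing numbers by the coboundary of [F], the part of
     row [j] left of column [i]; the only step where this fails crosses the open edge. Along the
     path the coboundary telescopes to the endpoints, neither of which is in that row. *)
  pose F (w : vertex) := [&& w.1 < i, j <= w.2 & w.2 < j + 1].
  have -> : g (i, j) = g (i, j + 1) (+) par (fun a c => F a (+) F c) u q.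
    rewrite /g -par_add; apply: par_eq pq => -[a1 a2] [c1 c2] /and3P[ac dac _].
    have nd := bd _ be; rewrite /chi /F /=.
    case/adjP: ac => /= -[ec1 ec2]; subst.
    + case: (eqVneq a2 j) => [ej|nj].
        have n : a1 != i - 1.
          apply/negP => /eqP e; move: dac nd.
          by rewrite e ej edge_of_right /dedge /= => ->.
        have -> : (a1 + 1 < i) = (a1 < i) by lia.
        by rewrite !addbb !andbF.
      have -> : (j <= a2) && (a2 < j + 1) = false by lia.
      by rewrite !addbb !andbF.
    + case: (eqVneq c2 j) => [ej|nj].
        have n : c1 != i - 1.
          apply/negP => /eqP e; move: dac nd.
          by rewrite e ej edge_of_left /dedge /= => ->.
        have -> : (c1 + 1 < i) = (c1 < i) by lia.
        by rewrite !addbb !andbF.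
      have -> : (j <= c2) && (c2 < j + 1) = false by lia.
      by rewrite !addbb !andbF.
    + by case: (a1 < i) => //=; lia.
    + by case: (c1 < i) => //=; lia.
  rewrite par_flip lq /F.
  have -> : (j <= u.2) = false by lia.
  have -> : (v.2 < j + 1) = false by lia.
  by rewrite !andbF /= addbF.
have gxy : g y = g x.
  apply: (conn_closed (F := fun z => g z = g x) (r := ostep b (rect x1 x2 y1 y2)));
    [|by []|exact: cxy].
  move=> [a1 a2] [c1 c2] <- /and4P[ac bac /= /andP[_ /= ra] /andP[_ /= rc]].
  case/adjP: ac => /= -[ec1 ec2]; subst.
  - by rewrite (gright a1 a2) // -edge_of_right.
  - by rewrite -(gright c1 c2) // -edge_of_left.
  - rewrite -gup // -?edge_of_up //; first by case/andP: ra.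
    by case/andP: rc.
  - rewrite gup // -?edge_of_down //; first by case/andP: rc.
    by case/andP: ra.
have ry : rect x1 x2 y1 y2 y.
  apply: (conn_closed (F := fun z => rect x1 x2 y1 y2 z)
    (r := ostep b (rect x1 x2 y1 y2))) rx cxy.
  by move=> a c _ /and4P[].
(* Dual vertices lie in the columns from [x1] to [x2 - 1]: the ray from [x] meets none of them,
   while the ray from [y] is crossed by the whole path, which passes from below [y] to above it and
   so crosses an odd number of times. *)
have gx : g x = false.
  rewrite /g (par_eq (chi' := fun _ _ => false) _ pq).
    by elim: (q) (u) => //= ? ? ->.
  move=> a c /and4P[_ _ /hD Da _]; rewrite /chi ex.
  by have -> : (a.1 < x1) = false by lia.
have gy : g y = true.
  rewrite /g (par_eq (chi' := fun a c : vertex => (a.2 < y.2) (+) (c.2 < y.2)) _ pq).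
    by rewrite (par_flip (fun a => a.2 < y.2)) lq; move: ry rx; rewrite /rect; lia.
  move=> a c /and4P[_ _ /hD Da _]; rewrite /chi ey.
  by have -> : (a.1 < x2) = true by lia.
by move: gxy; rewrite gx gy.
Qed.

(** Reduction to the bond version: [tgt (dedge e)] is [src e], so an edge whose source avoids [Q]
    and a dual edge whose target is in [Q] never cross. As the dual lattice is shifted by one half,
    one path is prolonged by a step to the right and the other by a step downwards. *)
Lemma no_crossing_disjoint (Q : pred vertex) (x1 x2 y1 y2 : int) x y u v :
  conn (restr (restr adj Q) (rect x1 x2 y1 y2)) u v ->
  Q u -> rect x1 x2 y1 y2 u -> u.2 = y1 -> v.2 = y2 ->
  conn (restr (restr adj (predC Q)) (rect x1 x2 y1 y2)) x y ->
  ~~ Q x -> rect x1 x2 y1 y2 x -> x.1 = x1 -> y.1 = x2 -> False.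
Proof.
move=> cuv Qu ru eu ev cxy Qx rx ex ey.
pose b : cfg := fun e => ~~ Q (src e).
pose d : cfg := fun e => Q (tgt e).
have Qy : ~~ Q y.
  apply: (conn_closed (F := fun z => ~~ Q z)
    (r := (restr (restr adj (predC Q)) (rect x1 x2 y1 y2)))) Qx cxy.
  by move=> a c _ /and3P[/and3P[]].
have ry : rect x1 x2 y1 y2 y.
  apply: (conn_closed (F := fun z => rect x1 x2 y1 y2 z)
    (r := (restr (restr adj (predC Q)) (rect x1 x2 y1 y2)))) rx cxy.
  by move=> a c _ /and3P[].
apply: (@no_crossing_dual b d x1 (x2 + 1) y1 y2
  (fun w => x1 <= w.1 < x2 + 1) x (x2 + 1, y.2) (u.1, u.2 - 1) v) => //.
- case=> [[i j] []]; rewrite /b /d /src /dedge /tgt /= => /negP h;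
    apply/negP => h'; apply: h; move: h'; by rewrite subrK.
- apply: (conn_trans (y := y)).
    apply: conn_sub cxy => a c /and3P[/and3P[ac Qa Qc] ra rc].
    rewrite /ostep ac /b /=; apply/and3P; split.
    + by rewrite /=; case: (edge_ofP ac) => -[-> _].
    + by move: ra; rewrite /rect; lia.
    + by move: rc; rewrite /rect; lia.
  apply: conn_step; case: y ey Qy ry {cxy} => y1' y2' /= -> Qy ry.
  rewrite /ostep adj_right edge_of_right /b /src /= Qy /=.
  by move: ry; rewrite /rect /=; lia.
- by move: rx; rewrite /rect; lia.
- apply: (conn_trans (y := u)); last first.
    apply: conn_sub cuv => a c /and3P[/and3P[ac Qa Qc] ra rc].
    rewrite /ostep ac /d /=; apply/and3P; split.
    + by rewrite /=; case: (edge_ofP ac) => -[_ ->].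
    + by move: ra; rewrite /rect; lia.
    + by move: rc; rewrite /rect; lia.
  apply: conn_step; case: u Qu ru eu {cuv} => u1 u2 /= Qu ru eu.
  have e : (u1, u2) = (u1, u2 - 1 + 1) :> vertex by rewrite subrK.
  rewrite [X in ostep _ _ _ X]e /ostep adj_up edge_of_up /d /tgt /= subrK Qu /=.
  by move: ru; rewrite /rect /=; lia.
- by rewrite /=; lia.
- by rewrite ev.
Qed.

Section Boundary.
Variables (x1 x2 y1 y2 : int) (K : pred vertex).
Let V := rect x1 x2 y1 y2.

(** The dual edges across these form the interface between [K] and its complement. When [K] hangs on
    the left side and its complement on the right side, as assumed below, the interface is connected
    and runs from bottom to top. *)
Definition bd (e : edge) : bool :=
  [&& V (src e), V (tgt e) & K (src e) (+) K (tgt e)].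

Definition dbd : rel vertex :=
  fun u v => adj u v && bd (undual (edge_of u v)).

Lemma dbd_sym : symmetric dbd.
Proof.
move=> u v; rewrite /dbd adj_sym; case: (boolP (adj v u)) => //= h.
by rewrite (edge_ofC h).
Qed.

Lemma dbd_dedge e : bd e -> dbd (src (dedge e)) (tgt (dedge e)).
Proof. by rewrite /dbd adj_src_tgt edge_of_src_tgt dedgeK. Qed.

Hypothesis x12 : x1 <= x2.
Hypothesis y12 : y1 <= y2.
Hypothesis hL : forall y : int, y1 <= y <= y2 -> K (x1, y).
Hypothesis hR : forall y : int, y1 <= y <= y2 -> ~~ K (x2, y).
Hypothesis hK : forall v, V v -> K v ->
  exists l, [/\ l.1 = x1, V l & conn (restr (restr adj K) V) l v].
Hypothesis hN : forall v, V v -> ~~ K v ->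
  exists l, [/\ l.1 = x2, V l & conn (restr (restr adj (predC K)) V) l v].

Variables (e0 : edge) (f : vertex).
Hypothesis bd0 : bd e0.
Hypothesis hf : f = src (dedge e0) \/ f = tgt (dedge e0).

Let comp w : bool := `[< conn dbd f w >].

(* Modulo 2, [phi] has zero sum around every face, hence is the coboundary of
   [G]. *)
Let phi e := bd e && comp (src (dedge e)).

Let comp_step u v : dbd u v -> comp u = comp v.
Proof.
move=> h; apply/asboolP/asboolP => c; apply: conn_trans c _; apply: conn_step => //.
by rewrite dbd_sym.
Qed.

Let phi_tgt e : phi e = bd e && comp (tgt (dedge e)).
Proof.
by rewrite /phi; case: (boolP (bd e)) => //= h; rewrite (comp_step (dbd_dedge h)).
Qed.

(** The dual edges across the four sides of a face share the dual vertex [(i, y)], so [comp] is the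
    same for those in the interface; and around the four corners [K] changes an even number of
    times. *)
Let face (i y : int) : x1 <= i -> i + 1 <= x2 -> y1 <= y -> y + 1 <= y2 ->
  phi ((i, y), false) (+) phi ((i, y + 1), false) =
  phi ((i, y), true) (+) phi ((i + 1, y), true).
Proof.
move=> h1 h2 h3 h4.
rewrite (phi_tgt ((i, y), false)) (phi_tgt ((i, y), true)) /phi.
rewrite /dedge /src /tgt /= !subrK !addrK.
case: (comp (i, y)); last by rewrite !andbF.
rewrite !andbT /bd /src /tgt /= /V /rect /=.
have -> : x1 <= i <= x2 by lia.
have -> : x1 <= i + 1 <= x2 by lia.
have -> : y1 <= y <= y2 by lia.
have -> : y1 <= y + 1 <= y2 by lia.
rewrite /=.
by case: (K (i, y)); case: (K (i + 1, y)); case: (K (i, y + 1)); case: (K _).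
Qed.

Let g (k : nat) (y : int) : bool :=
  \big[addb/false]_(j < k) phi ((x1 + j%:Z, y), false).

Let gS k y : g k.+1 y = g k y (+) phi ((x1 + k%:Z, y), false).
Proof. by rewrite /g big_ord_recr. Qed.

Let g_up k (y : int) : y1 <= y -> y + 1 <= y2 -> x1 + k%:Z <= x2 ->
  g k y (+) g k (y + 1) = phi ((x1 + k%:Z, y), true).
Proof.
move=> h1 h2; elim: k => [|k IH] hk.
  rewrite /g !big_ord0 addr0 /phi /bd /src /tgt /= /V /rect /=.
  by rewrite !hL ?addbb ?andbF //; lia.
have hk' : x1 + k%:Z <= x2 by lia.
rewrite !gS addbACA (IH hk') face //; try lia.
have -> : x1 + k.+1%:Z = x1 + k%:Z + 1 by lia.
by rewrite addbA addbb addFb.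
Qed.

Let G (v : vertex) := g (absz (v.1 - x1)%R) v.2.

Let G_right (i y : int) : x1 <= i -> G (i, y) (+) G (i + 1, y) = phi ((i, y), false).
Proof.
move=> h; rewrite /G /=.
have -> : absz (i + 1 - x1)%R = (absz (i - x1)%R).+1 by lia.
rewrite gS addbA addbb addFb.
by have -> : x1 + (absz (i - x1)%R)%:Z = i by lia.
Qed.

Let G_up (i y : int) : x1 <= i -> i <= x2 -> y1 <= y -> y + 1 <= y2 ->
  G (i, y) (+) G (i, y + 1) = phi ((i, y), true).
Proof.
move=> h1 h2 h3 h4; rewrite /G /= g_up //; last by lia.
by have -> : x1 + (absz (i - x1)%R)%:Z = i by lia.
Qed.

Let G_edge e : V (src e) -> V (tgt e) -> G (src e) (+) G (tgt e) = phi e.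
Proof.
case: e => [[i j] []]; rewrite /V /rect /src /tgt /= => h1 h2.
  by apply: G_up; lia.
by apply: G_right; lia.
Qed.

Let G_adj v w : adj v w -> V v -> V w -> G v (+) G w = phi (edge_of v w).
Proof.
move=> avw hv hw; case: (edge_ofP avw) => -[e1 e2].
  by have := @G_edge (edge_of v w); rewrite e1 e2; apply.
by rewrite addbC; have := @G_edge (edge_of v w); rewrite e1 e2; apply.
Qed.

Let phi_same v w : adj v w -> K v = K w -> phi (edge_of v w) = false.
Proof.
move=> avw kk; rewrite /phi /bd.
by case: (edge_ofP avw) => -[-> ->]; rewrite kk addbb !andbF.
Qed.

Let G_K v : V v -> K v -> G v = false.
Proof.
move=> hv kv; have [l [el Vl c]] := hK hv kv.
apply: (conn_closed (F := fun z => G z = false)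
  (r := (restr (restr adj K) V))) c.
  move=> a c Ga /and3P[/and3P[ac Ka Kc] ra rc].
  by have := G_adj ac ra rc; rewrite phi_same ?Ka ?Kc // Ga addFb.
by rewrite /G el subrr /g big_ord0.
Qed.

Let G_const v : V v -> ~~ K v -> G v = G (x2, y1).
Proof.
move=> hv kv; have [l [el Vl c]] := hN hv kv.
have -> : G v = G l.
  apply: (conn_closed (F := fun z => G z = G l)
  (r := (restr (restr adj (predC K)) V))) c => //.
  move=> a c Ga /and3P[/and3P[ac Ka Kc] ra rc].
  have := G_adj ac ra rc; rewrite (phi_same ac); last first.
    by move: Ka Kc => /= /negPf -> /negPf ->.
  by rewrite Ga; case: (G l); case: (G c).
case: l el Vl {c} => a b /= -> Vl.
have [k [-> hk]] : exists k : nat, b = y1 + k%:Z /\ y1 + k%:Z <= y2.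
  by exists (absz (b - y1)%R); move: Vl; rewrite /V /rect /=; lia.
move: hk.
elim: k => [|k IH] hk; first by rewrite addr0.
rewrite -IH; last by lia.
have -> : y1 + k.+1%:Z = y1 + k%:Z + 1 by lia.
have := @G_up x2 (y1 + k%:Z) x12 (lexx _).
rewrite -edge_of_up phi_same ?adj_up //.
  move=> h; have {h} : G (x2, y1 + k%:Z) (+) G (x2, y1 + k%:Z + 1) = false by apply: h; lia.
  by case: (G _); case: (G _).
by rewrite !(negPf (hR _)) //; lia.
Qed.

Let G0 e : bd e -> phi e = G (x2, y1).
Proof.
move=> be; case/and3P: (be) => V1 V2 Ke; rewrite -G_edge //.
move: Ke; case: (boolP (K (src e))) => k1; case: (boolP (K (tgt e))) => k2 //= _.
  by rewrite G_K // (G_const V2 k2) addFb.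
by rewrite (G_K V2) // (G_const V1 k1) addbF.
Qed.

(** [G] vanishes on [K], which hangs on the left side, and is constant on the complement, which
    hangs on the right side. So [phi] has one value on all boundary edges, and it is true at [e0]:
    the interface has a single component. *)
Let phi1 e : bd e -> comp (src (dedge e)) /\ comp (tgt (dedge e)).
Proof.
move=> be; suff : phi e by move=> pe; split; [case/andP: pe|move: pe; rewrite phi_tgt => /andP[]].
rewrite (G0 be) -(G0 bd0); rewrite /phi bd0 /=.
case: hf => h; last rewrite (comp_step (dbd_dedge bd0)).
  by rewrite -h; apply/asboolP; exact: conn_refl.
by rewrite -h; apply/asboolP; exact: conn_refl.
Qed.

Let flip (y : int) : y1 <= y <= y2 ->
  exists i : int, [/\ x1 <= i, i < x2 & bd ((i, y), false)].
Proof.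
move=> hy; have [n en] : exists n : nat, x2 = x1 + n%:Z.
  by exists (absz (x2 - x1)%R); lia.
have h : forall k : nat, (k <= n)%N -> ~~ K (x1 + k%:Z, y) ->
    exists i : int, [/\ x1 <= i, i < x2 & bd ((i, y), false)].
  elim=> [|k IH] hk; first by rewrite addr0 hL.
  case: (boolP (K (x1 + k%:Z, y))) => k1; last by move=> _; apply: IH => //; lia.
  have -> : x1 + k.+1%:Z = x1 + k%:Z + 1 by lia.
  move=> k2; exists (x1 + k%:Z); split; try lia.
  by rewrite /bd /src /tgt /= k1 (negPf k2) /V /rect /=; lia.
by apply: (h n) => //; rewrite -en; exact: hR.
Qed.

Lemma boundary_bottom : exists p : vertex,
  [/\ p.2 = y1 - 1, x1 <= p.1 < x2 & conn dbd f p].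
Proof.
have [|i [h1 h2 /phi1[c1 c2]]] := flip (y := y1); first by lia.
by exists (i, y1 - 1); split => //=; [rewrite h1|apply/asboolP].
Qed.

Lemma boundary_top : exists p : vertex,
  [/\ p.2 = y2, x1 <= p.1 < x2 & conn dbd f p].
Proof.
have [|i [h1 h2 /phi1[c1 c2]]] := flip (y := y2); first by lia.
exists (i, y2); split => //=; first by rewrite h1.
by move: c2; rewrite /dedge /tgt /= subrK => /asboolP.
Qed.

End Boundary.

(** * Independence and positive association *)

Section ProductMeasurable.
Variable R : realType.
Implicit Types A B : set (edge -> R).

Let G : set (set (edge -> R)) := \bigcup_(e in [set: edge])
  preimage_set_system [set: edge -> R] (fun w => w e) (measurable : set (set R)).

Let sG : sigma_algebra setT (@prod_measurable R).
Proof. exact: smallest_sigma_algebra. Qed.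

Lemma pmC A : prod_measurable A -> prod_measurable (~` A).
Proof. by case: sG => _ h _ mA; rewrite -setTD; exact: h. Qed.

Lemma pm_bigcup (F : (set (edge -> R))^nat) :
  (forall n, prod_measurable (F n)) -> prod_measurable (\bigcup_n F n).
Proof. by case: sG => _ _; apply. Qed.

Lemma pm0 : prod_measurable (set0 : set (edge -> R)).
Proof. by case: sG. Qed.

Lemma pmT : prod_measurable (setT : set (edge -> R)).
Proof. by rewrite -setC0; apply: pmC; exact: pm0. Qed.

Lemma pmU A B : prod_measurable A -> prod_measurable B -> prod_measurable (A `|` B).
Proof.
move=> mA mB; rewrite -bigcup2E; apply: pm_bigcup => -[|[|n]]; rewrite /bigcup2 /=;
  [exact: mA|exact: mB|exact: pm0].
Qed.

Lemma pmI A B : prod_measurable A -> prod_measurable B -> prod_measurable (A `&` B).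
Proof.
by move=> mA mB; rewrite -[A]setCK -[B]setCK -setCU; apply: pmC; apply: pmU; apply: pmC.
Qed.

Lemma pmD A B : prod_measurable A -> prod_measurable B -> prod_measurable (A `\` B).
Proof. by move=> mA mB; rewrite setDE; apply: pmI => //; exact: pmC. Qed.

Lemma pm_const (Q : Prop) : prod_measurable [set w : edge -> R | Q].
Proof.
have [q|q] := pselect Q.
  have -> : [set w : edge -> R | Q] = setT by apply/seteqP; split.
  exact: pmT.
have -> : [set w : edge -> R | Q] = set0 by apply/seteqP; split.
exact: pm0.
Qed.

Lemma pm_exists (I : countType) (F : I -> set (edge -> R)) :
  (forall i, prod_measurable (F i)) -> prod_measurable [set w | exists i, F i w].
Proof.
move=> mF; rewrite (_ : [set _ | _] = \bigcup_n
   (if unpickle n is Some i then F i else set0)).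
  by apply: pm_bigcup => n; case: unpickle => [i|]; [exact: mF|exact: pm0].
apply/seteqP; split => [w [i Fi]|w [n _]] /=.
  by exists (pickle i) => //; rewrite pickleK.
by case: unpickle => // i Fi; exists i.
Qed.

Lemma pm_coord e (B : set R) : measurable B -> prod_measurable [set w | B (w e)].
Proof.
move=> mB; apply: sub_sigma_algebra; exists e => //; exists B => //.
by rewrite setTI.
Qed.

Lemma pm_preimage (T : Type) (S : set (set T)) (f : T -> edge -> R) A :
  sigma_algebra setT S ->
  (forall e (B : set R), measurable B -> S [set x | B (f x e)]) ->
  prod_measurable A -> S (f @^-1` A).
Proof.
move=> [S0 SC SU] hf; apply: (smallest_sub (C := sigma_algebra setT)
    (X := [set A | S (f @^-1` A)])); last first.
  by move=> _ [e _ [B mB <-]] /=; rewrite preimage_setI preimage_setT setTI; exact: hf.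
split => [|A0 SA|F SF] /=.
- by rewrite preimage_set0.
- by rewrite setTD preimage_setC -setTD; exact: SC.
- by rewrite preimage_bigcup; exact: SU.
Qed.

End ProductMeasurable.

Section Pr.
Variables (R : realType) (d : measure_display) (Omega : measurableType d)
  (P : probability Omega R) (t : edge -> Omega -> R).
Hypothesis t_meas : forall e, measurable_fun [set: Omega] (t e).
Hypothesis t_nonneg : forall e omega, 0 <= t e omega.
Hypothesis t_indep : mutually_independent P t.

Implicit Types A B : set (edge -> R).

Let t_preim e (B : set R) : measurable B -> measurable (t e @^-1` B).
Proof. by move=> mB; rewrite -[X in measurable X]setTI; exact: t_meas. Qed.

Lemma config_measurable A : prod_measurable A -> measurable (config t @^-1` A).
Proof.
apply: pm_preimage; first exact: sigma_algebra_measurable.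
by move=> e B mB; exact: t_preim.
Qed.

Definition pr A : R := fine (P (config t @^-1` A)).

Definition nonneg (w : edge -> R) := forall e, 0 <= w e.

Lemma config_nonneg omega : nonneg (config t omega).
Proof. by move=> e; exact: t_nonneg. Qed.

Let PE A : prod_measurable A -> P (config t @^-1` A) = (pr A)%:E.
Proof.
by move=> mA; rewrite fineK // fin_num_measure //; exact: config_measurable.
Qed.

Lemma pr_ge0 A : 0 <= pr A.
Proof. by rewrite /pr fine_ge0. Qed.

Lemma prT : pr setT = 1.
Proof. by rewrite /pr preimage_setT probability_setT. Qed.

Lemma pr_le A B : prod_measurable A -> prod_measurable B ->
  (forall w, nonneg w -> A w -> B w) -> pr A <= pr B.
Proof.
move=> mA mB AB; rewrite -lee_fin -!PE //.
apply: le_measure; rewrite ?inE; try exact: config_measurable.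
by move=> omega /=; apply: AB; exact: config_nonneg.
Qed.

Lemma pr_eq A B : prod_measurable A -> prod_measurable B ->
  (forall w, nonneg w -> A w <-> B w) -> pr A = pr B.
Proof.
by move=> mA mB AB; apply/eqP; rewrite eq_le !pr_le // => w nw /AB; apply.
Qed.

Lemma prID A B : prod_measurable A -> prod_measurable B ->
  pr A = pr (A `&` B) + pr (A `\` B).
Proof.
move=> mA mB; apply: EFin_inj; rewrite EFinD -!PE //; last 2 first.
- exact: pmD.
- exact: pmI.
rewrite addeC [in LHS](measureDI P (B := config t @^-1` B)) //.
- exact: config_measurable.
- exact: config_measurable.
Qed.

Definition depw (S : pred edge) A := forall w w' : edge -> R,
  (forall e, S e -> w e = w' e) -> A w -> A w'.

Definition loc S A := prod_measurable A /\ depw S A.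

Let gen (S : pred edge) : set (set Omega) :=
  [set X | exists (s : seq edge) (B : edge -> set R),
    [/\ uniq s, all S s, forall e, measurable (B e) &
        X = \bigcap_(e in [set e | e \in s]) (t e @^-1` B e)]].

Let gen_sub S X : gen S X -> measurable X.
Proof.
move=> [s [B [us Ss mB ->]]]; apply: fin_bigcap_measurable.
  exact: finite_seq.
by move=> e _; exact: t_preim.
Qed.

Let gen_setI S : setI_closed (gen S).
Proof.
move=> _ _ [s [B [us Ss mB ->]]] [s' [B' [us' Ss' mB' ->]]].
exists (undup (s ++ s')), (fun e => (if e \in s then B e else setT) `&`
  (if e \in s' then B' e else setT)); split.
- exact: undup_uniq.
- by apply/allP => e; rewrite mem_undup mem_cat => /orP[/(allP Ss)|/(allP Ss')].
- by move=> e; apply: measurableI; case: ifP.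
- apply/seteqP; split => [omega [h h'] e /=|omega h].
    rewrite mem_undup mem_cat => _; split; case: ifP => // es.
      exact: h.
    exact: h'.
  by split => e /= es; have := h e; rewrite /= mem_undup mem_cat es ?orbT;
    move=> /(_ isT) [].
Qed.

Let gen_setT S : gen S setT.
Proof.
exists [::], (fun=> setT); split => //.
by apply/seteqP; split.
Qed.

Let loc_gen S A : loc S A -> <<s gen S >> (config t @^-1` A).
Proof.
move=> [mA dA].
(* [A] reads only the coordinates in [S]; freezing the others at 0 leaves it unchanged and makes it
   measurable with respect to the coordinates in [S]. *)
pose f omega e := if S e then t e omega else 0.
have -> : config t @^-1` A = f @^-1` A.
  by apply/seteqP; split => omega; apply: dA => e Se; rewrite /f Se.
have sg : sigma_algebra setT <<s gen S >> by exact: smallest_sigma_algebra.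
apply: (pm_preimage sg _ mA).
move=> e B mB; rewrite /f.
case: (boolP (S e)) => Se.
  apply: sub_sigma_algebra.
  exists [:: e], (fun=> B); split => //=; first by rewrite Se.
  apply/seteqP; split => [omega Bo e'|omega /(_ e)] /=.
    by rewrite inE => /eqP ->.
  by rewrite inE eqxx; apply.
have [B0|B0] := pselect (B 0).
  have -> : [set x : Omega | B 0] = setT by apply/seteqP; split.
  apply: sub_sigma_algebra; exact: gen_setT.
have -> : [set x : Omega | B 0] = set0 by apply/seteqP; split.
by case: sg.
Qed.

Let indep_gen (S S' : pred edge) X Y : (forall e, S e -> ~~ S' e) ->
  gen S X -> gen S' Y -> P (X `&` Y) = (P X * P Y)%E.
Proof.
move=> SS' [s [B [us Ss mB ->]]] [s' [B' [us' Ss' mB' ->]]].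
pose C e := if e \in s then B e else B' e.
have mC e : measurable (C e) by rewrite /C; case: ifP.
have ss' e : e \in s' -> (e \in s) = false.
  move=> es'; apply/negP => es.
  by have := SS' e (allP Ss e es); rewrite (allP Ss' e es').
have u : uniq (s ++ s').
  rewrite cat_uniq us us' /= andbT; apply/hasPn => e es'.
  by apply/negP => es; rewrite (ss' e es') in es.
have := t_indep u mC.
rewrite big_cat /=.
rewrite [X in (X * _)%E](eq_big_seq (fun e => P (t e @^-1` B e))); last first.
  by move=> e es; rewrite /C es.
rewrite [X in (_ * X)%E](eq_big_seq (fun e => P (t e @^-1` B' e))); last first.
  by move=> e es; rewrite /C ss'.
rewrite -(t_indep us mB) -(t_indep us' mB') => <-; congr (P _).
apply/seteqP; split => [omega [h h'] e|omega h].
  rewrite /= mem_cat /C; case: ifP => es /=; first by move=> _; exact: h.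
  by exact: h'.
split => e /= es; have := h e; rewrite /= mem_cat es ?orbT => /(_ isT).
  by rewrite /C es.
by rewrite /C ss'.
Qed.

(** The finite measures [P (X & Y)] and [P Y * P X] in [X] agree on a generating pi-system, hence
    everywhere. Used once for each of the two events. *)
Let indep_ext S Y : measurable Y ->
  (forall X, gen S X -> P (X `&` Y) = (P X * P Y)%E) ->
  forall X, <<s gen S >> X -> P (X `&` Y) = (P X * P Y)%E.
Proof.
move=> mY h X gX.
have Y0 : 0 <= fine (P Y) by exact: fine_ge0.
pose m2 := mscale (NngNum Y0) P.
rewrite muleC -[P Y]fineK; last by rewrite fin_num_measure.
change (mrestr P mY X = m2 X).
apply: (@g_sigma_algebra_measure_unique _ _ _ (gen S) _ (fun=> setT)) gX => //.
- by move=> Z; exact: gen_sub.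
- by rewrite bigcup_const //; exists 0%N.
- move=> Z gZ; change (P (Z `&` Y) = ((fine (P Y))%:E * P Z)%E).
  by rewrite h // muleC fineK // fin_num_measure.
- move=> _; change (P (setT `&` Y) < +oo)%E; rewrite setTI;
  apply: le_lt_trans (probability_le1 _ mY) _.
  exact: ltry.
Qed.

Let sgen_sub S X : <<s gen S >> X -> measurable X.
Proof.
apply: (smallest_sub (C := sigma_algebra setT)).
  exact: sigma_algebra_measurable.
exact: gen_sub.
Qed.

Lemma pr_indep (S S' : pred edge) A B : loc S A -> loc S' B -> (forall e, S e -> ~~ S' e) ->
  pr (A `&` B) = pr A * pr B.
Proof.
move=> lA lB SS'; have [mA _] := lA; have [mB _] := lB.
apply: EFin_inj; rewrite EFinM -!PE //; last exact: pmI.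
rewrite preimage_setI.
have gA := loc_gen lA; have gB := loc_gen lB.
apply: indep_ext gA; first exact: sgen_sub gB.
move=> X gX; rewrite setIC muleC; apply: indep_ext gB; first exact: gen_sub gX.
move=> Y gY; rewrite setIC muleC; exact: indep_gen SS' gX gY.
Qed.

End Pr.

(* What the argument uses of the law of the passage times. *)
Structure iid_law (R : realType) := IidLaw {
  lpr :> set (edge -> R) -> R;
  lpr_ge0 : forall A, 0 <= lpr A;
  lprT : lpr setT = 1;
  lpr_le : forall A B, prod_measurable A -> prod_measurable B ->
    (forall w, nonneg w -> A w -> B w) -> lpr A <= lpr B;
  lprID : forall A B, prod_measurable A -> prod_measurable B ->
    lpr A = lpr (A `&` B) + lpr (A `\` B);
  lpr_indep : forall (S S' : pred edge) A B, loc S A -> loc S' B ->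
    (forall e, S e -> ~~ S' e) -> lpr (A `&` B) = lpr A * lpr B;
  lpr_zero : forall e, lpr [set w | w e = 0] = 2^-1 }.

Definition fin (S : pred edge) := exists s : seq edge, forall e, S e -> e \in s.

Lemma finS (S S' : pred edge) : (forall e, S e -> S' e) -> fin S' -> fin S.
Proof. by move=> h [s hs]; exists s => e /h /hs. Qed.

Definition upd (T : Type) (b : edge -> T) (e : edge) (v : T) : edge -> T :=
  fun e' => if e' == e then v else b e'.

Definition bdep (S : pred edge) (B : set cfg) := forall b b' : cfg,
  (forall e, S e -> b e = b' e) -> B b -> B b'.

Definition binc (B : set cfg) := forall b b' : cfg,
  (forall e, b e -> b' e) -> B b -> B b'.

Definition rst (S : pred edge) (b : cfg) : cfg := fun e => S e && b e.

Lemma bdepS (S S' : pred edge) B : (forall e, S e -> S' e) -> bdep S B -> bdep S' B.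
Proof. by move=> h hB b b' bb'; apply: hB => e /h /bb'. Qed.

Lemma bdepI S A B : bdep S A -> bdep S B -> bdep S (A `&` B).
Proof. by move=> hA hB b b' bb' [Ab Bb]; split; [apply: hA bb' Ab|apply: hB bb' Bb]. Qed.

Lemma bdepC S A : bdep S A -> bdep S (~` A).
Proof. by move=> hA b b' bb' nA Ab'; apply: nA; apply: hA Ab' => e /bb'. Qed.

Lemma bdep_rst (T : Type) S (g : cfg -> T) k : bdep S [set b | g (rst S b) = k].
Proof.
move=> b b' bb' /= <-; congr g; apply/funext => e; rewrite /rst.
by case: (boolP (S e)) => //= /bb' ->.
Qed.

Lemma bincI A B : binc A -> binc B -> binc (A `&` B).
Proof. by move=> hA hB b b' bb' [Ab Bb]; split; [apply: hA bb' Ab|apply: hB bb' Bb]. Qed.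

Lemma rst_finite S : fin S ->
  exists ks : seq cfg, uniq ks /\ forall b, rst S b \in ks.
Proof.
move=> [s hs].
suff [ks hk] : exists ks : seq cfg, forall b, rst S b \in ks.
  by exists (undup ks); split; [exact: undup_uniq|move=> b; rewrite mem_undup].
suff [ks hk] : exists ks : seq cfg, forall b : cfg, (forall e, b e -> e \in s) -> b \in ks.
  by exists ks => b; apply: hk => e /andP[/hs].
elim: s {hs} => [|e s [ks hk]].
  exists [:: fun=> false] => b hb; rewrite inE; apply/eqP/funext => e.
  by apply/negP => /hb.
exists (ks ++ [seq upd b e true | b <- ks]) => b hb.
rewrite mem_cat; case: (boolP (b e)) => be; last first.
  apply/orP; left; apply: hk => e' be'; have := hb e' be'.
  by rewrite inE => /orP[/eqP ee'|//]; rewrite -ee' be' in be.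
apply/orP; right; apply/mapP; exists (upd b e false).
  apply: hk => e'; rewrite /upd; case: eqP => // ee' be'.
  by have := hb e' be'; rewrite inE => /orP[/eqP|].
by apply/funext => e'; rewrite /upd; case: eqP => // ->.
Qed.

Section Binary.
Variable R : realType.

Definition bin (w : edge -> R) : cfg := fun e => w e == 0.

Definition bev (B : set cfg) : set (edge -> R) := [set w | B (bin w)].

Lemma bevI A B : bev (A `&` B) = bev A `&` bev B.
Proof. by []. Qed.

Lemma pm_zero e : prod_measurable [set w : edge -> R | w e = 0].
Proof. by apply: (@pm_coord R e [set 0]); exact: measurable_set1. Qed.

Lemma loc_zero e : loc (pred1 e) [set w : edge -> R | w e = 0].
Proof. by split; [exact: pm_zero|move=> w w' /(_ e (eqxx _)) /= ->]. Qed.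

Lemma locS (S S' : pred edge) (A : set (edge -> R)) :
  (forall e, S e -> S' e) -> loc S A -> loc S' A.
Proof. by move=> h [mA dA]; split => // w w' ww'; apply: dA => e /h /ww'. Qed.

Lemma locI S (A B : set (edge -> R)) : loc S A -> loc S B -> loc S (A `&` B).
Proof.
move=> [mA dA] [mB dB]; split; first exact: pmI.
by move=> w w' ww' [Aw Bw]; split; [apply: dA ww' Aw|apply: dB ww' Bw].
Qed.

Lemma locC S (A : set (edge -> R)) : loc S A -> loc S (~` A).
Proof.
move=> [mA dA]; split; first exact: pmC.
by move=> w w' ww' nA Aw'; apply: nA; apply: dA Aw' => e /ww'.
Qed.

Lemma locD S (A B : set (edge -> R)) : loc S A -> loc S B -> loc S (A `\` B).
Proof. by move=> lA lB; rewrite setDE; apply: locI => //; exact: locC. Qed.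

Lemma locT S : loc S (setT : set (edge -> R)).
Proof. by split => //; exact: pmT. Qed.

Lemma pm_bev S B : fin S -> bdep S B -> prod_measurable (bev B).
Proof.
move=> [s hs] /(bdepS hs) {hs}; elim: s B => [|e s IH] B hB.
  have [B0|B0] := pselect (B (fun=> false)).
    have -> : bev B = setT by apply/seteqP; split => // w _; apply: hB B0.
    exact: pmT.
  have -> : bev B = set0.
    by apply/seteqP; split => // w Bw; apply: B0; apply: hB Bw.
  exact: pm0.
have IH' v : prod_measurable (bev [set b | B (upd b e v)]).
  apply: IH => b b' bb' /=; apply: hB => e'; rewrite inE /upd.
  by case: eqP => //= _ /bb'.
have -> : bev B = ([set w | w e = 0] `&` bev [set b | B (upd b e true)]) `|`
    (~` [set w | w e = 0] `&` bev [set b | B (upd b e false)]).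
  have ue (b : cfg) v : b e = v -> upd b e v = b.
    by move=> be; apply/funext => e'; rewrite /upd; case: eqP => [->|].
  apply/seteqP; split => [w Bw|w [] [/= w0]]; rewrite /bev /=.
  - have [w0|w0] := pselect (w e = 0).
      by left; split => //=; rewrite ue // /bin w0 eqxx.
    by right; split => //=; rewrite ue // /bin; apply/eqP.
  - by rewrite ue // /bin w0 eqxx.
  - by rewrite ue // /bin; apply/eqP.
apply: pmU; apply: pmI => //; try exact: pm_zero.
by apply: pmC; exact: pm_zero.
Qed.

Lemma loc_bev S B : fin S -> bdep S B -> loc S (bev B).
Proof.
move=> fS hB; split; first exact: pm_bev fS hB.
by move=> w w' ww'; apply: hB => e Se; rewrite /bin ww'.
Qed.

Lemma loc_upd e v (S : pred edge) (U : set (edge -> R)) : loc S U ->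
  loc (fun e' => S e' && (e' != e)) [set w | U (upd w e v)].
Proof.
move=> [mU dU]; split.
  have sg : sigma_algebra setT (@prod_measurable R) by exact: smallest_sigma_algebra.
  apply: (pm_preimage sg _ mU (f := fun w => upd w e v)) => e' B mB; rewrite /upd.
  by case: eqP => _; [exact: pm_const|exact: pm_coord].
move=> w w' ww'; apply: dU => e' Se'; rewrite /upd.
by case: eqP => // /eqP ne; apply: ww'; rewrite Se' ne.
Qed.

Variable mu : iid_law R.
Implicit Types A B U : set (edge -> R).

Definition bpr (B : set cfg) : R := mu (bev B).

Lemma lpr_eq A B : prod_measurable A -> prod_measurable B ->
  (forall w, nonneg w -> A w <-> B w) -> mu A = mu B.
Proof.
by move=> mA mB AB; apply/eqP; rewrite eq_le !lpr_le // => w nw /AB; apply.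
Qed.

Lemma lpr0 : mu set0 = 0.
Proof.
have := lprID mu (@pmT R) (@pmT R); rewrite setIT setDv lprT => /eqP.
by rewrite -subr_eq0 opprD addrA subrr add0r oppr_eq0 => /eqP.
Qed.

Lemma lpr_le1 A : prod_measurable A -> mu A <= 1.
Proof. by move=> mA; rewrite -(lprT mu); apply: lpr_le => //; exact: pmT. Qed.

Lemma lprU A B : prod_measurable A -> prod_measurable B ->
  (forall w, A w -> ~ B w) -> mu (A `|` B) = mu A + mu B.
Proof.
move=> mA mB AB; rewrite (lprID _ (pmU mA mB) mA); congr (mu _ + mu _).
  by apply/seteqP; split => [w []//|w Aw]; split => //; left.
by apply/seteqP; split => [w [[//|]]|w Bw]; [|split; [right|move=> /AB]].
Qed.

Lemma lpr_leU A B : prod_measurable A -> prod_measurable B ->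
  mu (A `|` B) <= mu A + mu B.
Proof.
move=> mA mB; rewrite (lprID _ (pmU mA mB) mA); apply: lerD.
  by apply: lpr_le => //; [apply: pmI => //; exact: pmU|move=> w _ []].
by apply: lpr_le => //; [apply: pmD => //; exact: pmU|move=> w _ [[]]].
Qed.

Lemma lprC A : prod_measurable A -> mu (~` A) = 1 - mu A.
Proof.
move=> mA; have := lprID mu (@pmT R) mA.
by rewrite setTI setTD lprT => ->; rewrite addrC addKr.
Qed.

Lemma lpr_zeroI e (S : pred edge) A : loc S A -> ~~ S e ->
  mu (A `&` [set w | w e = 0]) = mu A / 2.
Proof.
move=> lA Se; rewrite (lpr_indep _ lA (loc_zero e)) ?lpr_zero //.
by move=> e' Se'; apply/negP => /eqP ee'; rewrite -ee' Se' in Se.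
Qed.

Lemma bpr_split S (B : set cfg) e : fin S -> bdep S B ->
  bpr B = (bpr [set b | B (upd b e true)] + bpr [set b | B (upd b e false)]) / 2.
Proof.
move=> fS hB.
pose S' e' := S e' && (e' != e).
have fS' : fin S' by apply: finS fS => e' /andP[].
have hB' v : bdep S' [set b | B (upd b e v)].
  move=> b b' bb' /=; apply: hB => e' Se'; rewrite /upd.
  by case: eqP => // /eqP ne; apply: bb'; rewrite /S' Se'.
have l v := loc_bev fS' (hB' v).
have ne : ~~ S' e by rewrite /S' eqxx andbF.
have ue (b : cfg) v : b e = v -> upd b e v = b.
  by move=> be; apply/funext => e'; rewrite /upd; case: eqP => [->|].
rewrite /bpr (lprID _ (pm_bev fS hB) (pm_zero e)) mulrDl; congr (_ + _).
  rewrite -(lpr_zeroI (l true) ne); congr (mu _).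
  apply/seteqP; split => w [Bw /= w0]; split => //; move: Bw; rewrite /bev /= ue //.
    by rewrite /bin w0 eqxx.
  by rewrite /bin w0 eqxx.
have m0 := proj1 (l false).
have -> : mu (bev [set b | B (upd b e false)]) / 2 =
    mu (bev [set b | B (upd b e false)] `\` [set w | w e = 0]).
  have := lprID mu m0 (pm_zero e); rewrite (lpr_zeroI (l false) ne) => h.
  by lra.
congr (mu _); apply/seteqP; split => w [Bw /= w0]; split => //; move: Bw;
  rewrite /bev /= ue //; by rewrite /bin; apply/eqP.
Qed.

Lemma bpr_const S (B : set cfg) : fin S -> bdep S B -> (forall e, ~~ S e) ->
  bpr B = if `[< B (fun=> false) >] then 1 else 0.
Proof.
move=> fS hB S0; rewrite /bpr; case: asboolP => B0.
  have -> : bev B = setT.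
    by apply/seteqP; split => // w _; apply: hB B0 => e; rewrite (negPf (S0 e)).
  exact: lprT.
have -> : bev B = set0.
  apply/seteqP; split => // w Bw; apply: B0.
  by apply: hB Bw => e; rewrite (negPf (S0 e)).
exact: lpr0.
Qed.

(** Besides relabelling by [f], the flag [s] exchanges open and closed. The law is invariant under
    this exchange because both have probability 1/2, which is the source of self-duality. *)
Lemma bpr_sym (f : edge -> edge) (s : bool) S (B : set cfg) : injective f -> fin S -> bdep S B ->
  bpr [set b | B (fun e => s (+) b (f e))] = bpr B.
Proof.
move=> injf [l hl] /(bdepS hl) {hl}; elim: l B => [|e l IH] B hB.
  have f0 : fin [in [::]] by exists [::].
  rewrite (bpr_const f0 hB) // (bpr_const (S := [in [::]]) f0) //.
    congr (if _ then _ else _); apply: asbool_equiv_eq => /=.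
    by split; apply: hB.
  by move=> b b' _; apply: hB.
have fl : fin [in e :: l] by exists (e :: l).
have fl' : fin [in map f (e :: l)] by exists (map f (e :: l)).
have hB' : bdep [in map f (e :: l)] [set b | B (fun e => s (+) b (f e))].
  move=> b b' bb' /=; apply: hB => e' el; congr (_ (+) _); apply: bb'.
  exact: map_f.
rewrite (bpr_split e fl hB) (bpr_split (f e) fl' hB') /=.
have E v : [set b : cfg | B (fun e0 => s (+) upd b (f e) v (f e0))] =
    [set b : cfg | [set b | B (upd b e (s (+) v))] (fun e => s (+) b (f e))].
  apply/funext => b /=; congr B; apply/funext => e'; rewrite /upd (inj_eq injf).
  by case: (e' == e).
have hv v : bdep [in l] [set b | B (upd b e v)].
  move=> b b' bb' /=; apply: hB => e'; rewrite inE /upd.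
  by case: eqP => //= _ /bb'.
rewrite !E !IH //; case: s {IH hB' E} => /=; last by [].
by rewrite addrC.
Qed.

(* Induction on the edges on which [B] depends: making one of them open helps [U]
   and costs a factor 1/2. *)
Lemma fkg U S (B : set cfg) : prod_measurable U ->
  (forall w w', nonneg w -> (forall e, w e <= w' e) -> U w' -> U w) ->
  fin S -> bdep S B -> binc B -> mu U * bpr B <= mu (U `&` bev B).
Proof.
move=> mU dU [l hl] /(bdepS hl) {hl}; elim: l B => [|e l IH] B hB iB.
  have f0 : fin [in [::]] by exists [::].
  rewrite (bpr_const f0 hB) //; case: asboolP => B0; last by rewrite mulr0 lpr_ge0.
  rewrite mulr1; apply: lpr_le => //.
    by apply: pmI => //; exact: pm_bev f0 hB.
  by move=> w _ Uw; split => //; apply: hB B0.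
pose Bv v : set cfg := [set b | B (upd b e v)].
have hv v : bdep [in l] (Bv v).
  move=> b b' bb' /=; apply: hB => e'; rewrite inE /upd.
  by case: eqP => //= _ /bb'.
have hv' v : bdep (fun e' => (e' \in l) && (e' != e)) (Bv v).
  move=> b b' bb' /=; apply: hB => e'; rewrite inE /upd.
  by case: eqP => //= /eqP ne el; apply: bb'; rewrite el ne.
have iv v : binc (Bv v).
  move=> b b' bb' /=; apply: iB => e'; rewrite /upd.
  by case: eqP => // _ /bb'.
have fl : fin [in e :: l] by exists (e :: l).
have fl0 : fin [in l] by exists l.
have fl' : fin (fun e' => (e' \in l) && (e' != e)).
  by apply: finS fl0 => e' /andP[].
have B01 : Bv false `<=` Bv true.
  move=> b; apply: iB => e'; rewrite /upd; by case: eqP.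
have ue (b : cfg) v : b e = v -> upd b e v = b.
  by move=> be; apply/funext => e'; rewrite /upd; case: eqP => [->|].
have mv v : prod_measurable (bev (Bv v)) by exact: pm_bev fl0 (hv v).
have mB := pm_bev fl hB.
have mD : prod_measurable (bev (Bv true) `\` bev (Bv false)) by exact: pmD.
have e1 : mu (U `&` bev (Bv false)) +
    mu ((U `&` (bev (Bv true) `\` bev (Bv false))) `&` [set w | w e = 0]) <=
    mu (U `&` bev B).
  rewrite -lprU; first last.
  - by move=> w [_ Bw] [[_ [_]]] + _.
  - by apply: pmI; [exact: pmI|exact: pm_zero].
  - exact: pmI.
  apply: lpr_le; [|exact: pmI|].
    apply: pmU; first exact: pmI.
    by apply: pmI; [exact: pmI|exact: pm_zero].
  move=> w nw [[Uw Bw]|[[Uw [Bw _]] /= w0]]; split => //.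
    have := Bw; rewrite /bev /=; apply: iB => e'; rewrite /upd.
    by case: eqP.
  by move: Bw; rewrite /bev /= /Bv /= ue // /bin w0 eqxx.
(* Putting 0 at [e] enlarges [U] to an event that is independent of [e] and coincides with [U] where
   [e] is open; comparing the two yields the factor 1/2. *)
pose Ue : set (edge -> R) := [set w | U (upd w e 0)].
have lUe : loc (predC1 e) Ue.
  apply: (locS (S := fun e' => predT e' && (e' != e))) => //; apply: loc_upd.
  by split => // w w' ww'; rewrite (_ : w = w') //; apply/funext => e'; exact: ww'.
have lD : loc (predC1 e) (bev (Bv true) `\` bev (Bv false)).
  apply: locD; apply: (locS (S := fun e' => (e' \in l) && (e' != e)));
    try (by move=> e' /andP[]); exact: loc_bev.
have UUe w : nonneg w -> U w -> Ue w.
  move=> nw Uw; apply: dU Uw.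
    by move=> e'; rewrite /upd; case: eqP.
  by move=> e'; rewrite /upd; case: eqP.
have e2 : mu (U `&` (bev (Bv true) `\` bev (Bv false))) / 2 <=
    mu ((U `&` (bev (Bv true) `\` bev (Bv false))) `&` [set w | w e = 0]).
  apply: (@le_trans _ _ (mu (Ue `&` (bev (Bv true) `\` bev (Bv false))) / 2)).
    rewrite ler_pM2r ?invr_gt0 //; apply: lpr_le; [exact: pmI| |].
      by apply: pmI => //; case: lUe.
    by move=> w nw [/(UUe _ nw) Uw Dw].
  rewrite -(@lpr_zeroI e (predC1 e)); last 2 first.
  - exact: locI.
  - by rewrite /= eqxx.
  apply: lpr_le.
  - by apply: pmI; [apply: pmI => //; case: lUe|exact: pm_zero].
  - by apply: pmI; [exact: pmI|exact: pm_zero].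
  move=> w nw [[Uw Dw] w0]; split => //; split => //.
  move: Uw; rewrite /Ue /= (_ : upd w e 0 = w) //.
  by apply/funext => e'; rewrite /upd; case: eqP => // ->.
have e3 : mu (U `&` bev (Bv true)) = mu (U `&` bev (Bv false)) +
    mu (U `&` (bev (Bv true) `\` bev (Bv false))).
  rewrite -lprU.
  - congr (mu _); apply/seteqP; split => [w [Uw Bw]|w [[Uw /B01 //]|[Uw []]//]].
    by have [B0|B0] := pselect (bev (Bv false) w); [left|right].
  - exact: pmI.
  - exact: pmI.
  - by move=> w [_ Bw] [_ []].
have i1 := IH _ (hv true) (iv true).
have i0 := IH _ (hv false) (iv false).
rewrite (bpr_split e fl hB) -/(Bv true) -/(Bv false).
by lra.
Qed.

End Binary.

(** * Crossings of rectangles *)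

Definition edges_in (V : pred vertex) : pred edge := fun e => V (src e) && V (tgt e).

Lemma mem_grid (s s' : seq int) i j : i \in s -> j \in s' ->
  (i, j) \in [seq (x, y) | x <- s, y <- s'].
Proof. by move=> h h'; apply/allpairsP; exists (i, j). Qed.

Lemma mem_grid_edge (s : seq vertex) v (b : bool) : v \in s ->
  ((v, b) : edge) \in [seq (x, y) | x <- s, y <- [:: true; false]].
Proof. by move=> h; apply/allpairsP; exists (v, b); split => //; case: b. Qed.

Lemma fin_rect x1 x2 y1 y2 : fin (edges_in (rect x1 x2 y1 y2)).
Proof.
pose l (a b : int) := [seq a + k%:Z | k <- iota 0 (absz (b - a)%R).+1].
have hl a b i : a <= i <= b -> i \in l a b.
  move=> h; apply/mapP; exists (absz (i - a)%R); last by lia.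
  by rewrite mem_iota; lia.
exists [seq (p, b) | p <- [seq (x, y) | x <- l x1 x2, y <- l y1 y2],
    b <- [:: true; false]] => -[[i j] b].
move=> /andP[/andP[h1 h2] _].
by apply: mem_grid_edge; apply: mem_grid; exact: hl.
Qed.

Lemma fin_sub_rect (V : pred vertex) x1 x2 y1 y2 :
  (forall v, V v -> rect x1 x2 y1 y2 v) -> fin (edges_in V).
Proof.
by move=> h; apply: finS (fin_rect x1 x2 y1 y2) => e /andP[/h h1 /h h2]; apply/andP.
Qed.

Lemma ostep_sub (b b' : cfg) (V V' : pred vertex) x y :
  (forall e, edges_in V e -> b e -> b' e) -> (forall v, V v -> V' v) ->
  ostep b V x y -> ostep b' V' x y.
Proof.
move=> hb hV /and4P[axy bxy Vx Vy]; rewrite /ostep axy (hV x) // (hV y) // !andbT /=.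
by apply: hb => //; rewrite /edges_in edge_of_ends // Vx.
Qed.

Lemma conn_osub (b b' : cfg) (V V' : pred vertex) x y :
  (forall e, edges_in V e -> b e -> b' e) -> (forall v, V v -> V' v) ->
  conn (ostep b V) x y -> conn (ostep b' V') x y.
Proof. by move=> hb hV; apply: conn_sub => u v; exact: ostep_sub. Qed.

Lemma conn_ostep_in (b : cfg) (V : pred vertex) x y :
  V x -> conn (ostep b V) x y -> V y.
Proof.
by move=> Vx; apply: (conn_closed (F := fun v => V v)) => // u v _ /and4P[].
Qed.

Definition hcross (x1 x2 y1 y2 : int) : set cfg := [set b | exists x y,
  [/\ rect x1 x2 y1 y2 x, x.1 = x1, y.1 = x2 & conn (ostep b (rect x1 x2 y1 y2)) x y]].

Definition vcross (x1 x2 y1 y2 : int) : set cfg := [set b | exists x y,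
  [/\ rect x1 x2 y1 y2 x, x.2 = y1, y.2 = y2 & conn (ostep b (rect x1 x2 y1 y2)) x y]].

Lemma bdep_hcross x1 x2 y1 y2 :
  bdep (edges_in (rect x1 x2 y1 y2)) (hcross x1 x2 y1 y2).
Proof.
move=> b b' bb' [x [y [rx ex ey c]]]; exists x, y; split => //.
by apply: conn_osub c => // e /bb' ->.
Qed.

Lemma binc_hcross x1 x2 y1 y2 : binc (hcross x1 x2 y1 y2).
Proof.
move=> b b' bb' [x [y [rx ex ey c]]]; exists x, y; split => //.
by apply: conn_osub c => // e _ /bb'.
Qed.

Lemma bdep_vcross x1 x2 y1 y2 :
  bdep (edges_in (rect x1 x2 y1 y2)) (vcross x1 x2 y1 y2).
Proof.
move=> b b' bb' [x [y [rx ex ey c]]]; exists x, y; split => //.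
by apply: conn_osub c => // e /bb' ->.
Qed.

Lemma binc_vcross x1 x2 y1 y2 : binc (vcross x1 x2 y1 y2).
Proof.
move=> b b' bb' [x [y [rx ex ey c]]]; exists x, y; split => //.
by apply: conn_osub c => // e _ /bb'.
Qed.

Definition graph_hom (phi : vertex -> vertex) (f : edge -> edge) :=
  forall x y, adj x y -> adj (phi x) (phi y) /\ edge_of (phi x) (phi y) = f (edge_of x y).

Lemma conn_hom phi f (b : cfg) (V V' : pred vertex) x y : graph_hom phi f ->
  (forall v, V v -> V' (phi v)) ->
  conn (ostep (fun e => b (f e)) V) x y -> conn (ostep b V') (phi x) (phi y).
Proof.
move=> h hV; apply: conn_map => u v /and4P[auv buv Vu Vv].
by have [a e] := h u v auv; rewrite /ostep a e buv !hV.
Qed.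

Definition shift (a c : int) (v : vertex) : vertex := (v.1 + a, v.2 + c).
Definition eshift (a c : int) (e : edge) : edge := (shift a c e.1, e.2).
Definition vswap (v : vertex) : vertex := (v.2, v.1).
Definition eswap (e : edge) : edge := (vswap e.1, ~~ e.2).
Definition refly (c : int) (v : vertex) : vertex := (v.1, c - v.2).
Definition erefly (c : int) (e : edge) : edge :=
  ((e.1.1, c - e.1.2 - (if e.2 then 1 else 0)), e.2).
Definition reflx (c : int) (v : vertex) : vertex := (c - v.1, v.2).
Definition ereflx (c : int) (e : edge) : edge :=
  ((c - e.1.1 - (if e.2 then 0 else 1), e.1.2), e.2).

Lemma hom_of (phi : vertex -> vertex) (f : edge -> edge) :
  (forall e, adj (phi (src e)) (phi (tgt e)) /\
     edge_of (phi (src e)) (phi (tgt e)) = f e) -> graph_hom phi f.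
Proof.
move=> h x y axy; have [a e] := h (edge_of x y).
case: (edge_ofP axy) => -[e1 e2]; move: a e; rewrite e1 e2 //.
by move=> a e; rewrite adj_sym; split=> //; rewrite -e edge_ofC // adj_sym.
Qed.

Lemma hom_shift a c : graph_hom (shift a c) (eshift a c).
Proof.
apply: hom_of => -[[i j] []]; rewrite /shift /eshift /src /tgt /=.
  by rewrite addrAC adj_up edge_of_up.
by rewrite addrAC adj_right edge_of_right.
Qed.

Lemma hom_swap : graph_hom vswap eswap.
Proof.
apply: hom_of => -[[i j] []]; rewrite /vswap /eswap /src /tgt /=.
  by rewrite adj_right edge_of_right.
by rewrite adj_up edge_of_up.
Qed.

Lemma hom_refly c : graph_hom (refly c) (erefly c).
Proof.
apply: hom_of => -[[i j] []]; rewrite /refly /erefly /src /tgt /=; last first.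
  by rewrite subr0 adj_right edge_of_right.
have -> : c - j = c - (j + 1) + 1 by lia.
by rewrite adj_sym adj_up edge_of_down addrK.
Qed.

Lemma hom_reflx c : graph_hom (reflx c) (ereflx c).
Proof.
apply: hom_of => -[[i j] []]; rewrite /reflx /ereflx /src /tgt /=.
  by rewrite subr0 adj_up edge_of_up.
have -> : c - i = c - (i + 1) + 1 by lia.
by rewrite adj_sym adj_right edge_of_left addrK.
Qed.

Lemma eswapK : involutive eswap.
Proof. by case=> [[i j] b]; rewrite /eswap /vswap /= negbK. Qed.

Lemma eshiftK a c : cancel (eshift a c) (eshift (- a) (- c)).
Proof. by case=> [[i j] b]; rewrite /eshift /shift /= !addrK. Qed.

Lemma eshiftNK a c : cancel (eshift (- a) (- c)) (eshift a c).
Proof. by case=> [[i j] b]; rewrite /eshift /shift /= !subrK. Qed.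

Lemma ereflyK c : involutive (erefly c).
Proof.
by case=> [[i j] []]; rewrite /erefly /=; congr ((_, _), _); lia.
Qed.

Lemma ereflxK c : involutive (ereflx c).
Proof.
by case=> [[i j] []]; rewrite /ereflx /=; congr ((_, _), _); lia.
Qed.

Section BinaryLaw.
Variables (R : realType) (mu : iid_law R).
Local Notation bpr := (bpr mu).

Lemma bpr_le S S' (A B : set cfg) : fin S -> bdep S A -> fin S' -> bdep S' B ->
  (forall b, A b -> B b) -> bpr A <= bpr B.
Proof.
move=> fS hA fS' hB AB; apply: lpr_le; [exact: pm_bev fS hA|exact: pm_bev fS' hB|].
by move=> w _; exact: AB.
Qed.

Lemma bpr_le1 S (A : set cfg) : fin S -> bdep S A -> bpr A <= 1.
Proof. by move=> fS hA; apply: lpr_le1; exact: pm_bev fS hA. Qed.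

Lemma bprC S (A : set cfg) : fin S -> bdep S A -> bpr (~` A) = 1 - bpr A.
Proof. by move=> fS hA; rewrite /bpr -lprC //; exact: pm_bev fS hA. Qed.

Lemma bpr_fkg S S' (A B : set cfg) : fin S -> bdep S A -> binc A ->
  fin S' -> bdep S' B -> binc B -> bpr A * bpr B <= bpr (A `&` B).
Proof.
move=> fS hA iA fS' hB iB; rewrite {3}/bpr bevI; apply: fkg fS' hB iB.
  exact: pm_bev fS hA.
move=> w w' nw ww'; apply: iA => e; rewrite /bin => /eqP w'0.
by apply/eqP/le_anti; rewrite nw -[X in _ <= X]w'0 ww'.
Qed.

Lemma bpr_indep S S' (A B : set cfg) : fin S -> bdep S A -> fin S' -> bdep S' B ->
  (forall e, S e -> ~~ S' e) -> bpr (A `&` B) = bpr A * bpr B.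
Proof.
move=> fS hA fS' hB SS'.
by rewrite /bpr bevI; apply: (lpr_indep _ (loc_bev _ fS hA) (loc_bev _ fS' hB)).
Qed.

(** [g] factors through the restriction to [S], which takes finitely many values, so that
    conditioning on an explored object is a finite sum. *)
Lemma lpr_part (K : choiceType) (S : pred edge) (g : cfg -> K) : fin S ->
  (forall b b', (forall e, S e -> b e = b' e) -> g b = g b') ->
  exists ks : seq K, uniq ks /\ forall X, prod_measurable X ->
    mu X = \sum_(k <- ks) mu (X `&` bev [set b | g b = k]).
Proof.
move=> fS hg; have [l [ul hl]] := rst_finite fS.
have dg k : bdep S [set b | g b = k] by move=> b b' /hg /= ->.
exists (undup (map g l)); split; first exact: undup_uniq.
have hks (b : cfg) : g b \in undup (map g l).
  rewrite mem_undup; have -> : g b = g (rst S b) by apply: hg => e; rewrite /rst => ->.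
  exact: map_f.
have : forall ks : seq K, uniq ks -> forall X, prod_measurable X ->
    mu (X `&` bev [set b | g b \in ks]) = \sum_(k <- ks) mu (X `&` bev [set b | g b = k]).
  elim=> [|k ks IH] /=.
    move=> _ X mX; rewrite big_nil -[RHS](lpr0 mu); congr (mu _).
    by apply/seteqP; split => w [].
  move=> /andP[kks uks] X mX; rewrite big_cons -IH // -lprU.
  - congr (mu _); apply/seteqP; split => w.
      move=> [Xw]; rewrite /bev /= inE => /orP[/eqP|] h; [left|right]; split => //.
    by move=> [[Xw /= h]|[Xw /= h]]; split => //; rewrite /bev /= inE ?h ?eqxx ?orbT.
  - by apply: pmI => //; exact: pm_bev fS (dg k).
  - apply: pmI => //; apply: (pm_bev fS) => b b' /hg /= -> //.
  - by move=> w [_ /= h] [_]; rewrite /bev /= h (negPf kks).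
move=> /(_ _ (undup_uniq _)) h X mX; rewrite -h //; congr (mu _).
by apply/seteqP; split => [w Xw|w []//]; split => //; exact: hks.
Qed.

Lemma lpr_part_le (K : choiceType) (S : pred edge) (g : cfg -> K) V X q : fin S ->
  (forall b b', (forall e, S e -> b e = b' e) -> g b = g b') ->
  prod_measurable V -> prod_measurable X ->
  (forall k, mu (V `&` bev [set b | g b = k]) * q <= mu (X `&` bev [set b | g b = k])) ->
  mu V * q <= mu X.
Proof.
move=> fS hg mV mX h; have [ks [_ hks]] := lpr_part fS hg.
by rewrite (hks _ mV) (hks _ mX) mulr_suml; apply: ler_sum.
Qed.

(** [m] and [k] count edges: the rectangle has [m + 1] columns and [k + 1] rows of vertices. *)
Definition hp (m k : nat) : R := bpr (hcross 0 m%:Z 0 k%:Z).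

Lemma bpr_hcross (x1 x2 y1 y2 : int) (m k : nat) :
  x2 = x1 + m%:Z -> y2 = y1 + k%:Z -> bpr (hcross x1 x2 y1 y2) = hp m k.
Proof.
move=> -> ->; rewrite /hp.
rewrite -(@bpr_sym _ mu (eshift x1 y1) false _ (hcross 0 m 0 k) (can_inj (eshiftK _ _))
   (fin_rect _ _ _ _) (@bdep_hcross _ _ _ _)).
congr (bpr _); apply/seteqP; split => b [x [y [rx ex ey c]]].
  exists (shift (- x1) (- y1) x), (shift (- x1) (- y1) y); split.
  - by move: rx; rewrite /rect /shift /=; lia.
  - by rewrite /= ex subrr.
  - by rewrite /= ey addrAC subrr add0r.
  apply: (conn_hom (hom_shift _ _) (V := rect x1 (x1 + m) y1 (y1 + k))).
    by move=> v; rewrite /rect /shift /=; lia.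
  by apply: conn_osub c => // e _; rewrite eshiftNK.
exists (shift x1 y1 x), (shift x1 y1 y); split.
- by move: rx; rewrite /rect /shift /=; lia.
- by rewrite /= ex add0r.
- by rewrite /= ey addrC.
apply: (conn_hom (hom_shift _ _) (V := rect 0 m 0 k)) c.
by move=> v; rewrite /rect /shift /=; lia.
Qed.

Lemma bpr_vcross (x1 x2 y1 y2 : int) (m k : nat) :
  x2 = x1 + m%:Z -> y2 = y1 + k%:Z -> bpr (vcross x1 x2 y1 y2) = hp k m.
Proof.
move=> hx hy; rewrite -(bpr_hcross (x1 := y1) (x2 := y2) (y1 := x1) (y2 := x2) hy hx).
rewrite -(@bpr_sym _ mu eswap false _ (hcross y1 y2 x1 x2) (can_inj eswapK)
   (fin_rect _ _ _ _) (@bdep_hcross _ _ _ _)).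
congr (bpr _); apply/seteqP; split => b [x [y [rx ex ey c]]].
  exists (vswap x), (vswap y); split => //.
    by move: rx; rewrite /rect /=; lia.
  apply: (conn_hom hom_swap (V := rect x1 x2 y1 y2)).
    by move=> v; rewrite /rect /=; lia.
  by apply: conn_osub c => // e _; rewrite eswapK.
exists (vswap x), (vswap y); split => //.
  by move: rx; rewrite /rect /=; lia.
apply: (conn_hom hom_swap (V := rect y1 y2 x1 x2)) c.
by move=> v; rewrite /rect /=; lia.
Qed.

Lemma hp_ge0 m k : 0 <= hp m k.
Proof. exact: lpr_ge0. Qed.

Lemma hp_mono (m m' k k' : nat) : (m <= m')%N -> (k' <= k)%N -> hp m' k' <= hp m k.
Proof.
move=> mm kk; apply: (bpr_le (fin_rect _ _ _ _) (@bdep_hcross _ _ _ _)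
  (fin_rect _ _ _ _) (@bdep_hcross _ _ _ _)) => b [x [y [rx ex ey c]]].
pose F v := rect 0 m%:Z 0 k'%:Z v.
have sub v : F v -> rect 0 m%:Z 0 k%:Z v by rewrite /F /rect; lia.
have Fx : F x by move: rx; rewrite /F /rect; lia.
have [ymm|ymm] := eqVneq (m%:Z) (m'%:Z).
  exists x, y; split => //; first exact: sub.
    by rewrite ymm.
  by apply: conn_osub c => // v; rewrite /rect; lia.
have nFy : ~~ F y by rewrite /F /rect ey; lia.
have [u [v [cu Fu nFv ruv _]]] := conn_first_exit c Fx nFy.
exists x, u; split => //; first exact: sub.
- case/and4P: ruv => a _ ru rv; move: a ru rv Fu nFv.
  by rewrite /adj /F /rect; case: (u) (v) => [u1 u2] [v1 v2] /=; lia.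
apply: conn_sub cu => p q /and3P[/and4P[apq bpq _ _] Fp Fq].
by rewrite /ostep apq bpq !sub.
Qed.

Lemma bpr_codual S (B : set cfg) : fin S -> bdep S B ->
  bpr [set b | B (fun e => ~~ b (dedge e))] = bpr B.
Proof. by move=> fS hB; have := bpr_sym mu true (can_inj dedgeK) fS hB. Qed.

End BinaryLaw.

(** With [d] read on the dual lattice, this is the primal configuration that it determines. *)
Definition codual (d : cfg) : cfg := fun e => ~~ d (dedge e).

(** * The leftmost dual crossing of a square *)

Section Hull.
Variable n : nat.
Hypothesis n0 : (0 < n)%N.

Let S := rect 0 n%:Z 0 (n%:Z - 1).

Definition lclus (c : cfg) : vertex -> bool :=
  fun v => `[< exists l, [/\ S l, l.1 = 0 & conn (ostep c S) l v] >].

Definition rside (A : vertex -> bool) : vertex -> bool := fun v =>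
  `[< exists r, [/\ S r, r.1 = n%:Z, ~~ A r &
        conn (restr (restr adj (predC A)) S) r v] >].

(** [A] with its holes filled. For the open cluster of the left side this makes the complement hang
    on the right side, so that the interface is connected; the interface is then the leftmost closed
    vertical crossing. *)
Definition hull (A : vertex -> bool) : vertex -> bool := fun v => S v && ~~ rside A v.

Lemma lclus_in c v : lclus c v -> S v.
Proof. by move=> /asboolP[l [Sl _]]; exact: conn_ostep_in. Qed.

Lemma rside_in A v : rside A v -> S v /\ ~~ A v.
Proof.
move=> /asboolP[r [Sr _ nAr]].
apply: (conn_closed (F := fun v => S v /\ ~~ A v)) => // a b _.
by move=> /and3P[/and3P[]].
Qed.

Lemma rside_step A u v : rside A u -> adj u v -> S v -> ~~ A v -> rside A v.
Proof.
move=> h auv Sv nAv; have [Su nAu] := rside_in h.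
move: h => /asboolP[r [Sr er nAr c]]; apply/asboolP; exists r; split => //.
apply: (conn_trans c); apply: conn_step.
by rewrite /restr auv Su Sv !andbT /=; apply/andP.
Qed.

Lemma lclus_hull c v : lclus c v -> hull (lclus c) v.
Proof.
move=> h; rewrite /hull (lclus_in h) /=; apply/negP => /rside_in[_].
by rewrite h.
Qed.

Lemma lclus_left c (y : int) : 0 <= y <= n%:Z - 1 -> lclus c (0, y).
Proof.
by move=> hy; apply/asboolP; exists (0, y); split => //; exact: conn_refl.
Qed.

Lemma hull_left c (y : int) : 0 <= y <= n%:Z - 1 -> hull (lclus c) (0, y).
Proof. by move=> hy; apply/lclus_hull/lclus_left. Qed.

Lemma hull_right c : ~ hcross 0 n%:Z 0 (n%:Z - 1) c ->
  forall y : int, 0 <= y <= n%:Z - 1 -> ~~ hull (lclus c) (n%:Z, y).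
Proof.
move=> nc y hy; rewrite /hull negb_and negbK; apply/orP; right.
have Sn : S (n%:Z, y) by rewrite /S /rect /=; lia.
apply/asboolP; exists (n%:Z, y); split => //; last exact: conn_refl.
apply/negP => /asboolP[l [Sl el cl]]; apply: nc.
by exists l, (n%:Z, y).
Qed.

Lemma hull_rightN c : hcross 0 n%:Z 0 (n%:Z - 1) c ->
  exists2 y : int, 0 <= y <= n%:Z - 1 & hull (lclus c) (n%:Z, y).
Proof.
move=> [x [y [rx ex ey cxy]]]; exists y.2.
  by have := conn_ostep_in rx cxy; rewrite /rect; lia.
rewrite -ey -surjective_pairing; apply: lclus_hull; apply/asboolP.
by exists x.
Qed.

Lemma straight_left (k : nat) (y : int) : (k <= n)%N -> 0 <= y <= n%:Z - 1 ->
  conn (restr adj S) (k%:Z, y) (0, y).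
Proof.
move=> + hy; elim: k => [|k IH] hk; first exact: conn_refl.
apply: conn_trans (IH _); last by lia.
apply: conn_step; rewrite /restr adj_sym.
have -> : k.+1%:Z = k%:Z + 1 by lia.
by rewrite adj_right /S /rect /=; lia.
Qed.

(** A vertex in a hole walks left along its row until it meets the cluster. Up to then it stays in
    the hull, since between adjacent vertices off the cluster there is no step from the hull to the
    right component. *)
Lemma hull_conn c v : S v -> hull (lclus c) v ->
  exists l, [/\ l.1 = 0, S l & conn (restr (restr adj (hull (lclus c))) S) l v].
Proof.
move=> Sv hv.
have inC w : lclus c w -> exists l, [/\ l.1 = 0, S l &
    conn (restr (restr adj (hull (lclus c))) S) l w].
  move=> /asboolP[l [Sl el cl]]; exists l; split => //.
  have [] // : lclus c w /\ conn (restr (restr adj (hull (lclus c))) S) l w.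
  apply: (conn_closed (F := fun w => lclus c w /\
    conn (restr (restr adj (hull (lclus c))) S) l w)) cl.
    move=> a b [la ca] rab; have lb : lclus c b.
      move: la => /asboolP[l' [Sl' el' c']]; apply/asboolP; exists l'; split => //.
      by apply: (conn_trans c'); exact: conn_step.
    split => //; apply: (conn_trans ca); apply: conn_step.
    by case/and4P: rab => aab _ Sa Sb; rewrite /restr aab !lclus_hull // Sa Sb.
  split; last exact: conn_refl.
  by apply/asboolP; exists l; split => //; exact: conn_refl.
case: (boolP (lclus c v)) => [/inC//|lv].
have [k [ek hk]] : exists k : nat, v.1 = k%:Z /\ (k <= n)%N.
  by exists (absz v.1); move: Sv; rewrite /S /rect; lia.
have hy : 0 <= v.2 <= n%:Z - 1 by move: Sv; rewrite /S /rect; lia.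
have := straight_left hk hy; rewrite -ek -surjective_pairing => cv.
have nl : ~~ predC (lclus c) (0, v.2) by rewrite /= negbK lclus_left.
have [u [w [cu lu lw ruw _]]] := conn_first_exit (F := predC (lclus c)) cv lv nl.
have [l [el Sl cl]] : exists l, [/\ l.1 = 0, S l &
    conn (restr (restr adj (hull (lclus c))) S) l w].
  by apply: inC; move: lw; rewrite /= negbK.
exists l; split => //; apply: (conn_trans cl).
have [hu cuv] : hull (lclus c) u /\ conn (restr (restr adj (hull (lclus c))) S) u v.
  apply: (conn_closed (F := fun u => hull (lclus c) u /\
    conn (restr (restr adj (hull (lclus c))) S) u v)) cu; last first.
    by split => //; exact: conn_refl.
  move=> a b [ha ca] /and3P[/and3P[aab Sa Sb] la lb].
  have hb : hull (lclus c) b.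
    rewrite /hull Sb /=; apply/negP => rb; move: ha.
    by rewrite /hull Sa /= (rside_step rb) // adj_sym.
  split => //; apply: conn_trans ca; apply: conn_step.
  by rewrite /restr adj_sym aab hb ha Sa Sb.
apply: conn_trans cuv; apply: conn_step.
case/and3P: ruw => auw Su Sw.
rewrite /restr adj_sym auw hu Su Sw !andbT /=.
by apply: lclus_hull; move: lw; rewrite /= negbK.
Qed.

Lemma hull_conn' c v : S v -> ~~ hull (lclus c) v ->
  exists l, [/\ l.1 = n%:Z, S l &
    conn (restr (restr adj (predC (hull (lclus c)))) S) l v].
Proof.
rewrite /hull => Sv; rewrite Sv /= negbK => hv.
move: (hv) => /asboolP[r [Sr er nAr c']]; exists r; split => //.
have [] // : rside (lclus c) v /\
  conn (restr (restr adj (predC (fun v => S v && ~~ rside (lclus c) v))) S) r v.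
apply: (conn_closed (F := fun v => rside (lclus c) v /\
  conn (restr (restr adj (predC (fun v => S v && ~~ rside (lclus c) v))) S) r v)) c'.
  move=> a b [ha ca] /and3P[/and3P[aab la lb] Sa Sb].
  have hb : rside (lclus c) b by exact: rside_step ha aab Sb lb.
  split => //; apply: (conn_trans ca); apply: conn_step.
  by rewrite /restr aab /= ha hb Sa Sb.
split; last exact: conn_refl.
by apply/asboolP; exists r; split => //; exact: conn_refl.
Qed.

Lemma hull_closed c e : bd 0 n%:Z 0 (n%:Z - 1) (hull (lclus c)) e -> ~~ c e.
Proof.
move=> /and3P[S1 S2 Ke]; apply/negP => ce.
have key x y : adj x y -> edge_of x y = e -> S x -> S y -> hull (lclus c) x ->
    ~~ hull (lclus c) y -> False.
  move=> axy ee Sx Sy hx; rewrite /hull Sy /= negbK => ry.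
  have [_ ny] := rside_in ry.
  case: (boolP (lclus c x)) => lx; last first.
    by move: hx; rewrite /hull Sx (rside_step ry) // adj_sym.
  move: ny; have -> // : lclus c y.
  move: lx => /asboolP[l [Sl el cl]]; apply/asboolP; exists l; split => //.
  apply: (conn_trans cl); apply: conn_step.
  by rewrite /ostep axy ee ce Sx Sy.
move: Ke; case: (boolP (hull (lclus c) (src e))) => h1;
  case: (boolP (hull (lclus c) (tgt e))) => h2 //= _.
- exact: (key _ _ (adj_src_tgt e) (edge_of_src_tgt e)).
- apply: (key (tgt e) (src e)) => //; first by rewrite adj_sym adj_src_tgt.
  by rewrite edge_ofC ?edge_of_src_tgt // adj_sym adj_src_tgt.
Qed.

(** Exploration property: the cluster of the left side is discovered by inspecting only edges that
    touch it, and it is contained in its hull. Everything away from [K0] remains independent of the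
    event that the hull is [K0]. *)
Lemma hull_dep (c c' : cfg) (K0 : vertex -> bool) :
  (forall e, edges_in S e && (K0 (src e) || K0 (tgt e)) -> c e = c' e) ->
  hull (lclus c) = K0 -> hull (lclus c') = K0.
Proof.
move=> cc' eK; have K v : lclus c v -> K0 v by rewrite -eK; exact: lclus_hull.
rewrite -eK; congr hull; apply: esym.
have st (a : cfg) v w : lclus a v -> ostep a S v w -> lclus a w.
  move=> /asboolP[l [Sl el cl]] r; apply/asboolP; exists l; split => //.
  by apply: (conn_trans cl); exact: conn_step.
have l0 (a : cfg) l : S l -> l.1 = 0 -> lclus a l.
  by move=> Sl el; apply/asboolP; exists l; split => //; exact: conn_refl.
have cE v w : lclus c v -> adj v w -> S v -> S w -> c (edge_of v w) = c' (edge_of v w).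
  move=> lv avw Sv Sw; apply: cc'.
  by rewrite edge_of_touch // K // /edges_in edge_of_ends // Sv Sw.
apply/funext => v; apply/idP/idP => [/asboolP[l [Sl el cl]]|/asboolP[l [Sl el cl]]].
  have [] // : lclus c v /\ lclus c' v.
    apply: (conn_closed (F := fun v => lclus c v /\ lclus c' v)) cl; last first.
      by split; exact: l0.
    move=> a b [ha ha'] r; case/and4P: (r) => aab ce Sa Sb.
    split; first exact: (st _ _ _ ha r).
    apply: (st _ _ _ ha'); by rewrite /ostep aab -cE // ce Sa.
apply: (conn_closed (F := fun v => lclus c v)) cl; last exact: l0.
move=> a b ha r; case/and4P: (r) => aab ce Sa Sb.
apply: (st _ _ _ ha); by rewrite /ostep aab cE // ce Sa.
Qed.

Section Attached.
Variable K0 : vertex -> bool.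
Hypothesis KS : forall v, K0 v -> S v.
Hypothesis KL : forall y : int, 0 <= y <= n%:Z - 1 -> K0 (0, y).
Hypothesis KR : forall y : int, 0 <= y <= n%:Z - 1 -> ~~ K0 (n%:Z, y).

Definition attached (f : vertex) := exists e0,
  bd 0 n%:Z 0 (n%:Z - 1) K0 e0 /\ (f = src (dedge e0) \/ f = tgt (dedge e0)).

(* The mirror is the line of height [n - 1/2]. *)
Definition mirrored (v : vertex) : bool :=
  if v.2 <= n%:Z - 1 then K0 v else K0 (refly (2 * n%:Z - 1) v).

(** Here [e] is a dual edge: the primal edge that it crosses touches neither the hull nor its mirror
    image, hence has not been explored. *)
Definition off_mirrored (e : edge) : bool :=
  ~~ (mirrored (src (undual e)) || mirrored (tgt (undual e))).

Definition touch (f : vertex) : bool :=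
  [|| mirrored f, mirrored (f.1 + 1, f.2), mirrored (f.1, f.2 + 1) |
      mirrored (f.1 + 1, f.2 + 1)].

Lemma mirrored_refly v : mirrored (refly (2 * n%:Z - 1) v) = mirrored v.
Proof.
rewrite /mirrored /=; case: ifP => h; case: ifP => h'.
- lia.
- by [].
- by congr K0; case: v {h h'} => a b; rewrite /refly /=; congr pair; lia.
- lia.
Qed.

Lemma touch_refly f : touch (refly (2 * n%:Z - 2) f) = touch f.
Proof.
rewrite /touch -(mirrored_refly f) -(mirrored_refly (f.1 + 1, f.2)).
rewrite -(mirrored_refly (f.1, f.2 + 1)) -(mirrored_refly (f.1 + 1, f.2 + 1)).
rewrite /refly /=.
have -> : 2 * n%:Z - 2 - f.2 + 1 = 2 * n%:Z - 1 - f.2 by lia.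
have -> : 2 * n%:Z - 2 - f.2 = 2 * n%:Z - 1 - (f.2 + 1) by lia.
by do 4 case: mirrored.
Qed.

Lemma touch_off u v : adj u v -> ~~ touch v -> off_mirrored (edge_of u v).
Proof.
case: u v => [u1 u2] [v1 v2]; rewrite /touch /off_mirrored /= => /adjP /= [] [-> ->];
  rewrite ?edge_of_right ?edge_of_left ?edge_of_up ?edge_of_down /undual /src /tgt /=;
  by rewrite !negb_or => /and4P[h1 h2 h3 h4]; rewrite ?h1 ?h2 ?h3 ?h4.
Qed.

Lemma KSb (i j : int) : K0 (i, j) -> [/\ 0 <= i, i < n%:Z, 0 <= j & j <= n%:Z - 1].
Proof.
move=> h; have := KS h; rewrite /S /rect /= => /andP[/andP[h1 h2] /andP[h3 h4]].
split => //; rewrite lt_neqAle h2 andbT; apply/negP => /eqP ei.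
by have := @KR j; rewrite h3 h4 -ei h => /(_ isT).
Qed.

(** The two corners that the dual vertices [u] and [v] share are off the mirrored hull, while one of
    the other corners of [u] is in it, so a side of the face of [u] is a boundary edge. If [u] is on
    the mirror line, its upper corners are images of its lower ones, and the boundary edge is found
    below the line. *)
Lemma attached_of u v : adj u v -> 0 <= u.1 -> -1 <= v.2 -> u.2 <= n%:Z - 1 ->
  touch u -> ~~ touch v -> attached u.
Proof.
case: u v => [i j] [v1 v2] /= auv i0 v20 jn tu tv.
have Zlow (a b : int) : b <= n%:Z - 1 -> mirrored (a, b) = K0 (a, b).
  by rewrite /mirrored /= => ->.
have Zmid (a : int) : mirrored (a, n%:Z) = K0 (a, n%:Z - 1).
  rewrite /mirrored /=; have -> : (n%:Z <= n%:Z - 1) = false by lia.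
  by congr K0; rewrite /refly /=; congr pair; lia.
have eh (a b : int) : 0 <= a -> K0 (a, b) (+) K0 (a + 1, b) ->
    bd 0 n%:Z 0 (n%:Z - 1) K0 ((a, b), false).
  move=> a0 h; rewrite /bd /src /tgt /= h andbT.
  case k1 : (K0 (a, b)); case k2 : (K0 (a + 1, b)); rewrite ?k1 ?k2 //= in h.
    by have [] := KSb k1; rewrite /rect /=; lia.
  by have [] := KSb k2; rewrite /rect /=; lia.
have ev (a b : int) : 0 <= b -> b + 1 <= n%:Z - 1 -> K0 (a, b) (+) K0 (a, b + 1) ->
    bd 0 n%:Z 0 (n%:Z - 1) K0 ((a, b), true).
  move=> b0 b1 h; rewrite /bd /src /tgt /= h andbT.
  case k1 : (K0 (a, b)); case k2 : (K0 (a, b + 1)); rewrite ?k1 ?k2 //= in h.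
    by have [] := KSb k1; rewrite /rect /=; lia.
  by have [] := KSb k2; rewrite /rect /=; lia.
have bh (a b : int) : 0 <= a -> K0 (a, b) (+) K0 (a + 1, b) ->
    attached (a, b) /\ attached (a, b - 1).
  move=> a0 h; split; exists ((a, b), false); (split; first exact: eh);
    rewrite /dedge /src /tgt /= ?subrK; by [right|left].
have bv (a b : int) : 0 <= b -> b + 1 <= n%:Z - 1 -> K0 (a, b) (+) K0 (a, b + 1) ->
    attached (a, b) /\ attached (a - 1, b).
  move=> b0 b1 h; split; exists ((a, b), true); (split; first exact: ev);
    rewrite /dedge /src /tgt /= ?subrK; by [right|left].
have kneg (a b : int) : K0 (a, b) -> 0 <= b by move=> /KSb[].
have Zup (a : int) : mirrored (a, j + 1) = K0 (a, if j == n%:Z - 1 then j else j + 1).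
  case: eqP => e; last by apply: Zlow; lia.
  have -> : j + 1 = n%:Z by lia.
  by rewrite Zmid e.
move: tu tv; rewrite /touch /= !Zup !(Zlow _ j) //.
have bhl : attached (i, j + 1 - 1) -> attached (i, j) by rewrite addrK.
have bvl : attached (i + 1 - 1, j) -> attached (i, j) by rewrite addrK.
have : [\/ (v1 = i + 1 /\ v2 = j), (v1 = i - 1 /\ v2 = j),
            (v1 = i /\ v2 = j + 1) | (v1 = i /\ v2 = j - 1)].
  move: auv => /adjP /= [] [e1 e2]; [apply: Or41|apply: Or42|apply: Or43|apply: Or44];
    by split; lia.
move=> [] [e1 e2]; subst v1 v2; rewrite ?subrK.
- rewrite !Zup !(Zlow _ j) // !negb_or => h /and4P[/negPf n1 _ /negPf n2 _].
  move: h; rewrite n1 n2 /= orbF => /orP[k|k]; first by apply: (bh i j _ _).1; rewrite ?k ?n1.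
  case: ifP k n2 => _ k n2; first by apply: (bh i j _ _).1; rewrite ?k ?n2.
  by apply: bhl; apply: (bh i (j + 1) _ _).2; rewrite ?k ?n2.
- rewrite !Zup !(Zlow _ j) // !negb_or => h /and4P[_ /negPf n1 _ /negPf n2].
  move: h; rewrite n1 n2 /= => /orP[k|k]; first by apply: (bh i j _ _).1; rewrite ?k ?n1.
  case: ifP k n2 => _ k n2; first by apply: (bh i j _ _).1; rewrite ?k ?n2.
  by apply: bhl; apply: (bh i (j + 1) _ _).2; rewrite ?k ?n2.
- rewrite !Zup !negb_or => h /and4P[/negPf n1 /negPf n2 _ _].
  move: h; rewrite n1 n2 !orbF; case: ifP n1 n2 => ej n1 n2; first by rewrite n1 n2.
  move=> /orP[k|k]; have j0 := kneg _ _ k.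
    by apply: (bv _ _ j0 _ _).1; [lia|rewrite k n1].
  by apply: bvl; apply: (bv _ _ j0 _ _).2; [lia|rewrite k n2].
- rewrite !(Zlow _ j) // !negb_or => h /and4P[_ _ /negPf n1 /negPf n2].
  move: h; rewrite n1 n2 /=; case: ifP => ej; first by rewrite n1 n2.
  have j0 : 0 <= j by lia.
  move=> /orP[k|k].
    by apply: (bv _ _ j0 _ _).1; [lia|rewrite k n1].
  by apply: bvl; apply: (bv _ _ j0 _ _).2; [lia|rewrite k n2].
Qed.

End Attached.
End Hull.

Section BollobasRiordan.
Variables (n M : nat).
Hypothesis n0 : (0 < n)%N.
Hypothesis nM : (n <= M)%N.

Let S := rect 0 n%:Z 0 (n%:Z - 1).
Let Sd := rect 0 (n%:Z - 1) (-1) (n%:Z - 1).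
Let Rd := rect 0 M%:Z (-1) (2 * n%:Z - 1).

(* A dual vertical crossing of the square that is joined to the right side of
   the rectangle.  Exploring the leftmost vertical crossing reveals nothing about
   the right of it and of its mirror image; by symmetry, a horizontal crossing of
   the rectangle meets the lower half of this curve with probability at least
   1/2 of its own. *)
Definition branch : set cfg := [set d | exists p q t,
  [/\ Sd p, p.2 = -1, q.2 = n%:Z - 1 &
   [/\ conn (ostep d Sd) p q, conn (ostep d Rd) p t & t.1 = M%:Z]]].

Definition low_arm (K0 : vertex -> bool) : set cfg := [set d | exists f x,
  [/\ attached n K0 f, x.1 = M%:Z &
      conn (ostep (fun e => d e && off_mirrored n K0 e) Rd) f x]].

Definition high_arm (K0 : vertex -> bool) : set cfg := [set d | exists f x,
  [/\ attached n K0 (refly (2 * n%:Z - 2) f), x.1 = M%:Z &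
      conn (ostep (fun e => d e && off_mirrored n K0 e) Rd) f x]].

Lemma off_erefly K0 e :
  off_mirrored n K0 (erefly (2 * n%:Z - 2) e) = off_mirrored n K0 e.
Proof.
case: e => [[i j] []]; rewrite /off_mirrored /erefly /undual /src /tgt /=.
  rewrite -(mirrored_refly n0 K0 (i, j + 1)) -(mirrored_refly n0 K0 (i + 1, j + 1)).
  rewrite /refly /=; have -> : 2 * n%:Z - 2 - j - 1 + 1 = 2 * n%:Z - 1 - (j + 1) by lia.
  by [].
rewrite -(mirrored_refly n0 K0 (i + 1, j)) -(mirrored_refly n0 K0 (i + 1, j + 1)).
rewrite /refly /= orbC.
have -> : 2 * n%:Z - 2 - j - 0 + 1 = 2 * n%:Z - 1 - j by lia.
by have -> : 2 * n%:Z - 2 - j - 0 = 2 * n%:Z - 1 - (j + 1) by lia.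
Qed.

Section Shape.
Variable K0 : vertex -> bool.
Hypothesis KS : forall v, K0 v -> S v.
Hypothesis KL : forall y : int, 0 <= y <= n%:Z - 1 -> K0 (0, y).
Hypothesis KR : forall y : int, 0 <= y <= n%:Z - 1 -> ~~ K0 (n%:Z, y).

(** A crossing starts at the mirrored hull, which contains the left side, and ends away from it. The
    last of its dual vertices that touch the mirrored hull is on the boundary of the hull or of its
    image, and from there on only unexplored edges are used. *)
Lemma arm_cover d : hcross 0 M%:Z (-1) (2 * n%:Z - 1) d ->
  low_arm K0 d \/ high_arm K0 d.
Proof.
move=> [x [y [rx ex ey cxy]]].
have tx : touch n K0 x.
  case: x ex rx {cxy} => x1 j /= -> rx; rewrite /touch /=.
  have m (b : int) : 0 <= b <= 2 * n%:Z - 1 -> mirrored n K0 (0, b).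
    by move=> hb; rewrite /mirrored /refly /=; case: ifP => h; apply: KL; lia.
  have [ej|nj] := eqVneq j (-1).
    by rewrite ej addNr (m 0) ?orbT //; lia.
  by rewrite m //; move: rx; rewrite /rect /=; lia.
have nty : ~~ touch n K0 y.
  have m (a b : int) : M%:Z <= a -> mirrored n K0 (a, b) = false.
    move=> hb; apply/negP; rewrite /mirrored /refly /=; case: ifP => h k;
    by have [] := KSb KS KR k; lia.
  by rewrite /touch; case: y ey {cxy} => a b /= ->; rewrite !m //; lia.
have [u [v [cu tu tv ruv cv]]] := conn_last_exit cxy tx nty.
have [auv duv Ru Rv] := and4P ruv.
have c : conn (ostep (fun e => d e && off_mirrored n K0 e) Rd) u y.
  apply: (conn_trans (y := v)).
    by apply: conn_step; apply/and4P; split => //; rewrite duv (touch_off auv tv).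
  apply: conn_sub cv => a b /and3P[/and4P[aab dab ra rb] ta tb].
  by apply/and4P; split => //; rewrite dab (touch_off aab tb).
have [h|h] := leP u.2 (n%:Z - 1).
  left; exists u, y; split => //.
  by apply: (attached_of n0 KS KR auv) => //; move: Ru Rv; rewrite /rect; lia.
right; exists u, y; split => //.
have [auv' _] := @hom_refly (2 * n%:Z - 2) _ _ auv.
apply: (attached_of n0 KS KR auv'); rewrite ?(touch_refly n0) //=;
  by move: Ru Rv; rewrite /rect; lia.
Qed.
End Shape.

Lemma hull_dual_paths d e0 f (K := hull n (lclus n (codual d))) :
  ~ hcross 0 n%:Z 0 (n%:Z - 1) (codual d) -> bd 0 n%:Z 0 (n%:Z - 1) K e0 ->
  f = src (dedge e0) \/ f = tgt (dedge e0) ->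
  exists p q, [/\ Sd p, p.2 = -1, q.2 = n%:Z - 1, conn (ostep d Sd) p f &
    conn (ostep d Sd) f q].
Proof.
set c := codual d in K * => nc be hf.
have KL : forall y : int, 0 <= y <= n%:Z - 1 -> K (0, y) by move=> y; exact: hull_left.
have KR : forall y : int, 0 <= y <= n%:Z - 1 -> ~~ K (n%:Z, y).
  by move=> y; exact: hull_right.
have x12 : 0 <= n%:Z by [].
have y12 : 0 <= n%:Z - 1 by lia.
have bdS e : bd 0 n%:Z 0 (n%:Z - 1) K e -> Sd (src (dedge e)) && Sd (tgt (dedge e)).
  case: e => [[i j] []] /and3P[]; rewrite /src /tgt /dedge /= /Sd /rect /=;
    last by move=> h1 h2 _; lia.
  move=> h1 h2 kk.
  have i0 : i != 0 by apply/negP => /eqP i0; move: kk; rewrite i0 !KL //; lia.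
  have i1 : i != n%:Z.
    by apply/negP => /eqP i1; move: kk; rewrite i1 !(negPf (KR _ _)) //; lia.
  by lia.
have dS u v : dbd 0 n%:Z 0 (n%:Z - 1) K u v -> ostep d Sd u v.
  move=> /andP[auv b]; have := bdS _ b; rewrite undualK edge_of_ends // => /andP[Su Sv].
  have := hull_closed b; rewrite /c /codual undualK negbK => duv.
  by apply/and4P.
have [p [ep hp cp]] := boundary_bottom x12 y12 KL KR (@hull_conn _ n0 c)
   (@hull_conn' _ c) be hf.
have [q [eq hq cq]] := boundary_top x12 y12 KL KR (@hull_conn _ n0 c)
   (@hull_conn' _ c) be hf.
exists p, q; split => //.
- by rewrite /Sd /rect ep; move: hp; lia.
- by apply/conn_osym/(conn_sub dS).
- by apply: conn_sub cq.
Qed.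

Lemma hull_branch d : low_arm (hull n (lclus n (codual d))) d ->
  ~ hcross 0 n%:Z 0 (n%:Z - 1) (codual d) -> branch d.
Proof.
move=> [f [x [[e0 [be hf]] ex cfx]]] nc.
have [p [q [Sp ep eq cp cq]]] := hull_dual_paths nc be hf.
exists p, q, x; split => //.
split => //; first by apply: (conn_trans cp).
apply: (conn_trans (y := f)).
  by apply: conn_osub cp => // v; rewrite /Sd /Rd /rect; lia.
by apply: conn_osub cfx => // e _ /andP[].
Qed.

Lemma blocked_vcross d : ~ hcross 0 n%:Z 0 (n%:Z - 1) (codual d) ->
  vcross 0 (n%:Z - 1) (-1) (n%:Z - 1) d.
Proof.
move=> nc; set c := codual d in nc *; pose K := hull n (lclus n c).
have h0 : (0 : int) <= 0 <= n%:Z - 1 by lia.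
have cs := straight_left n0 (leqnn n) h0.
have n1 : predC K (n%:Z, 0) by exact: hull_right.
have n2 : ~~ predC K (0, 0) by rewrite /= negbK; exact: hull_left h0.
have [u [v [_ Fu Fv /and3P[auv Su Sv] _]]] := conn_first_exit cs n1 n2.
have be : bd 0 n%:Z 0 (n%:Z - 1) K (edge_of u v).
  move: Fu Fv; rewrite /= negbK => /negPf Ku Kv; rewrite /bd andbA edge_of_ends //.
  by rewrite Su Sv /=; case: (edge_ofP auv) => -[-> ->]; rewrite Ku Kv.
have [p [q [Sp ep eq cp cq]]] := hull_dual_paths nc be (or_introl erefl).
by exists p, q; split => //; exact: conn_trans cq.
Qed.

Section Law.
Variables (R : realType) (mu : iid_law R).

(** A rectangle with [n + 1] columns and [n] rows is its own dual turned by a right angle. Exactly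
    one of a primal horizontal and a dual vertical crossing occurs, and the two are equally
    likely. *)
Lemma hp_square : hp mu n n.-1 = 2^-1.
Proof.
pose B := hcross 0 n%:Z 0 (n%:Z - 1).
have n1 : n%:Z - 1 = 0 + n.-1%:Z by lia.
have fS := fin_rect 0 n%:Z 0 (n%:Z - 1).
have hB := @bdep_hcross 0 n%:Z 0 (n%:Z - 1).
have fSd := fin_rect 0 (n%:Z - 1) (-1) (n%:Z - 1).
have hV := @bdep_vcross 0 (n%:Z - 1) (-1) (n%:Z - 1).
have eB : bpr mu B = hp mu n n.-1 by apply: bpr_hcross; lia.
have eC : bpr mu [set d | B (codual d)] = hp mu n n.-1.
  by rewrite (bpr_codual _ fS hB).
have eV : bpr mu (vcross 0 (n%:Z - 1) (-1) (n%:Z - 1)) = hp mu n n.-1.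
  by apply: bpr_vcross; lia.
have fS' : fin (fun e => edges_in (rect 0 n%:Z 0 (n%:Z - 1)) (undual e)).
  have [s hs] := fS; exists (map dedge s) => e /hs h.
  by rewrite -[e]undualK map_f.
have hC : bdep (fun e => edges_in (rect 0 n%:Z 0 (n%:Z - 1)) (undual e))
    [set d | B (codual d)].
  move=> b b' bb' /=; apply: hB => e Se; rewrite /codual bb' //.
  by rewrite dedgeK.
have mC : prod_measurable (bev [set d | B (codual d)] : set (edge -> R)).
  exact: pm_bev fS' hC.
have mV : prod_measurable (bev (vcross 0 (n%:Z - 1) (-1) (n%:Z - 1)) : set (edge -> R)).
  exact: pm_bev fSd hV.
have h1 : 1 - hp mu n n.-1 <= hp mu n n.-1.
  rewrite -{1}eC -eV -(bprC mu fS' hC).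
  by apply: (bpr_le mu fS' (bdepC hC) fSd hV) => d; exact: blocked_vcross.
have h2 : hp mu n n.-1 + hp mu n n.-1 <= 1.
  rewrite -{1}eC -eV /bpr -lprU //; first by apply: lpr_le1; exact: pmU.
  move=> w [x [y [rx ex ey cxy]]] [u [v [ru eu ev cuv]]].
  apply: (no_crossing_dual _ _ cxy rx ex ey cuv); rewrite ?eu ?ev //.
  - by move=> v'; rewrite /rect; lia.
by lra.
Qed.
End Law.
End BollobasRiordan.

Section Recursion.
Variables (n M : nat).
Hypothesis n0 : (0 < n)%N.
Hypothesis nM : (n <= M)%N.
Variables (R : realType) (mu : iid_law R).

Let S := rect 0 n%:Z 0 (n%:Z - 1).
Let Sd := rect 0 (n%:Z - 1) (-1) (n%:Z - 1).
Let Rd := rect 0 M%:Z (-1) (2 * n%:Z - 1).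

Lemma bdep_low K0 : bdep (fun e => edges_in Rd e && off_mirrored n K0 e) (low_arm n M K0).
Proof.
move=> b b' bb' [f [x [q ex c]]]; exists f, x; split => //.
apply: conn_osub c => // e Ve /andP[be oe].
by rewrite -bb' ?be ?oe // Ve.
Qed.

Lemma bdep_high K0 : bdep (edges_in Rd) (high_arm n M K0).
Proof.
move=> b b' bb' [f [x [q ex c]]]; exists f, x; split => //.
apply: conn_osub c => // e Ve /andP[be oe].
by rewrite -bb' ?be ?oe // Ve.
Qed.

Let fR := fin_rect 0 M%:Z (-1) (2 * n%:Z - 1).

Lemma bdep_low' K0 : bdep (edges_in Rd) (low_arm n M K0).
Proof. by apply: bdepS (@bdep_low K0) => e /andP[]. Qed.

Lemma high_low K0 : bpr mu (high_arm n M K0) = bpr mu (low_arm n M K0).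
Proof.
rewrite -[RHS](bpr_sym mu false (can_inj (ereflyK (2 * n%:Z - 2))) fR (@bdep_low' K0)).
have RR v : Rd v -> Rd (refly (2 * n%:Z - 2) v) by rewrite /Rd /rect /refly /=; lia.
have reK v : refly (2 * n%:Z - 2) (refly (2 * n%:Z - 2) v) = v.
  by case: v => a b; rewrite /refly /=; congr pair; lia.
congr (bpr _); apply/seteqP; split => d [f [x [af ex c]]].
  exists (refly (2 * n%:Z - 2) f), (refly (2 * n%:Z - 2) x); split => //=.
  apply: (conn_hom (@hom_refly (2 * n%:Z - 2)) RR).
  by apply: conn_osub c => // e _; rewrite /= ereflyK (off_erefly n0 nM).
exists (refly (2 * n%:Z - 2) f), (refly (2 * n%:Z - 2) x); split => //=.
  by rewrite reK.
apply: (conn_hom (@hom_refly (2 * n%:Z - 2)) RR).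
by apply: conn_osub c => // e _; rewrite /= (off_erefly n0 nM).
Qed.

Lemma low_arm_prob (K0 : vertex -> bool) : (forall v, K0 v -> S v) ->
  (forall y : int, 0 <= y <= n%:Z - 1 -> K0 (0, y)) ->
  (forall y : int, 0 <= y <= n%:Z - 1 -> ~~ K0 (n%:Z, y)) ->
  hp mu M n.*2 / 2 <= bpr mu (low_arm n M K0).
Proof.
move=> KS KL KR.
have <- : bpr mu (hcross 0 M%:Z (-1) (2 * n%:Z - 1)) = hp mu M n.*2.
  by apply: bpr_hcross; lia.
have mL : prod_measurable (bev (low_arm n M K0) : set (edge -> R)).
  exact: pm_bev fR (@bdep_low' K0).
have mH : prod_measurable (bev (high_arm n M K0) : set (edge -> R)).
  exact: pm_bev fR (@bdep_high K0).
have : bpr mu (hcross 0 M%:Z (-1) (2 * n%:Z - 1)) <=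
    bpr mu (low_arm n M K0) + bpr mu (high_arm n M K0).
  apply: le_trans (lpr_leU mu mL mH); apply: lpr_le.
  - exact: pm_bev fR (@bdep_hcross _ _ _ _).
  - exact: pmU.
  by move=> w _ /(arm_cover n0 nM KS KL KR).
by rewrite high_low; lra.
Qed.

Lemma bdep_branch : bdep (edges_in Rd) (branch n M).
Proof.
move=> b b' bb' [p [q [x [Sp ep eq [c1 c2 ex]]]]]; exists p, q, x; split => //; split => //.
  apply: conn_osub c1 => // e /andP[h1 h2]; rewrite bb' //.
  by move: h1 h2; rewrite /edges_in /Rd /rect; lia.
by apply: conn_osub c2 => // e /bb' ->.
Qed.

Lemma binc_branch : binc (branch n M).
Proof.
move=> b b' bb' [p [q [x [Sp ep eq [c1 c2 ex]]]]]; exists p, q, x; split => //.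
by split => //; [apply: conn_osub c1|apply: conn_osub c2] => // e _ /bb'.
Qed.

(** One factor 1/2 is the probability that the square has a dual vertical crossing. The other is the
    share of the lower arm, which given the explored hull is at least half of an unconditional
    crossing. *)
Lemma branch_prob : hp mu M n.*2 / 4 <= bpr mu (branch n M).
Proof.
pose g (d : cfg) := hull n (lclus n (codual d)).
pose B := [set d | ~ hcross 0 n%:Z 0 (n%:Z - 1) (codual d)].
pose Sg e := edges_in (rect 0 n%:Z 0 (n%:Z - 1)) (undual e).
have fSg : fin Sg.
  have [s hs] := fin_rect 0 n%:Z 0 (n%:Z - 1); exists (map dedge s) => e /hs h.
  by rewrite -[e]undualK map_f.
have dB : bdep Sg B.
  move=> b b' bb' nb hb; apply: nb; apply: bdep_hcross hb => e Se.
  by rewrite /codual bb' // /Sg dedgeK.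
have dg b b' : (forall e, Sg e -> b e = b' e) -> g b = g b'.
  move=> bb'; apply/esym; apply: (hull_dep (c := codual b)) => // e /andP[Se _].
  by rewrite /codual bb' // /Sg dedgeK.
have dgk k : bdep (fun e => Sg e && (k (src (undual e)) || k (tgt (undual e))))
    [set d | g d = k].
  move=> b b' bb' /=; apply: hull_dep => e he.
  by rewrite /codual bb' // /Sg dedgeK.
have fgk k : fin (fun e => Sg e && (k (src (undual e)) || k (tgt (undual e)))).
  by apply: finS fSg => e /andP[].
have eB : bpr mu B = 2^-1.
  have : bpr mu (~` B) = 2^-1.
    rewrite -(hp_square n0 nM mu); transitivity (bpr mu (hcross 0 n%:Z 0 (n%:Z - 1))).
      rewrite -(bpr_codual mu (fin_rect _ _ _ _) (@bdep_hcross _ _ _ _)).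
      congr (bpr _); apply/seteqP; split => d /=; last by move=> h; apply.
      by move=> /contrapT.
    by apply: bpr_hcross; lia.
  by rewrite (bprC mu fSg dB); lra.
have mB : prod_measurable (bev B : set (edge -> R)) by exact: pm_bev fSg dB.
have mX : prod_measurable (bev (branch n M) : set (edge -> R)).
  exact: pm_bev fR bdep_branch.
have -> : hp mu M n.*2 / 4 = bpr mu B * (hp mu M n.*2 / 2) by rewrite eB; lra.
apply: (lpr_part_le fSg dg mB mX) => k.
have [[d0 [nd0 gd0]]|nk] := pselect (exists d, B d /\ g d = k); last first.
  have -> : (bev B `&` bev [set b | g b = k] : set (edge -> R)) = set0.
    by apply/seteqP; split => // w [Bw gw]; apply: nk; exists (bin w).
  by rewrite lpr0 mul0r lpr_ge0.
have KS v : k v -> S v by rewrite -gd0 => /andP[].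
have KL (y : int) : 0 <= y <= n%:Z - 1 -> k (0, y).
  by rewrite -gd0; exact: hull_left.
have KR (y : int) : 0 <= y <= n%:Z - 1 -> ~~ k (n%:Z, y).
  by rewrite -gd0; exact: hull_right.
have mk : prod_measurable (bev [set b | g b = k] : set (edge -> R)).
  exact: pm_bev (fgk k) (dgk k).
apply: (@le_trans _ _ (bpr mu [set d | g d = k] * bpr mu (low_arm n M k))).
  apply: ler_pM; rewrite ?lpr_ge0 //.
  - by rewrite divr_ge0 // hp_ge0.
  - by apply: lpr_le => //; [exact: pmI|move=> w _ []].
  - exact: low_arm_prob.
rewrite -(bpr_indep mu (fgk k) (dgk k) _ (@bdep_low k)).
- apply: lpr_le.
  + rewrite bevI; apply: pmI => //; exact: pm_bev fR (@bdep_low' k).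
  + exact: pmI.
  move=> w _ [gw lw]; split => //.
  have gw' : hull n (lclus n (codual (bin w))) = k := gw.
  apply: (hull_branch n0 nM); first by rewrite gw'.
  by move=> /(hull_rightN n0)[y hy]; rewrite gw' (negPf (KR y hy)).
- by apply: finS fR => e /andP[].
(* The exploration reads only dual edges across primal edges that touch [k]. These have both ends
   below the mirror line, where [mirrored] is [k] itself, so the lower arm does not use them. *)
- move=> e /andP[/andP[S1 S2] ke]; rewrite negb_and; apply/orP; right.
  rewrite /off_mirrored negbK /mirrored.
  have -> : (src (undual e)).2 <= n%:Z - 1 by move: S1; rewrite /rect; lia.
  by have -> : (tgt (undual e)).2 <= n%:Z - 1 by move: S2; rewrite /rect; lia.
Qed.

End Recursion.

(** Otherwise the set of vertices joined to [u] would contain a vertical crossing and its complement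
    a horizontal one. *)
Lemma cross_meet (b b' : cfg) (x1 x2 y1 y2 : int) u v x y :
  conn (ostep b (rect x1 x2 y1 y2)) u v -> rect x1 x2 y1 y2 u -> u.2 = y1 -> v.2 = y2 ->
  conn (ostep b' (rect x1 x2 y1 y2)) x y -> rect x1 x2 y1 y2 x -> x.1 = x1 -> y.1 = x2 ->
  exists z, conn (ostep b (rect x1 x2 y1 y2)) u z /\ conn (ostep b' (rect x1 x2 y1 y2)) x z.
Proof.
move=> cuv ru eu ev cxy rx ex ey; apply: contrapT => nz.
pose Q z : bool := `[< conn (ostep b (rect x1 x2 y1 y2)) u z >].
have nQ z : conn (ostep b' (rect x1 x2 y1 y2)) x z -> ~~ Q z.
  by move=> cz; apply/asboolP => cu; apply: nz; exists z.
have Qu : Q u by apply/asboolP; exact: conn_refl.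
apply: (@no_crossing_disjoint Q x1 x2 y1 y2 x y u v) => //; last 2 first.
- have [] // : conn (ostep b' (rect x1 x2 y1 y2)) x y /\
      conn (restr (restr adj (predC Q)) (rect x1 x2 y1 y2)) x y.
  apply: (conn_closed (F := fun y => conn (ostep b' (rect x1 x2 y1 y2)) x y /\
      conn (restr (restr adj (predC Q)) (rect x1 x2 y1 y2)) x y)) cxy.
    move=> a c [ca ca'] r; have cc : conn (ostep b' (rect x1 x2 y1 y2)) x c.
      by apply: (conn_trans ca); exact: conn_step.
    split => //; apply: (conn_trans ca'); apply: conn_step.
    case/and4P: r => aac _ ra rc; apply/and3P; split => //.
    by apply/and3P; split => //=; exact: nQ.
  by split; exact: conn_refl.
- by apply: nQ; exact: conn_refl.
have [] // : Q v /\ conn (restr (restr adj Q) (rect x1 x2 y1 y2)) u v.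
apply: (conn_closed (F := fun v => Q v /\
    conn (restr (restr adj Q) (rect x1 x2 y1 y2)) u v)) cuv.
  move=> a c [/asboolP ca ca'] r; have Qc : Q c.
    by apply/asboolP; apply: (conn_trans ca); exact: conn_step.
  split => //; apply: (conn_trans ca'); apply: conn_step.
  case/and4P: r => aac _ ra rc; apply/and3P; split => //.
  by apply/and3P; split => //; apply/asboolP.
by split => //; exact: conn_refl.
Qed.

(** * Russo-Seymour-Welsh bounds for long rectangles *)

Section RSW.
Variables (R : realType) (mu : iid_law R).

Section Glue.
Variables (n M : nat).
Hypothesis n0 : (0 < n)%N.
Hypothesis nM : (n <= M)%N.

Let Sd := rect 0 (n%:Z - 1) (-1) (n%:Z - 1).
Let Rd := rect 0 M%:Z (-1) (2 * n%:Z - 1).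
Let Rd' := rect (n%:Z - 1 - M%:Z) (n%:Z - 1) (-1) (2 * n%:Z - 1).
Let L := rect (n%:Z - 1 - M%:Z) M%:Z (-1) (2 * n%:Z - 1).
Let f := ereflx (n%:Z - 1).

Let branch' : set cfg := [set d | branch n M (fun e => d (f e))].

Lemma branches_cross d : branch n M d -> branch' d ->
  hcross 0 (n%:Z - 1) (-1) (n%:Z - 1) d ->
  hcross (n%:Z - 1 - M%:Z) M%:Z (-1) (2 * n%:Z - 1) d.
Proof.
move=> [p [q [x [Sp ep eq [cpq cpx ex]]]]] [p' [q' [x' [Sp' ep' eq' [cpq' cpx' ex']]]]].
move=> [l [r [Sl el er clr]]].
have SS v : Sd v -> Sd (reflx (n%:Z - 1) v) by rewrite /Sd /rect /reflx /=; lia.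
have RR v : Rd v -> Rd' (reflx (n%:Z - 1) v) by rewrite /Rd' /Rd /rect /reflx /=; lia.
have {}cpq' := conn_hom (@hom_reflx (n%:Z - 1)) SS cpq'.
have {}cpx' := conn_hom (@hom_reflx (n%:Z - 1)) RR cpx'.
have [z [cz cz']] := cross_meet cpq Sp ep eq clr Sl el er.
have [y [cy cy']] := cross_meet cpq' (SS _ Sp') ep' eq' clr Sl el er.
have inS a c : conn (ostep d Sd) a c -> conn (ostep d L) a c.
  by apply: conn_osub => // v; rewrite /Sd /L /rect; lia.
exists (reflx (n%:Z - 1) x'), x; split => //.
- have Rp' : Rd p' by move: Sp'; rewrite /Sd /Rd /rect; lia.
  by have := conn_ostep_in (RR _ Rp') cpx'; rewrite /Rd' /rect; lia.
- by rewrite /reflx /= ex'.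
apply: (conn_trans (y := reflx (n%:Z - 1) p')).
  by apply/conn_osym; apply: conn_osub cpx' => // v; rewrite /Rd' /L /rect; lia.
apply: (conn_trans (inS _ _ cy)); apply: (conn_trans (inS _ _ (conn_osym cy'))).
apply: (conn_trans (inS _ _ cz')); apply: (conn_trans (inS _ _ (conn_osym cz))).
by apply: conn_osub cpx => // v; rewrite /Rd /L /rect; lia.
Qed.

(* Two mirror images of [branch] and a horizontal crossing of the square where
   they overlap. *)
Lemma hp_rec : (hp mu M n.*2 / 4) ^+ 2 / 2 <= hp mu (M.*2 - n).+1 n.*2.
Proof.
have fR := fin_rect 0 M%:Z (-1) (2 * n%:Z - 1).
have fS := fin_rect 0 (n%:Z - 1) (-1) (n%:Z - 1).
have dB := @bdep_branch n M n0 nM.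
have iB := @binc_branch n M.
have fRf : fin (fun e => edges_in Rd (f e)).
  have [s hs] := fR; exists (map f s) => e /hs h.
  by rewrite -[e](ereflxK (n%:Z - 1)) map_f.
have dB' : bdep (fun e => edges_in Rd (f e)) branch'.
  move=> b b' bb'; apply: dB => e Re; apply: bb'.
  by rewrite /f ereflxK.
have iB' : binc branch' by move=> b b' bb'; apply: iB => e /bb'.
have dH := @bdep_hcross 0 (n%:Z - 1) (-1) (n%:Z - 1).
have iH := @binc_hcross 0 (n%:Z - 1) (-1) (n%:Z - 1).
have eB' : bpr mu branch' = bpr mu (branch n M).
  exact: (bpr_sym mu false (can_inj (ereflxK (n%:Z - 1))) fR dB).
have pB := branch_prob n0 nM mu.
have pH : 2^-1 <= bpr mu (hcross 0 (n%:Z - 1) (-1) (n%:Z - 1)).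
  have -> : bpr mu (hcross 0 (n%:Z - 1) (-1) (n%:Z - 1)) = hp mu n.-1 n.
    by apply: bpr_hcross; lia.
  by rewrite -(hp_square n0 (leqnn n) mu); apply: hp_mono; lia.
have fB : fin (predU (edges_in Rd) (fun e => edges_in Rd (f e))).
  have [s hs] := fR; have [s' hs'] := fRf; exists (s ++ s') => e.
  by rewrite mem_cat => /orP[/hs ->//|/hs' ->]; rewrite orbT.
have dBB : bdep (predU (edges_in Rd) (fun e => edges_in Rd (f e))) (branch n M `&` branch').
  by apply: bdepI; [apply: bdepS dB|apply: bdepS dB'] => e /= ->; rewrite ?orbT.
have h1 : bpr mu (branch n M) * bpr mu branch' <= bpr mu (branch n M `&` branch').
  exact: bpr_fkg fR dB iB fRf dB' iB'.
have h2 : bpr mu (branch n M `&` branch') * bpr mu (hcross 0 (n%:Z - 1) (-1) (n%:Z - 1))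
    <= bpr mu ((branch n M `&` branch') `&` hcross 0 (n%:Z - 1) (-1) (n%:Z - 1)).
  by apply: bpr_fkg fB dBB (bincI iB iB') fS dH iH.
have h3 : bpr mu ((branch n M `&` branch') `&` hcross 0 (n%:Z - 1) (-1) (n%:Z - 1)) <=
    hp mu (M.*2 - n).+1 n.*2.
  rewrite -(@bpr_hcross _ mu (n%:Z - 1 - M%:Z) M%:Z (-1) (2 * n%:Z - 1)); try lia.
  have fBH : fin (predU (predU (edges_in Rd) (fun e => edges_in Rd (f e))) (edges_in Sd)).
    have [s hs] := fB; have [s' hs'] := fS; exists (s ++ s') => e.
    by rewrite mem_cat => /orP[/hs ->//|/hs' ->]; rewrite orbT.
  have dBH : bdep (predU (predU (edges_in Rd) (fun e => edges_in Rd (f e))) (edges_in Sd))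
      ((branch n M `&` branch') `&` hcross 0 (n%:Z - 1) (-1) (n%:Z - 1)).
    apply: bdepI; [apply: bdepS dBB|apply: bdepS dH] => e h; apply/orP; [by left|by right].
  apply: (bpr_le mu fBH dBH (fin_rect _ _ _ _) (@bdep_hcross _ _ _ _)).
  by move=> d [[B1 B2] H]; exact: branches_cross.
have c0 : 0 <= hp mu M n.*2 / 4 by rewrite divr_ge0 // hp_ge0.
apply: le_trans h3; apply: le_trans h2; apply: ler_pM => //.
  exact: exprn_ge0.
apply: le_trans h1; rewrite eB' expr2; exact: ler_pM.
Qed.

End Glue.

(** For [M = a * n - 1] the glued rectangle has length [2 * M - n + 1 = (2 * a - 1) * n - 1], which
    is again of the same form; hence the predecessor in the lengths. *)
Lemma rsw_step (a : nat) : (2 <= a)%N ->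
  (exists c, 0 < c /\ forall n, (0 < n)%N -> c <= hp mu (a * n).-1 n.*2) ->
  exists c, 0 < c /\ forall n, (0 < n)%N -> c <= hp mu ((a.*2.-1) * n).-1 n.*2.
Proof.
move=> a2 [c [c0 hc]]; exists ((c / 4) ^+ 2 / 2); split.
  by rewrite divr_gt0 // exprn_gt0 // divr_gt0.
move=> n n0; have nM : (n <= (a * n).-1)%N by nia.
have := hp_rec n0 nM.
have -> : (((a * n).-1).*2 - n).+1 = ((a.*2.-1) * n).-1 by nia.
apply: le_trans; rewrite ler_pM2r ?invr_gt0 //.
rewrite lerXn2r ?nnegrE ?divr_ge0 ?hp_ge0 //; first exact: ltW.
by rewrite ler_pM2r ?invr_gt0 //; exact: hc.
Qed.

(** The multiples grow as 2, 3, 5, 9, 17, the last leaving room for odd [k]. The length [4 * k + 5]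
    is [4 * r + 1] for [k = r - 1], the size of the dual rectangles that block an annulus. *)
Lemma rsw : exists c, 0 < c /\ forall m k, (4 <= k)%N -> (m <= (4 * k).+4.+1)%N -> c <= hp mu m k.
Proof.
have h2 : exists c, 0 < c /\ forall n, (0 < n)%N -> c <= hp mu (2 * n).-1 n.*2.
  exists 2^-1; split => // n n0.
  have n20 : (0 < n.*2)%N by lia.
  rewrite -(hp_square n20 (leqnn _) mu) mul2n; apply: hp_mono; lia.
have := rsw_step (a := 2) isT h2; rewrite /= => h3.
have := rsw_step (a := 3) isT h3; rewrite /= => h5.
have := rsw_step (a := 5) isT h5; rewrite /= => h9.
have := rsw_step (a := 9) isT h9; rewrite /= => -[c [c0 hc]].
exists c; split => // m k k4 mk.
apply: (le_trans (hc k./2 _)); first by lia.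
by apply: hp_mono; lia.
Qed.

End RSW.

(** * Circuits and arms in annuli *)

(** Half-open, so that consecutive annuli share no edge and are independent. *)
Definition ann (l u : nat) : pred vertex := fun v => (l < nm v <= u)%N.

Definition cl (b : cfg) (V : pred vertex) (z : vertex) : pred vertex :=
  fun v => `[< conn (ostep b V) z v >].

(* A circuit is encoded by its separation property, as a cluster that every
   lattice path across the annulus meets. *)
Definition sep (l u : nat) (K : pred vertex) : Prop := forall x s, path adj x s ->
  (nm x <= l)%N -> (u <= nm (last x s))%N -> has K (x :: s).

Definition circ (l u : nat) : set cfg :=
  [set b | exists z, ann l u z /\ sep l u (cl b (ann l u) z)].

Definition shell (l u : nat) : pred vertex := fun v => (l <= nm v <= u)%N.

Definition escape (l u : nat) : set cfg := [set b | exists x y,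
  [/\ nm x = l, nm y = u & conn (ostep b (shell l u)) x y]].

Lemma nm_rect (u : nat) v : (nm v <= u)%N = rect (- u%:Z) u%:Z (- u%:Z) u%:Z v.
Proof. by case: v => a b; rewrite /nm /rect /=; lia. Qed.

Lemma fin_nm (V : pred vertex) (u : nat) : (forall v, V v -> (nm v <= u)%N) ->
  fin (edges_in V).
Proof.
move=> h; apply: (fin_sub_rect (x1 := - u%:Z) (x2 := u%:Z) (y1 := - u%:Z) (y2 := u%:Z)).
by move=> v /h; rewrite nm_rect.
Qed.

Lemma fin_ann l u : fin (edges_in (ann l u)).
Proof. by apply: (@fin_nm _ u) => v /andP[]. Qed.

Lemma fin_shell l u : fin (edges_in (shell l u)).
Proof. by apply: (@fin_nm _ u) => v /andP[]. Qed.

Lemma sepS l u (K K' : pred vertex) : (forall v, K v -> K' v) -> sep l u K -> sep l u K'.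
Proof. by move=> h hK x s ps hx hy; apply: sub_has (hK x s ps hx hy). Qed.

Lemma bdep_circ l u : bdep (edges_in (ann l u)) (circ l u).
Proof.
move=> b b' bb' [z [az hz]]; exists z; split => //; apply: sepS hz => v /asboolP c.
by apply/asboolP; apply: conn_osub c => // e /bb' ->.
Qed.

Lemma binc_circ l u : binc (circ l u).
Proof.
move=> b b' bb' [z [az hz]]; exists z; split => //; apply: sepS hz => v /asboolP c.
by apply/asboolP; apply: conn_osub c => // e _ /bb'.
Qed.

Lemma circ_mono l u l' u' b : (l <= l')%N -> (u' <= u)%N -> circ l' u' b -> circ l u b.
Proof.
move=> ll uu [z [az hz]]; exists z; split; first by move: az; rewrite /ann; lia.
move=> x s ps hx hy; have : has (cl b (ann l' u') z) (x :: s) by apply: hz => //; lia.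
apply: sub_has => v /asboolP c; apply/asboolP; apply: conn_osub c => // w.
by rewrite /ann; lia.
Qed.

Lemma bdep_escape l u : bdep (edges_in (shell l u)) (escape l u).
Proof.
move=> b b' bb' [x [y [ex ey c]]]; exists x, y; split => //.
by apply: conn_osub c => // e /bb' ->.
Qed.

Lemma binc_escape l u : binc (escape l u).
Proof.
move=> b b' bb' [x [y [ex ey c]]]; exists x, y; split => //.
by apply: conn_osub c => // e _ /bb'.
Qed.

Lemma cl_path b (V W : pred vertex) z a c : (forall v, W v -> V v) ->
  conn (ostep b W) a c -> cl b V z a -> conn (restr (restr adj (cl b V z)) W) a c.
Proof.
move=> WV cac za.
have [] // : cl b V z c /\ conn (restr (restr adj (cl b V z)) W) a c.
apply: (conn_closed (F := fun c => cl b V z c /\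
    conn (restr (restr adj (cl b V z)) W) a c)) cac; last first.
  by split => //; exact: conn_refl.
move=> p q [/asboolP zp cp] r; have zq : cl b V z q.
  apply/asboolP; apply: (conn_trans zp); apply: conn_step.
  by case/and4P: r => apq bpq Wp Wq; apply/and4P; split => //; exact: WV.
split => //; apply: (conn_trans cp); apply: conn_step.
case/and4P: r => apq bpq Wp Wq; apply/and3P; split => //; apply/and3P; split => //.
exact/asboolP.
Qed.

Lemma vsub_top b (a1 a2 lo hi m : int) u v : lo < m -> m <= hi ->
  conn (ostep b (rect a1 a2 lo hi)) u v -> u.2 = lo -> v.2 = hi ->
  exists w, [/\ w.2 = m, rect a1 a2 m hi w, conn (ostep b (rect a1 a2 lo hi)) u w &
    conn (ostep b (rect a1 a2 m hi)) w v].
Proof.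
move=> lm mh c eu ev; pose F (w : vertex) := w.2 < m.
have Fu : F u by rewrite /F eu.
have nFv : ~~ F v by rewrite /F ev -leNgt.
have [p [w [cp Fp nFw r cw]]] := conn_last_exit c Fu nFv.
case/and4P: (r) => apw _ rp rw.
have ew : w.2 = m.
  by move: Fp nFw apw; rewrite /F /adj; case: (p) (w) => [p1 p2] [w1 w2] /=; lia.
exists w; split => //.
- by move: rw; rewrite /rect ew; lia.
- by apply: (conn_trans cp); exact: conn_step.
apply: conn_sub cw => x y /and3P[/and4P[axy bxy rx ry] nFx nFy]; apply/and4P; split => //.
  by case/andP: rx => h1 /andP[h2 h3]; rewrite /rect h1 h3 andbT leNgt.
by case/andP: ry => h1 /andP[h2 h3]; rewrite /rect h1 h3 andbT leNgt.
Qed.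

Lemma vsub_bot b (a1 a2 lo hi m : int) u v : lo <= m -> m < hi ->
  conn (ostep b (rect a1 a2 lo hi)) u v -> rect a1 a2 lo hi u -> u.2 = lo -> v.2 = hi ->
  exists w, [/\ w.2 = m, rect a1 a2 lo m u & conn (ostep b (rect a1 a2 lo m)) u w].
Proof.
move=> lm mh c ru eu ev; pose F (w : vertex) := w.2 <= m.
have Fu : F u by rewrite /F eu.
have nFv : ~~ F v by rewrite /F ev -ltNge.
have [p [w [cp Fp nFw r _]]] := conn_first_exit c Fu nFv.
case/and4P: (r) => apw _ rp rw.
have ep : p.2 = m.
  by move: Fp nFw apw; rewrite /F /adj; case: (p) (w) => [p1 p2] [w1 w2] /=; lia.
exists p; split => //.
  by move: ru; rewrite /rect eu; lia.
apply: conn_sub cp => x y /and3P[/and4P[axy bxy rx ry] Fx Fy]; apply/and4P; split => //.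
  by case/andP: rx => h1 /andP[h2 h3]; rewrite /rect h1 h2.
by case/andP: ry => h1 /andP[h2 h3]; rewrite /rect h1 h2.
Qed.

Lemma restr_sym (r : rel vertex) F : symmetric r -> symmetric (restr r F).
Proof. by move=> h x y; rewrite /restr h [F x && _]andbC. Qed.

Section Circuits.
Variable r : nat.
Hypothesis r5 : (5 <= r)%N.

Let Rr := rect (r%:Z + 1) (2 * r%:Z) (- (2 * r%:Z)) (2 * r%:Z).
Let Rl := rect (- (2 * r%:Z)) (- r%:Z - 1) (- (2 * r%:Z)) (2 * r%:Z).
Let Rt := rect (- (2 * r%:Z)) (2 * r%:Z) (r%:Z + 1) (2 * r%:Z).
Let Rb := rect (- (2 * r%:Z)) (2 * r%:Z) (- (2 * r%:Z)) (- r%:Z - 1).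
Let A := ann r r.*2.

Let RA v : [|| Rr v, Rl v, Rt v | Rb v] -> A v.
Proof.
rewrite /A /ann ltnNge !nm_rect.
by move=> /or4P[]; rewrite /Rr /Rl /Rt /Rb /rect => /andP[/andP[h1 h2] /andP[h3 h4]];
  apply/andP; (split; last by apply/andP; split; apply/andP; split; lia);
  rewrite !negb_and; lia.
Qed.

(** The four crossings meet in pairs and form one cluster [K]. A path off [K] from the inner box,
    stopped when it first reaches radius [2 * r], ends on one of the four sides; after its last exit
    from the corresponding half-plane it crosses the rectangle on that side from the inside to the
    outside, and there it must meet the long crossing contained in [K]. *)
Lemma circ_of_crossings b :
  vcross (r%:Z + 1) (2 * r%:Z) (- (2 * r%:Z)) (2 * r%:Z) b ->
  vcross (- (2 * r%:Z)) (- r%:Z - 1) (- (2 * r%:Z)) (2 * r%:Z) b ->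
  hcross (- (2 * r%:Z)) (2 * r%:Z) (r%:Z + 1) (2 * r%:Z) b ->
  hcross (- (2 * r%:Z)) (2 * r%:Z) (- (2 * r%:Z)) (- r%:Z - 1) b ->
  circ r r.*2 b.
Proof.
move=> [ur [vr [rur eur evr cr]]] [ul [vl [rul eul evl cl']]].
move=> [xt [yt [rxt ext eyt ct]]] [xb [yb [rxb exb eyb cb]]].
have inA (W : pred vertex) x y : (forall v, W v -> [|| Rr v, Rl v, Rt v | Rb v]) ->
    conn (ostep b W) x y -> conn (ostep b A) x y.
  by move=> hW; apply: conn_osub => // v /hW; exact: RA.
have in_r : forall v, Rr v -> [|| Rr v, Rl v, Rt v | Rb v] by move=> v ->.
have in_l : forall v, Rl v -> [|| Rr v, Rl v, Rt v | Rb v] by move=> v ->; rewrite orbT.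
have in_t : forall v, Rt v -> [|| Rr v, Rl v, Rt v | Rb v] by move=> v ->; rewrite !orbT.
have in_b : forall v, Rb v -> [|| Rr v, Rl v, Rt v | Rb v] by move=> v ->; rewrite !orbT.
have top (a1 a2 : int) u v : - (2 * r%:Z) <= a1 -> a2 <= 2 * r%:Z ->
    (forall v, rect a1 a2 (- (2 * r%:Z)) (2 * r%:Z) v -> [|| Rr v, Rl v, Rt v | Rb v]) ->
    conn (ostep b (rect a1 a2 (- (2 * r%:Z)) (2 * r%:Z))) u v ->
    u.2 = - (2 * r%:Z) -> v.2 = 2 * r%:Z -> conn (ostep b A) u xt.
  move=> h1 h2 hin c eu ev.
  have m1 : - (2 * r%:Z) < r%:Z + 1 by clear -r5; lia.
  have m2 : r%:Z + 1 <= 2 * r%:Z by clear -r5; lia.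
  have [w [ew rw cw cwv]] := vsub_top m1 m2 c eu ev.
  have cT : conn (ostep b Rt) w v.
    by apply: conn_osub cwv => // p; rewrite /Rt /rect; clear -r5 h1 h2; lia.
  have rT : Rt w by move: rw; rewrite /Rt /rect; clear -r5 h1 h2; lia.
  have [z [c1 c2]] := cross_meet cT rT ew ev ct rxt ext eyt.
  apply: (conn_trans (inA _ _ _ hin cw)); apply: (conn_trans (inA _ _ _ in_t c1)).
  exact: conn_osym (inA _ _ _ in_t c2).
have cut : conn (ostep b A) ur xt by apply: (top _ _ _ _ _ _ in_r cr eur evr); clear -r5; lia.
have cul : conn (ostep b A) ul xt by apply: (top _ _ _ _ _ _ in_l cl' eul evl); clear -r5; lia.
have cub : conn (ostep b A) ur xb.
  have m1 : - (2 * r%:Z) <= - r%:Z - 1 by clear -r5; lia.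
  have m2 : - r%:Z - 1 < 2 * r%:Z by clear -r5; lia.
  have [w [ew rw cw]] := vsub_bot m1 m2 cr rur eur evr.
  have cT : conn (ostep b Rb) ur w.
    by apply: conn_osub cw => // p; rewrite /Rb /rect; clear -r5; lia.
  have rT : Rb ur by move: rw; rewrite /Rb /rect; clear -r5; lia.
  have [z [c1 c2]] := cross_meet cT rT eur ew cb rxb exb eyb.
  apply: (conn_trans (inA _ _ _ in_b c1)); exact: conn_osym (inA _ _ _ in_b c2).
pose K := cl b A ur.
have Kur : K ur by apply/asboolP; exact: conn_refl.
have Kxt : K xt by apply/asboolP.
have Kxb : K xb by apply/asboolP.
have Kul : K ul by apply/asboolP; apply: (conn_trans cut); exact: conn_osym.
exists ur; split; first by apply: RA; exact: in_r.
rewrite -/A -/K => x0 s ps hx hy; apply: contrapT => /negP nK.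
have {}nK : all (predC K) (x0 :: s) by rewrite all_predC.
have F0 : (nm x0 < r.*2)%N by clear -hx r5; lia.
have nF : ~~ (nm (last x0 s) < r.*2)%N by rewrite -leqNgt.
have [s1 [y [s2 [es h1 h2]]]] := path_first_exit (F := fun v => (nm v < r.*2)%N) ps F0 nF.
have [cy ay] : conn (restr (restr adj (predC K)) (fun v => (nm v <= r.*2)%N)) x0 y /\
    nm y = r.*2.
  move: ps; rewrite es -cat_rcons cat_path rcons_path => /andP[/andP[p1 a1] _].
  have ny : nm y = r.*2.
    have hl : (nm (last x0 s1) < r.*2)%N by move/allP: h1; apply; rewrite mem_last.
    have h3 := nm_adj a1; move: h2; rewrite -leqNgt => h2.
    by clear -h2 h3 hl; lia.
  split => //; exists (rcons s1 y); rewrite last_rcons; split => //.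
  apply: path_restr; first apply: path_restr.
  - by rewrite rcons_path p1.
  - by move: nK; rewrite es -cat_rcons -cat_cons all_cat => /andP[].
  - rewrite -rcons_cons all_rcons ny leqnn /=; apply: sub_all h1 => v /=; exact: ltnW.
have nKy : ~~ K y.
  by move/allP: nK => /(_ y); rewrite es inE mem_cat inE eqxx !orbT => /(_ isT).
have side (F W : pred vertex) : F x0 -> ~~ F y ->
    (forall v, ~~ F v -> (nm v <= r.*2)%N -> W v) ->
    exists p v, [/\ F p, ~~ F v, adj p v, W v & ~~ K v /\
      conn (restr (restr adj (predC K)) W) v y].
  move=> Fx nFy FW; have [p [v [_ Fp nFv rpv cv]]] := conn_last_exit cy Fx nFy.
  case/and3P: (rpv) => /and3P[apv _ nKv] _ hv.
  exists p, v; split => //; first exact: FW.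
  split => //; apply: conn_sub cv => a c /and3P[/and3P[h ha hc] Fa Fc].
  by apply/and3P; split => //; exact: FW.
have [hx1 hx2] : (- r%:Z <= x0.1 <= r%:Z) /\ (- r%:Z <= x0.2 <= r%:Z).
  by move: hx; rewrite nm_rect /rect => /andP.
have yside : [\/ y.1 = 2 * r%:Z, y.1 = - (2 * r%:Z), y.2 = 2 * r%:Z | y.2 = - (2 * r%:Z)].
  clear -ay; case: y ay => a b; rewrite /nm /= => ay.
  have : [|| a == 2 * r%:Z, a == - (2 * r%:Z), b == 2 * r%:Z | b == - (2 * r%:Z)] by lia.
  by case/or4P => /eqP h; [apply: Or41|apply: Or42|apply: Or43|apply: Or44].
have nmW v : (nm v <= r.*2)%N ->
    (- (2 * r%:Z) <= v.1 <= 2 * r%:Z) && (- (2 * r%:Z) <= v.2 <= 2 * r%:Z).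
  by rewrite nm_rect /rect -mul2n PoszM.
have KK (W : pred vertex) p q : conn (restr (restr adj K) W) p q ->
    conn (restr (restr adj (predC (predC K))) W) p q.
  by apply: conn_sub => a c; rewrite /restr /= !negbK.
have ry : (- (2 * r%:Z) <= y.1 <= 2 * r%:Z) && (- (2 * r%:Z) <= y.2 <= 2 * r%:Z).
  by apply: nmW; rewrite ay.
case: yside => ey.
- have [|||p [v [Fp nFv apv Wv [nKv cv]]]] := side (fun v => v.1 <= r%:Z) Rr.
  + by case/andP: hx1.
  + by rewrite ey -ltNge; clear -r5; lia.
  + by move=> v; rewrite -ltNge => g1 /nmW; rewrite /Rr /rect; clear -g1; lia.
  have ev : v.1 = r%:Z + 1.
    by move: Fp nFv apv; clear; rewrite /adj; case: (p) (v) => [p1 p2] [w1 w2] /=; lia.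
  apply: (@no_crossing_disjoint K (r%:Z + 1) (2 * r%:Z) (- (2 * r%:Z)) (2 * r%:Z)
    v y ur vr) => //; apply: (cl_path _ cr Kur).
  by move=> w hw; apply: RA; exact: in_r.
- have [|||p [v [Fp nFv apv Wv [nKv cv]]]] := side (fun v => - r%:Z <= v.1) Rl.
  + by case/andP: hx1.
  + by rewrite ey -ltNge; clear -r5; lia.
  + by move=> v; rewrite -ltNge => g1 /nmW; rewrite /Rl /rect; clear -g1; lia.
  have ev : v.1 = - r%:Z - 1.
    by move: Fp nFv apv; clear; rewrite /adj; case: (p) (v) => [p1 p2] [w1 w2] /=; lia.
  have cv' : conn (restr (restr adj (predC K)) Rl) y v.
    by apply: conn_sym cv; do 2 apply: restr_sym; exact: adj_sym.
  apply: (@no_crossing_disjoint K (- (2 * r%:Z)) (- r%:Z - 1) (- (2 * r%:Z)) (2 * r%:Z)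
    y v ul vl) => //.
    by apply: (cl_path _ cl' Kul) => w hw; apply: RA; exact: in_l.
  by rewrite /rect; clear -ry ey r5; lia.
- have [|||p [v [Fp nFv apv Wv [nKv cv]]]] := side (fun v => v.2 <= r%:Z) Rt.
  + by case/andP: hx2.
  + by rewrite ey -ltNge; clear -r5; lia.
  + by move=> v; rewrite -ltNge => g1 /nmW; rewrite /Rt /rect; clear -g1; lia.
  have ev : v.2 = r%:Z + 1.
    by move: Fp nFv apv; clear; rewrite /adj; case: (p) (v) => [p1 p2] [w1 w2] /=; lia.
  apply: (@no_crossing_disjoint (predC K) (- (2 * r%:Z)) (2 * r%:Z) (r%:Z + 1) (2 * r%:Z)
    xt yt v y) => //.
    by apply: KK; apply: (cl_path _ ct Kxt) => w hw; apply: RA; exact: in_t.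
  by rewrite /= negbK.
- have [|||p [v [Fp nFv apv Wv [nKv cv]]]] := side (fun v => - r%:Z <= v.2) Rb.
  + by case/andP: hx2.
  + by rewrite ey -ltNge; clear -r5; lia.
  + by move=> v; rewrite -ltNge => g1 /nmW; rewrite /Rb /rect; clear -g1; lia.
  have ev : v.2 = - r%:Z - 1.
    by move: Fp nFv apv; clear; rewrite /adj; case: (p) (v) => [p1 p2] [w1 w2] /=; lia.
  have cv' : conn (restr (restr adj (predC K)) Rb) y v.
    by apply: conn_sym cv; do 2 apply: restr_sym; exact: adj_sym.
  apply: (@no_crossing_disjoint (predC K) (- (2 * r%:Z)) (2 * r%:Z) (- (2 * r%:Z)) (- r%:Z - 1)
    xb yb y v) => //.
  + by rewrite /rect; clear -ry ey r5; lia.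
  + by apply: KK; apply: (cl_path _ cb Kxb) => w hw; apply: RA; exact: in_b.
  by rewrite /= negbK.
Qed.
End Circuits.

Section Blocking.
Variable r : nat.
Hypothesis r5 : (5 <= r)%N.

(** After its last visit to the columns between [-r] and [r], the path crosses a side rectangle
    horizontally, against the dual vertical crossing there. Dual crossings start one row lower
    because of the half shift. *)
Lemma no_side_escape (b d : cfg) x y : (forall e, b e -> ~~ d (dedge e)) ->
  vcross r%:Z (2 * r%:Z - 1) (- (2 * r%:Z) - 1) (2 * r%:Z) d ->
  vcross (- (2 * r%:Z)) (- r%:Z - 1) (- (2 * r%:Z) - 1) (2 * r%:Z) d ->
  nm x = r -> conn (ostep b (shell r r.*2)) x y ->
  y.1 = 2 * r%:Z \/ y.1 = - (2 * r%:Z) -> False.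
Proof.
move=> bd [u1 [v1 [ru1 eu1 ev1 c1]]] [u2 [v2 [ru2 eu2 ev2 c2]]] ex cxy ey.
have hx : - r%:Z <= x.1 <= r%:Z.
  have : (nm x <= r)%N by rewrite ex.
  by rewrite nm_rect => /andP[].
have nmW v : shell r r.*2 v ->
    (- (2 * r%:Z) <= v.1 <= 2 * r%:Z) && (- (2 * r%:Z) <= v.2 <= 2 * r%:Z).
  by move=> /andP[_]; rewrite nm_rect /rect -mul2n PoszM.
case: ey => ey.
- have Fx : x.1 <= r%:Z by case/andP: hx.
  have nFy : ~~ (y.1 <= r%:Z) by rewrite ey -ltNge; clear -r5; lia.
  have [p [w [_ Fp nFw rpw cw]]] := conn_last_exit (F := fun v => v.1 <= r%:Z) cxy Fx nFy.
  have [apw _ /nmW sp /nmW sw] := and4P rpw.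
  have ep : p.1 = r%:Z.
    clear -Fp nFw apw; move: Fp nFw apw; rewrite /adj.
    by case: (p) (w) => [p1 p2] [w1 w2] /=; lia.
  have rp : rect r%:Z (2 * r%:Z) (- (2 * r%:Z)) (2 * r%:Z) p.
    by rewrite /rect; clear -sp ep r5; lia.
  have cpy : conn (ostep b (rect r%:Z (2 * r%:Z) (- (2 * r%:Z)) (2 * r%:Z))) p y.
    apply: (conn_trans (y := w)).
      apply: conn_step; case/and4P: rpw => _ bpw _ _; apply/and4P; split => //.
      by rewrite /rect; clear -sw nFw; lia.
    apply: conn_sub cw => a c /and3P[/and4P[aac bac /nmW sa /nmW sc] Fa Fc].
    apply/and4P; split => //; rewrite /rect.
      by move: Fa => /= Fa; clear -sa Fa; lia.
    by move: Fc => /= Fc; clear -sc Fc; lia.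
  have hD v : rect r%:Z (2 * r%:Z - 1) (- (2 * r%:Z) - 1) (2 * r%:Z) v ->
      r%:Z <= v.1 < 2 * r%:Z.
    by rewrite /rect => /andP[h _]; clear -h; lia.
  have hu : u1.2 < - (2 * r%:Z) by rewrite eu1; clear; lia.
  have hv : 2 * r%:Z <= v1.2 by rewrite ev1.
  exact: (no_crossing_dual bd hD cpy rp ep ey c1 hu hv).
- have Fx : - r%:Z <= x.1 by case/andP: hx.
  have nFy : ~~ (- r%:Z <= y.1) by rewrite ey -ltNge; clear -r5; lia.
  have [p [w [_ Fp nFw rpw cw]]] := conn_last_exit (F := fun v => - r%:Z <= v.1) cxy Fx nFy.
  have [apw _ /nmW sp /nmW sw] := and4P rpw.
  have ep : p.1 = - r%:Z.
    clear -Fp nFw apw; move: Fp nFw apw; rewrite /adj.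
    by case: (p) (w) => [p1 p2] [w1 w2] /=; lia.
  have cpy : conn (ostep b (rect (- (2 * r%:Z)) (- r%:Z) (- (2 * r%:Z)) (2 * r%:Z))) p y.
    apply: (conn_trans (y := w)).
      apply: conn_step; case/and4P: rpw => _ bpw _ _; apply/and4P; split => //.
        by rewrite /rect; clear -sp ep r5; lia.
      by rewrite /rect; clear -sw nFw; lia.
    apply: conn_sub cw => a c /and3P[/and4P[aac bac /nmW sa /nmW sc] Fa Fc].
    apply/and4P; split => //; rewrite /rect.
      by move: Fa => /= Fa; clear -sa Fa; lia.
    by move: Fc => /= Fc; clear -sc Fc; lia.
  have ry : rect (- (2 * r%:Z)) (- r%:Z) (- (2 * r%:Z)) (2 * r%:Z) y.
    apply: conn_ostep_in cpy; rewrite /rect; clear -sp ep r5; lia.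
  have hD v : rect (- (2 * r%:Z)) (- r%:Z - 1) (- (2 * r%:Z) - 1) (2 * r%:Z) v ->
      - (2 * r%:Z) <= v.1 < - r%:Z.
    by rewrite /rect => /andP[h _]; clear -h; lia.
  have hu : u2.2 < - (2 * r%:Z) by rewrite eu2; clear; lia.
  have hv : 2 * r%:Z <= v2.2 by rewrite ev2.
  exact: (no_crossing_dual bd hD (conn_osym cpy) ry ey ep c2 hu hv).
Qed.

Lemma dedge_eswap e : dedge (eswap e) = eswap (dedge e).
Proof. by case: e => [[i j] []]. Qed.

Lemma no_escape (d : cfg) :
  vcross r%:Z (2 * r%:Z - 1) (- (2 * r%:Z) - 1) (2 * r%:Z) d ->
  vcross (- (2 * r%:Z)) (- r%:Z - 1) (- (2 * r%:Z) - 1) (2 * r%:Z) d ->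
  hcross (- (2 * r%:Z) - 1) (2 * r%:Z) r%:Z (2 * r%:Z - 1) d ->
  hcross (- (2 * r%:Z) - 1) (2 * r%:Z) (- (2 * r%:Z)) (- r%:Z - 1) d ->
  ~ escape r r.*2 (codual d).
Proof.
move=> c1 c2 c3 c4 [x [y [ex ey cxy]]].
have yside : [|| y.1 == 2 * r%:Z, y.1 == - (2 * r%:Z), y.2 == 2 * r%:Z | y.2 == - (2 * r%:Z)].
  by clear -ey; case: y ey => a b; rewrite /nm /= => ey; lia.
have bd e : codual d e -> ~~ d (dedge e) by [].
(* Swapping the coordinates commutes with [dedge] and turns top and bottom into right and left. *)
have hv (a1 a2 b1 b2 : int) : hcross a1 a2 b1 b2 d ->
    vcross b1 b2 a1 a2 (fun e => d (eswap e)).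
  move=> [p [q [rp ep eq c]]]; exists (vswap p), (vswap q); split => //.
    by move: rp; rewrite /rect /vswap /= => /andP[-> ->].
  apply: (conn_hom hom_swap (V := rect a1 a2 b1 b2)).
    by move=> v; rewrite /rect /vswap /= => /andP[-> ->].
  by apply: conn_osub c => // e _; rewrite eswapK.
case/or4P: yside => /eqP h.
- by apply: (no_side_escape bd c1 c2 ex cxy); left.
- by apply: (no_side_escape bd c1 c2 ex cxy); right.
- apply: (@no_side_escape (fun e => codual d (eswap e)) (fun e => d (eswap e))
     (vswap x) (vswap y) _ (hv _ _ _ _ c3) (hv _ _ _ _ c4)).
  + by move=> e /bd; rewrite dedge_eswap.
  + by move: ex; rewrite /nm /vswap /= maxnC.
  + apply: (conn_hom hom_swap (V := shell r r.*2)).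
      by move=> v; rewrite /shell /nm /vswap /= maxnC.
    by apply: conn_osub cxy => // e _; rewrite eswapK.
  + by left.
- apply: (@no_side_escape (fun e => codual d (eswap e)) (fun e => d (eswap e))
     (vswap x) (vswap y) _ (hv _ _ _ _ c3) (hv _ _ _ _ c4)).
  + by move=> e /bd; rewrite dedge_eswap.
  + by move: ex; rewrite /nm /vswap /= maxnC.
  + apply: (conn_hom hom_swap (V := shell r r.*2)).
      by move=> v; rewrite /shell /nm /vswap /= maxnC.
    by apply: conn_osub cxy => // e _; rewrite eswapK.
  + by right.
Qed.
End Blocking.

Lemma escape_of_hcross r u b : (r <= u)%N ->
  hcross r%:Z u%:Z (- r%:Z) r%:Z b -> escape r u b.
Proof.
move=> ru [x [y [rx ex ey c]]]; exists x, y.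
have sh v : rect r%:Z u%:Z (- r%:Z) r%:Z v -> shell r u v.
  by clear -ru; case: v => a b'; rewrite /shell /nm /rect /=; lia.
have ry := conn_ostep_in rx c.
split.
- by clear -rx ex; case: x rx ex => a b'; rewrite /nm /rect /=; lia.
- by clear -ry ey ru; case: y ry ey => a b'; rewrite /nm /rect /=; lia.
- exact: conn_osub c.
Qed.

Section AnnulusProb.
Variables (R : realType) (mu : iid_law R).

Lemma four_fkg S1 S2 S3 S4 (A1 A2 A3 A4 : set cfg) (c : R) : 0 <= c ->
  fin S1 -> fin S2 -> fin S3 -> fin S4 ->
  bdep S1 A1 -> bdep S2 A2 -> bdep S3 A3 -> bdep S4 A4 ->
  binc A1 -> binc A2 -> binc A3 -> binc A4 ->
  c <= bpr mu A1 -> c <= bpr mu A2 -> c <= bpr mu A3 -> c <= bpr mu A4 ->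
  c ^+ 4 <= bpr mu (A1 `&` A2 `&` (A3 `&` A4)).
Proof.
move=> c0 f1 f2 f3 f4 d1 d2 d3 d4 i1 i2 i3 i4 h1 h2 h3 h4.
have finU (S S' : pred edge) : fin S -> fin S' -> fin (predU S S').
  move=> [s hs] [s' hs']; exists (s ++ s') => e /orP[/hs|/hs'];
  by rewrite mem_cat => ->; rewrite ?orbT.
have dU (S S' : pred edge) (A B : set cfg) : bdep S A -> bdep S' B -> bdep (predU S S') (A `&` B).
  by move=> dA dB; apply: bdepI; [apply: bdepS dA|apply: bdepS dB] => e /= ->; rewrite ?orbT.
have h12 : c * c <= bpr mu (A1 `&` A2).
  apply: le_trans (bpr_fkg mu f1 d1 i1 f2 d2 i2); exact: ler_pM.
have h34 : c * c <= bpr mu (A3 `&` A4).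
  apply: le_trans (bpr_fkg mu f3 d3 i3 f4 d4 i4); exact: ler_pM.
apply: le_trans (bpr_fkg mu (finU _ _ f1 f2) (dU _ _ _ _ d1 d2) (bincI i1 i2)
  (finU _ _ f3 f4) (dU _ _ _ _ d3 d4) (bincI i3 i4)).
rewrite (exprD c 2 2) !expr2; apply: ler_pM => //; exact: mulr_ge0.
Qed.

Lemma annulus_bounds : exists c, [/\ 0 < c, c < 1 & forall r, (5 <= r)%N ->
  [/\ c <= bpr mu (circ r r.*2), bpr mu (escape r r.*2) <= 1 - c &
      c <= bpr mu (escape r (4 * r))]].
Proof.
have [c0 [c00 hc]] := rsw mu.
(* The power is for the four crossings that form a primal or dual circuit; the minimum with 1/2
   ensures [c < 1]. *)
pose c := Num.min (c0 ^+ 4) 2^-1.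
have cc : c <= c0 ^+ 4 by rewrite /c ge_min lexx.
have c1 : c <= 2^-1 by rewrite /c ge_min lexx orbT.
have cpos : 0 < c by rewrite /c lt_min exprn_gt0 //= invr_gt0.
exists c; split => //; first by lra.
move=> r r5; have c0' := ltW c00; split.
- apply: (le_trans cc).
  have := four_fkg c0' (fin_rect _ _ _ _) (fin_rect _ _ _ _) (fin_rect _ _ _ _)
    (fin_rect _ _ _ _)
    (@bdep_vcross (r%:Z + 1) (2 * r%:Z) (- (2 * r%:Z)) (2 * r%:Z))
    (@bdep_vcross (- (2 * r%:Z)) (- r%:Z - 1) (- (2 * r%:Z)) (2 * r%:Z))
    (@bdep_hcross (- (2 * r%:Z)) (2 * r%:Z) (r%:Z + 1) (2 * r%:Z))
    (@bdep_hcross (- (2 * r%:Z)) (2 * r%:Z) (- (2 * r%:Z)) (- r%:Z - 1))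
    (@binc_vcross _ _ _ _) (@binc_vcross _ _ _ _) (@binc_hcross _ _ _ _) (@binc_hcross _ _ _ _).
  rewrite (@bpr_vcross _ mu _ _ _ _ r.-1 (4 * r)); try lia.
  rewrite (@bpr_vcross _ mu _ _ _ _ r.-1 (4 * r)); try lia.
  rewrite (@bpr_hcross _ mu _ _ _ _ (4 * r) r.-1); try lia.
  rewrite (@bpr_hcross _ mu _ _ _ _ (4 * r) r.-1); try lia.
  have h : c0 <= hp mu (4 * r) r.-1 by apply: hc; lia.
  move=> /(_ h h h h) /le_trans; apply; apply: lpr_le.
  + apply: pmI; apply: pmI;
      [exact: pm_bev (fin_rect _ _ _ _) (@bdep_vcross _ _ _ _)|
       exact: pm_bev (fin_rect _ _ _ _) (@bdep_vcross _ _ _ _)|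
       exact: pm_bev (fin_rect _ _ _ _) (@bdep_hcross _ _ _ _)|
       exact: pm_bev (fin_rect _ _ _ _) (@bdep_hcross _ _ _ _)].
  + exact: pm_bev (fin_ann _ _) (@bdep_circ _ _).
  + by move=> w _ [[h1 h2] [h3 h4]]; apply: circ_of_crossings.
- have -> : bpr mu (escape r r.*2) = 1 - bpr mu (~` [set d | escape r r.*2 (codual d)]).
    rewrite -(bpr_codual mu (fin_shell _ _) (@bdep_escape _ _)).
    have fS : fin (fun e => edges_in (shell r r.*2) (undual e)).
      have [s hs] := fin_shell r r.*2; exists (map dedge s) => e /hs h.
      by rewrite -[e]undualK map_f.
    rewrite (bprC mu fS); first by rewrite opprB addrC subrK.
    move=> b b' bb'; apply: bdep_escape => e Se.
    by rewrite /codual bb' // dedgeK.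
  rewrite lerD2l lerN2; apply: (le_trans cc).
  have := four_fkg c0' (fin_rect _ _ _ _) (fin_rect _ _ _ _) (fin_rect _ _ _ _)
    (fin_rect _ _ _ _)
    (@bdep_vcross r%:Z (2 * r%:Z - 1) (- (2 * r%:Z) - 1) (2 * r%:Z))
    (@bdep_vcross (- (2 * r%:Z)) (- r%:Z - 1) (- (2 * r%:Z) - 1) (2 * r%:Z))
    (@bdep_hcross (- (2 * r%:Z) - 1) (2 * r%:Z) r%:Z (2 * r%:Z - 1))
    (@bdep_hcross (- (2 * r%:Z) - 1) (2 * r%:Z) (- (2 * r%:Z)) (- r%:Z - 1))
    (@binc_vcross _ _ _ _) (@binc_vcross _ _ _ _) (@binc_hcross _ _ _ _) (@binc_hcross _ _ _ _).
  rewrite (@bpr_vcross _ mu _ _ _ _ r.-1 (4 * r).+1); try lia.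
  rewrite (@bpr_vcross _ mu _ _ _ _ r.-1 (4 * r).+1); try lia.
  rewrite (@bpr_hcross _ mu _ _ _ _ (4 * r).+1 r.-1); try lia.
  rewrite (@bpr_hcross _ mu _ _ _ _ (4 * r).+1 r.-1); try lia.
  have h : c0 <= hp mu (4 * r).+1 r.-1 by apply: hc; lia.
  move=> /(_ h h h h) /le_trans; apply; apply: lpr_le.
  + apply: pmI; apply: pmI;
      [exact: pm_bev (fin_rect _ _ _ _) (@bdep_vcross _ _ _ _)|
       exact: pm_bev (fin_rect _ _ _ _) (@bdep_vcross _ _ _ _)|
       exact: pm_bev (fin_rect _ _ _ _) (@bdep_hcross _ _ _ _)|
       exact: pm_bev (fin_rect _ _ _ _) (@bdep_hcross _ _ _ _)].
  + have fS : fin (fun e => edges_in (shell r r.*2) (undual e)).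
      have [s hs] := fin_shell r r.*2; exists (map dedge s) => e /hs he.
      by rewrite -[e]undualK map_f.
    apply: (pm_bev fS); apply: bdepC => b b' bb'; apply: bdep_escape => e Se.
    by rewrite /codual bb' // dedgeK.
  + by move=> w _ [[h1 h2] [h3 h4]]; apply: no_escape.
- have h : c <= c0.
    apply: (le_trans cc); rewrite exprS ler_piMr //.
    rewrite exprn_ile1 //; have := hc 0%N 4 isT isT; move=> /le_trans; apply.
    exact: bpr_le1 (fin_rect _ _ _ _) (@bdep_hcross _ _ _ _).
  apply: (le_trans h); apply: (le_trans (hc (3 * r)%N r.*2 _ _)); try lia.
  rewrite -(@bpr_hcross _ mu r%:Z (4 * r)%N%:Z (- r%:Z) r%:Z); try lia.
  apply: (bpr_le mu (fin_rect _ _ _ _) (@bdep_hcross _ _ _ _) (fin_shell _ _) (@bdep_escape _ _)).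
  by move=> b; apply: escape_of_hcross; lia.
Qed.

End AnnulusProb.

Lemma exp_small (R : realType) (x e : R) : 0 <= x -> x < 1 -> 0 < e -> exists n, x ^+ n <= e.
Proof.
move=> x0 x1 e0.
have h : (fun n => x ^+ n) @ \oo --> (0 : R) by apply: cvg_expr; rewrite ger0_norm.
have /cvgrPdist_le /(_ e e0) [n _ hn] := h.
exists n; have := hn n (leqnn n); rewrite /= sub0r normrN ger0_norm // exprn_ge0 //.
Qed.

(** Dyadic annuli are independent and each contains a circuit with probability at least [c], so [k]
    of them all fail with probability at most [(1 - c) ^+ k]. *)
Lemma circ_whp (R : realType) (mu : iid_law R) (l : nat) (e : R) : 0 < e ->
  exists u, (l < u)%N /\ 1 - e <= bpr mu (circ l u).
Proof.
move=> e0; have [c [c0 c1 hc]] := annulus_bounds mu.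
pose r k := (maxn l 5 * 2 ^ k)%N.
have r5 k : (5 <= r k)%N.
  have h0 : (0 < 2 ^ k)%N by rewrite expn_gt0.
  by rewrite /r; nia.
have rS k : r k.+1 = (r k).*2 by rewrite /r expnS; lia.
have rl k : (l <= r k)%N.
  have h0 : (0 < 2 ^ k)%N by rewrite expn_gt0.
  by rewrite /r; nia.
have h k : bpr mu (~` circ l (r k)) <= (1 - c) ^+ k.
  elim: k => [|k IH].
    rewrite expr0; exact: bpr_le1 (fin_ann _ _) (bdepC (@bdep_circ _ _)).
  have [hck _ _] := hc _ (r5 k).
  apply: (@le_trans _ _ (bpr mu (~` circ l (r k) `&` ~` circ (r k) (r k).*2))).
    apply: (bpr_le mu (fin_ann _ _) (bdepC (@bdep_circ _ _)) (fin_ann l (r k).*2)).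
      apply: bdepI; apply: bdepC; apply: bdepS (@bdep_circ _ _) => ee;
      rewrite /edges_in /ann => /andP[/andP[h1 h2] /andP[h3 h4]];
      have := rl k; lia.
    move=> b nb; split => h; apply: nb; rewrite rS; apply: circ_mono h => //; first by lia.
  rewrite (bpr_indep mu (fin_ann _ _) (bdepC (@bdep_circ _ _)) (fin_ann _ _)
    (bdepC (@bdep_circ _ _))); last first.
    move=> ee; rewrite /edges_in /ann => /andP[/andP[h1 h2] _].
    by rewrite negb_and; apply/orP; left; lia.
  rewrite exprS mulrC; apply: ler_pM; rewrite ?lpr_ge0 //.
  by rewrite (bprC mu (fin_ann _ _) (@bdep_circ _ _)); lra.
have [k hk] := @exp_small R (1 - c) e ltac:(lra) ltac:(lra) e0.
exists (r k.+1); split.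
  by rewrite rS; have := rl k; have := r5 k; lia.
have := h k; rewrite (bprC mu (fin_ann _ _) (@bdep_circ _ _)) => h1.
apply: (@le_trans _ _ (bpr mu (circ l (r k)))); first by lra.
apply: (bpr_le mu (fin_ann _ _) (@bdep_circ _ _) (fin_ann _ _) (@bdep_circ _ _)) => b.
by apply: circ_mono => //; rewrite rS; lia.
Qed.

(* Hopf's contraction of ratios, behind the improvement from [delta] to
   [(1 - c ^+ 3) * delta + e] in [good_step]. *)
Lemma ratio_contraction (R : realType) (I : Type) (ks : seq I) (v w a : I -> R)
    (c rho delta : R) :
  0 <= rho <= 1 -> 0 < c < 1 ->
  (forall k, 0 <= w k <= v k) -> (forall k, 0 <= a k) ->
  (forall k, `|w k - rho * v k| <= delta * v k) ->
  exists rho', 0 <= rho' <= 1 /\ forall (M : I -> R) (b : R), 0 <= b ->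
    (forall k, c * (a k * b) <= M k <= a k * b) ->
    `|\sum_(k <- ks) w k * M k - rho' * \sum_(k <- ks) v k * M k| <=
      (1 - c) * delta * \sum_(k <- ks) v k * M k.
Proof.
move=> hr hc hw ha hd.
pose W := \sum_(k <- ks) v k * a k; pose We := \sum_(k <- ks) w k * a k.
have v0 k : 0 <= v k by have := hw k; lra.
have W0 : 0 <= W by apply: sumr_ge0 => k _; exact: mulr_ge0.
have We0 : 0 <= We.
  by apply: sumr_ge0 => k _; apply: mulr_ge0 => //; case/andP: (hw k).
have WeW : We <= W.
  by apply: ler_sum => k _; apply: ler_wpM2r => //; case/andP: (hw k).
have bnd (f : I -> R) : (forall k, 0 <= f k) ->
    `|\sum_(k <- ks) w k * f k - rho * \sum_(k <- ks) v k * f k| <=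
    delta * \sum_(k <- ks) v k * f k.
  move=> f0; rewrite !mulr_sumr -sumrB; apply: (le_trans (ler_norm_sum _ _ _)).
  apply: ler_sum => k _; rewrite !mulrA -mulrBl normrM (ger0_norm (f0 k)).
  exact: ler_wpM2r.
have hWe := bnd a ha; rewrite -/W -/We in hWe.
pose p := if W == 0 then rho else We / W.
have pW : p * W = We.
  rewrite /p; case: eqP => [w0|/eqP w0]; last by rewrite divfK.
  by move: hWe; rewrite w0 !mulr0 subr0 normr_le0 => /eqP ->.
have [p01 pd] : 0 <= p <= 1 /\ `|p - rho| * W <= delta * W.
  split; last by rewrite -[X in _ * X](ger0_norm W0) -normrM mulrBl pW.
  rewrite /p; case: eqP => // /eqP w0.
  have Wp : 0 < W by rewrite lt_neqAle eq_sym w0.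
  by rewrite divr_ge0 //= ler_pdivrMr // mul1r.
(* The rank-one part [c * a k * b] of [M k] has the ratio [p] exactly, whatever [M] is; the
   nonnegative remainder, of total weight [N - c * b * W], has a ratio within [delta] of [rho].
   Replacing [c * b * W] by [c * N] costs at most [c * delta * (b * W - N)], and the two errors add
   up to [(1 - c) * delta * N]. *)
exists (c * p + (1 - c) * rho); split; first by nra.
move=> M b b0 hM; set N := \sum_(k <- ks) v k * M k; set Ne := \sum_(k <- ks) w k * M k.
have NbW : N <= b * W.
  rewrite /N /W mulr_sumr; apply: ler_sum => k _; rewrite mulrCA.
  by apply: ler_wpM2l => //; rewrite mulrC; case/andP: (hM k).
have hf k : 0 <= M k - c * (a k * b) by rewrite subr_ge0; case/andP: (hM k).
have := bnd _ hf.
have sE (z : I -> R) : \sum_(k <- ks) z k * (M k - c * (a k * b)) =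
    \sum_(k <- ks) z k * M k - c * b * \sum_(k <- ks) z k * a k.
  by rewrite mulr_sumr -sumrB; apply: eq_bigr => k _; ring.
rewrite !sE -/N -/Ne -/W -/We -pW => h.
have Ic : `|c * (p - rho) * (b * W - N)| <= c * (delta * (b * W - N)).
  have [W00|Wn] := eqVneq W 0.
    have N00 : N = 0.
      have : 0 <= N.
        apply: sumr_ge0 => k _; apply: mulr_ge0 => //.
        have /andP[h1 _] := hM k; apply: le_trans h1.
        by rewrite !mulr_ge0 //; case/andP: hc => /ltW.
      by move: NbW; rewrite W00 mulr0; lra.
    by rewrite W00 N00 mulr0 subrr !mulr0 normr0.
  have Wp : 0 < W by rewrite lt_neqAle eq_sym Wn.
  have {}pd : `|p - rho| <= delta by move: pd; rewrite ler_pM2r.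
  rewrite -mulrA normrM (gtr0_norm (proj1 (andP hc))) normrM.
  have bWN : 0 <= b * W - N by rewrite subr_ge0.
  rewrite (ger0_norm bWN).
  apply: ler_wpM2l; first by case/andP: hc => /ltW.
  exact: ler_wpM2r.
have -> : Ne - (c * p + (1 - c) * rho) * N =
  (Ne - c * b * (p * W) - rho * (N - c * b * W)) + c * (p - rho) * (b * W - N) by ring.
apply: (le_trans (ler_normD _ _)); apply: (le_trans (lerD h Ic)).
by apply/eqP/eqP; rewrite le_eqVlt; apply/orP; left; apply/eqP; ring.
Qed.

(** * Decoupling across a circuit *)

Definition box (n : nat) : pred vertex := fun v => (nm v <= n)%N.
Definition ebox (n : nat) : pred edge := edges_in (box n).
Definition outer (n : nat) : pred vertex := fun v => (n < nm v)%N.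
Definition frz (S : pred edge) (b tau : cfg) : cfg := fun e => if S e then b e else tau e.

Lemma fin_ebox n : fin (ebox n).
Proof. exact: (@fin_nm (box n) n). Qed.

Lemma ebox_mono m n e : (m <= n)%N -> ebox m e -> ebox n e.
Proof. by rewrite /ebox /edges_in /box => h /andP[h1 h2]; apply/andP; split; lia. Qed.

Lemma ebox_outer n e : edges_in (outer n) e -> ebox n e = false.
Proof.
rewrite /ebox /edges_in /box /outer => /andP[h1 _]; apply/negP => /andP[h2 _].
by move: h1; rewrite ltnNge h2.
Qed.

Lemma conn_restr_between (r : rel vertex) (G : pred vertex) x y : conn r x y ->
  (forall v, conn r x v -> conn r v y -> G v) -> conn (restr r G) x y.
Proof.
move=> [s [ps ly]] h; exists s; split => //; apply: path_restr => //.
elim: s x ps ly h => [|z s IH] x /=.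
  by move=> _ -> h; rewrite h //; exact: conn_refl.
move=> /andP[rxz ps] ly h; rewrite h /=; last 2 first.
- exact: conn_refl.
- by apply: (conn_trans (conn_step rxz)); exists s.
apply: IH ps ly _ => v c1 c2; apply: h => //.
by apply: (conn_trans (conn_step rxz)).
Qed.

Section Separation.
Variables (l u : nat) (K : pred vertex) (r : rel vertex).
Hypothesis sK : sep l u K.
Hypothesis ra : forall x y, r x y -> adj x y.

Lemma sep_hit x y : conn r x y -> (nm x <= l)%N -> (u <= nm y)%N ->
  exists v, [/\ K v, conn r x v & conn r v y].
Proof.
move=> [s [ps ly]] hx hy.
have /hasP[v vs Kv] : has K (x :: s).
  by apply: sK => //; [apply: sub_path ps|rewrite ly].
exists v; split => //; case/splitPl: vs ps ly => p1 p2 <-;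
  rewrite cat_path last_cat => /andP[h1 h2] h3.
  by exists p1.
by exists p2.
Qed.

End Separation.

Lemma conn_predC (r : rel vertex) (K : pred vertex) x y :
  ~~ K x -> conn (restr r (predC K)) x y -> ~~ K y.
Proof. by move=> Kx; apply: (conn_closed (F := fun y => ~~ K y)) => // a c _ /and3P[]. Qed.

Lemma sep_first l u (K : pred vertex) (r : rel vertex) x y : sep l u K ->
  (forall v, K v -> ann l u v) -> (forall x y, r x y -> adj x y) -> (l < u)%N ->
  conn r x y -> (nm x <= l)%N -> (u <= nm y)%N ->
  exists k, [/\ K k, conn (restr r (box u)) x k & conn r k y].
Proof.
move=> sK hK ra lu c hx hy.
(* The path leaves [F] at a vertex of [K]: reaching radius [u] off [K] would contradict
   separation. *)
pose F v := ~~ K v && (nm v < u)%N.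
have nKx : ~~ K x by apply/negP => /hK /andP[h _]; move: h; rewrite ltnNge hx.
have Fx : F x by rewrite /F nKx (leq_ltn_trans hx lu).
have nFy : ~~ F y by rewrite /F negb_and -leqNgt hy orbT.
have [p [w [cp Fp nFw rpw cw]]] := conn_first_exit c Fx nFy.
have Kw : K w.
  apply: contrapT => /negP nKw; move: nFw; rewrite /F nKw /= -leqNgt => hw.
  have cxw : conn (restr r (predC K)) x w.
    apply: (conn_trans (y := p)).
      by apply: conn_sub cp => a b /and3P[rab /andP[Fa _] /andP[Fb _]]; apply/and3P.
    by apply: conn_step; apply/and3P; split => //; case/andP: Fp.
  have [|v [Kv cv _]] := sep_hit sK _ cxw hx hw.
    by move=> a b /and3P[/ra].
  by have := conn_predC nKx cv; rewrite Kv.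
exists w; split => //; apply: (conn_trans (y := p)).
  apply: conn_sub cp => a b /and3P[rab /andP[_ Fa] /andP[_ Fb]].
  by apply/and3P; split => //; exact: ltnW.
apply: conn_step; apply/and3P; split => //.
  by case/andP: Fp => _ /ltnW.
by case/andP: (hK _ Kw).
Qed.

(** After its last visit to [K] the path cannot return to radius [l], since it would have to meet
    [K] again on its way out. *)
Lemma sep_last l u (K : pred vertex) (r : rel vertex) k y : sep l u K ->
  (forall v, K v -> ann l u v) -> (forall x y, r x y -> adj x y) ->
  K k -> conn r k y -> (u <= nm y)%N -> ~~ K y ->
  exists k', K k' /\ conn (restr r (outer l)) k' y.
Proof.
move=> sK hK ra Kk c hy nKy.
have [p [w [cp Kp nKw rpw cw]]] := conn_last_exit c Kk nKy.
have cw' : conn (restr r (outer l)) w y.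
  have : conn (restr (restr r (predC K)) (outer l)) w y.
    apply: conn_restr_between cw _ => v cv cvy; rewrite /outer ltnNge; apply/negP => hv.
    have nKv := conn_predC nKw cv.
    have [|v' [Kv' cv' _]] := sep_hit sK _ cvy hv hy.
      by move=> a b /and3P[/ra].
    by have := conn_predC nKv cv'; rewrite Kv'.
  by apply: conn_sub => a b /and3P[/and3P[rab _ _] h1 h2]; apply/and3P.
exists p; split => //; apply: (conn_trans _ cw'); apply: conn_step; apply/and3P; split => //.
  by case/andP: (hK _ Kp).
case: cw' => -[|z s] /= [h e].
  rewrite e /outer; case/andP: (hK _ Kp) => h1 h2.
  by apply: leq_trans hy; apply: leq_trans h1 h2.
by case/andP: h => /and3P[].
Qed.

(* [tau] is the configuration off the box of radius [l]. *)
Definition target (l : nat) (tau : cfg) (Q : pred vertex) : set cfg :=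
  [set b | exists q, Q q /\ conn (ostep (frz (ebox l) b tau) predT) origin q].

Lemma bdep_target l tau Q : bdep (ebox l) (target l tau Q).
Proof.
move=> b b' bb' [q [Qq c]]; exists q; split => //; apply: conn_osub c => // e _.
by rewrite /frz; case: ifP => // /bb' ->.
Qed.

Lemma binc_target l tau Q : binc (target l tau Q).
Proof.
move=> b b' bb' [q [Qq c]]; exists q; split => //; apply: conn_osub c => // e _.
by rewrite /frz; case: ifP => // _ /bb'.
Qed.

Section Decomposition.
Variables (l u : nat).
Hypothesis lu : (l < u)%N.

Definition mid_edges : pred edge := fun e => ebox u e && ~~ ebox l e.

(* Junk value [origin] when [circ l u sigma] fails. *)
Definition hub_root (sigma : cfg) : vertex :=
  xget origin [set z | ann l u z /\ sep l u (cl sigma (ann l u) z)].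

Definition hub (sigma : cfg) : pred vertex := cl sigma (ann l u) (hub_root sigma).

Lemma hubP sigma : circ l u sigma -> ann l u (hub_root sigma) /\ sep l u (hub sigma).
Proof.
move=> [z hz]; rewrite /hub /hub_root; set A := [set z | _].
by have : A (xget origin A) by apply: xgetPex; exists z.
Qed.

Lemma hub_ann sigma k : circ l u sigma -> hub sigma k -> ann l u k.
Proof. by move=> /hubP[az _] /asboolP; exact: conn_ostep_in. Qed.

Lemma ann_mid e : edges_in (ann l u) e -> mid_edges e.
Proof.
rewrite /mid_edges /ebox /edges_in /box /ann => /andP[/andP[h1 h2] /andP[h3 h4]].
by rewrite h2 h4 /= negb_and -ltnNge h1.
Qed.

Lemma circ_rst b : circ l u (rst mid_edges b) <-> circ l u b.
Proof.
by split; apply: bdep_circ => e /ann_mid h; rewrite /rst h.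
Qed.

Lemma fin_mid : fin mid_edges.
Proof. by apply: finS (fin_ebox u) => e /andP[]. Qed.

Lemma hub_conn sigma x y : hub sigma x -> hub sigma y ->
  conn (ostep sigma (ann l u)) x y.
Proof. by move=> /asboolP cx /asboolP cy; apply: conn_trans cy; exact: conn_osym. Qed.

Section OuterTarget.
Variables (l1 : nat) (tau : cfg) (Q : pred vertex).
Hypothesis ul1 : (u <= l1)%N.
Hypothesis hQ : forall q, Q q -> (l1 < nm q)%N.

(** Three layers: [sigma] up to radius [u], [b] from there to [l1], and [tau] beyond. *)
Definition hub_cfg (sigma b : cfg) : cfg :=
  frz (ebox l1) (frz (ebox u) sigma b) tau.

Definition hub_target (sigma : cfg) : set cfg := [set b | exists k q,
  [/\ hub sigma k, Q q & conn (ostep (hub_cfg sigma b) (outer l)) k q]].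

Definition far_edges : pred edge := fun e => ebox l1 e && ~~ ebox u e.

Lemma fin_far : fin far_edges.
Proof. by apply: finS (fin_ebox l1) => e /andP[]. Qed.

Lemma bdep_hub_target sigma : bdep far_edges (hub_target sigma).
Proof.
move=> b b' bb' [k [q [Kk Qq c]]]; exists k, q; split => //.
apply: conn_osub c => // e _; rewrite /hub_cfg /frz.
by case: ifP => // h1; case: ifP => // h2; rewrite bb' // /far_edges h1 h2.
Qed.

(** Once [sigma] has fixed the hub, a path to the target splits at its first visit to the hub and at
    its last exit from it; conversely the two pieces are joined inside the hub, which is connected
    by open edges. The two resulting events depend on disjoint sets of edges. *)
Lemma target_decomp sigma b : circ l u sigma -> rst mid_edges b = sigma ->
  target l1 tau Q b <-> target l sigma (hub sigma) b /\ hub_target sigma b.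
Proof.
move=> cs eb; have [az sK] := hubP cs.
have hK v : hub sigma v -> ann l u v by exact: hub_ann.
have ra (c : cfg) V x y : ostep c V x y -> adj x y by case/and4P.
have sE e : mid_edges e -> sigma e = b e by move=> he; rewrite -eb /rst he.
have lE e : ebox l e -> ebox l1 e by apply: ebox_mono; lia.
have uE e : ebox u e -> ebox l1 e by exact: ebox_mono.
split=> [[q [Qq c]]|[[k [Kk c]] [k' [q [Kk' Qq c']]]]].
  have hq : (u <= nm q)%N by have := hQ Qq; lia.
  have nKq : ~~ hub sigma q.
    by apply/negP => /hK /andP[_ h]; have := hQ Qq; lia.
  have [k [Kk c1 c2]] := sep_first sK hK (ra _ _) lu c (leq0n _) hq.
  split.
    exists k; split => //; apply: conn_sub c1 => x y /and3P[/and4P[axy bxy _ _] bx by'].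
    apply/and4P; split => //; move: bxy.
    have he : ebox u (edge_of x y) by rewrite /ebox /edges_in edge_of_ends // bx.
    rewrite /frz (uE _ he); case: (boolP (ebox l _)) => // nl.
    by rewrite sE // /mid_edges he.
  have [k' [Kk' c3]] := sep_last sK hK (ra _ _) Kk c2 hq nKq.
  exists k', q; split => //; apply: conn_sub c3 => x y /and3P[/and4P[axy bxy _ _] ox oy].
  apply/and4P; split => //; move: bxy; rewrite /hub_cfg /frz.
  case: ifP => // h1; case: ifP => // h2.
  rewrite sE // /mid_edges h2 ebox_outer //.
  by rewrite /edges_in edge_of_ends // ox.
exists q; split => //; apply: (conn_trans (y := k)).
  apply: conn_osub c => // e _; rewrite /frz; case: (boolP (ebox l e)) => [/lE -> //|nl].
  by rewrite -eb /rst => /andP[/andP[/uE -> _]].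
apply: (conn_trans (y := k')).
  apply: conn_osub (hub_conn Kk Kk') => // e /ann_mid he.
  by rewrite sE // /frz uE //; case/andP: he.
apply: conn_osub c' => // e oe; rewrite /hub_cfg /frz.
case: ifP => // h1; case: ifP => // h2; rewrite sE //.
by rewrite /mid_edges h2 ebox_outer.
Qed.

End OuterTarget.
End Decomposition.

Section Kernel.
Variables (l u r l1 : nat) (tau : cfg) (Q : pred vertex).
Hypothesis lu : (l < u)%N.
Hypothesis ur : (u < r)%N.
Hypothesis r5 : (5 <= r)%N.
Hypothesis rl1 : (r.*2.*2 <= l1)%N.
Hypothesis hQ : forall q, Q q -> (l1 < nm q)%N.

Let mid_shell : pred vertex := fun v => (l < nm v <= r.*2)%N.

(* [hub_target] nearly factorises into these two events, the circuits at scales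
   [r] and [2r] and an arm across them providing the lower bound. *)
Definition inner_arm (sigma : cfg) : set cfg := [set b | exists k y,
  [/\ hub l u sigma k, nm y = r.*2 & conn (ostep (frz (ebox u) sigma b) mid_shell) k y]].

Definition outer_arm : set cfg := [set b | exists p w q,
  [/\ nm p = r.*2, (r.*2 < nm w)%N, ostep (frz (ebox l1) b tau) predT p w,
      Q q & conn (ostep (frz (ebox l1) b tau) (outer r.*2)) w q]].

Let near_edges : pred edge := fun e => ebox r.*2 e && ~~ ebox u e.
Let out_edges : pred edge := fun e => ebox l1 e && ~~ ebox r.*2 e.

Lemma fin_near : fin near_edges.
Proof. by apply: finS (fin_ebox r.*2) => e /andP[]. Qed.

Lemma fin_out : fin out_edges.
Proof. by apply: finS (fin_ebox l1) => e /andP[]. Qed.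

Lemma bdep_inner sigma : bdep near_edges (inner_arm sigma).
Proof.
move=> b b' bb' [k [y [Kk ey c]]]; exists k, y; split => //.
apply: conn_osub c => // e /andP[h1 h2]; rewrite /frz; case: ifP => // h3.
rewrite bb' // /near_edges h3 andbT.
by move: h1 h2; rewrite /mid_shell /ebox /edges_in /box => /andP[_ ->] /andP[_ ->].
Qed.

Lemma binc_inner sigma : binc (inner_arm sigma).
Proof.
move=> b b' bb' [k [y [Kk ey c]]]; exists k, y; split => //.
by apply: conn_osub c => // e _; rewrite /frz; case: ifP => // _ /bb'.
Qed.

Lemma bdep_outer : bdep out_edges outer_arm.
Proof.
move=> b b' bb' [p [w [q [ep hw rpw Qq c]]]]; exists p, w, q; split => //.
  case/and4P: rpw => apw bpw _ _; apply/and4P; split => //; move: bpw; rewrite /frz.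
  case: ifP => // h; rewrite bb' // /out_edges h /ebox /edges_in edge_of_ends //.
  by rewrite negb_and; apply/orP; right; rewrite /box -ltnNge.
apply: conn_osub c => // e he; rewrite /frz; case: ifP => // h; rewrite bb' //.
by rewrite /out_edges h ebox_outer.
Qed.

Lemma binc_outer : binc outer_arm.
Proof.
move=> b b' bb' [p [w [q [ep hw rpw Qq c]]]]; exists p, w, q; split => //.
  case/and4P: rpw => apw bpw _ _; apply/and4P; split => //; move: bpw; rewrite /frz.
  by case: ifP => // _ /bb'.
by apply: conn_osub c => // e _; rewrite /frz; case: ifP => // _ /bb'.
Qed.

Let ra (c : cfg) V x y : ostep c V x y -> adj x y.
Proof. by case/and4P. Qed.

Lemma hub_target_arms sigma b : circ l u sigma ->
  hub_target l u l1 tau Q sigma b -> inner_arm sigma b /\ outer_arm b.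
Proof.
move=> cs [k [q [Kk Qq c]]].
have hk : (nm k <= u)%N by case/andP: (hub_ann cs Kk).
have hk0 : (l < nm k)%N by case/andP: (hub_ann cs Kk).
have hq := hQ Qq.
split.
  pose F (v : vertex) := (nm v < r.*2)%N.
  have Fk : F k by rewrite /F; clear -hk ur; lia.
  have nFq : ~~ F q by rewrite /F -leqNgt; clear -hq rl1; lia.
  have [p [y [cp Fp nFy rpy _]]] := conn_first_exit c Fk nFq.
  have ey : nm y = r.*2.
    have := nm_adj (ra rpy); move: Fp nFy; rewrite /F -leqNgt.
    by clear; lia.
  exists k, y; split => //; apply: (conn_trans (y := p)).
    apply: conn_sub cp => x z /and3P[/and4P[axz bxz ox oz] Fx Fz].
    apply/and4P; split => //; last 2 first.
    - by apply/andP; split => //; exact: ltnW.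
    - by apply/andP; split => //; exact: ltnW.
    move: bxz; rewrite /hub_cfg /frz.
    have -> // : ebox l1 (edge_of x z).
    rewrite /ebox /edges_in edge_of_ends // /box.
    by move: Fx Fz; rewrite /F; clear -rl1; lia.
  apply: conn_step; case/and4P: rpy => apy bpy op oy; apply/and4P; split => //; last 2 first.
  - by apply/andP; split => //; exact: ltnW.
  - by apply/andP; split => //; rewrite ey.
  move: bpy; rewrite /hub_cfg /frz.
  have -> // : ebox l1 (edge_of p y).
  rewrite /ebox /edges_in edge_of_ends // /box ey.
  by move: Fp; rewrite /F; clear -rl1; lia.
pose F (v : vertex) := (nm v <= r.*2)%N.
have Fk : F k by rewrite /F; clear -hk ur; lia.
have nFq : ~~ F q by rewrite /F -ltnNge; clear -hq rl1; lia.
have [p [w [_ Fp nFw rpw cw]]] := conn_last_exit c Fk nFq.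
have hw : (r.*2 < nm w)%N by rewrite ltnNge.
have ep : nm p = r.*2.
  by have := nm_adj (ra rpw); move: Fp hw; rewrite /F; clear; lia.
have cfgE x z : adj x z -> (r.*2 < nm z)%N ->
    hub_cfg u l1 tau sigma b (edge_of x z) -> frz (ebox l1) b tau (edge_of x z).
  move=> axz hz; rewrite /hub_cfg /frz; case: ifP => // h.
  have -> // : ebox u (edge_of x z) = false.
  rewrite /ebox /edges_in edge_of_ends // /box.
  by apply/negP => /andP[_ h']; move: hz h'; clear -ur; lia.
exists p, w, q; split => //.
  case/and4P: rpw => apw bpw op ow; apply/and4P; split => //; exact: cfgE.
apply: conn_sub cw => x z /and3P[/and4P[axz bxz ox oz] Fx Fz].
apply/and4P; split => //.
- by apply: cfgE => //; move: Fz; rewrite /= /F -ltnNge.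
- by move: Fx; rewrite /= /F -ltnNge.
- by move: Fz; rewrite /= /F -ltnNge.
Qed.

Lemma arms_hub_target sigma b : circ l u sigma ->
  inner_arm sigma b -> outer_arm b -> circ r r.*2 b -> circ r.*2 r.*2.*2 b ->
  escape r (4 * r) b -> hub_target l u l1 tau Q sigma b.
Proof.
move=> cs [k [y [Kk ey c1]]] [p [w [q [ep hw rpw Qq c2]]]] [z1 [az1 s1]] [z2 [az2 s2]].
move=> [x [y' [ex ey' c3]]].
have hk : (nm k <= u)%N by case/andP: (hub_ann cs Kk).
have hq := hQ Qq.
pose h := hub_cfg u l1 tau sigma b.
have inH (V : pred vertex) : (forall v, V v -> (u < nm v <= l1)%N) -> forall x y,
    conn (ostep b V) x y -> conn (ostep h (outer l)) x y.
  move=> hV a c'; apply: conn_osub => [e|v /hV].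
    move=> /andP[/hV /andP[V1 V1'] /hV /andP[V2 V2']].
    rewrite /h /hub_cfg /frz.
    have -> : ebox l1 e by rewrite /ebox /edges_in /box V1' V2'.
    by rewrite ebox_outer // /edges_in /outer V1 V2.
  by rewrite /outer; clear -lu; lia.
have {}c3 : conn (ostep h (outer l)) x y'.
  by apply: inH c3 => v; rewrite /shell; clear -ur rl1; lia.
have {}c1 : conn (ostep h (outer l)) k y.
  apply: conn_osub c1 => [e|v]; last by case/andP.
  move=> /andP[/andP[_ V1] /andP[_ V2]]; rewrite /h /hub_cfg /frz.
  have -> // : ebox l1 e.
  by rewrite /ebox /edges_in /box; clear -V1 V2 rl1; lia.
have cfgE a c' : adj a c' -> (r.*2 < nm c')%N ->
    frz (ebox l1) b tau (edge_of a c') -> h (edge_of a c').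
  move=> aac hc; rewrite /h /hub_cfg /frz; case: ifP => // _.
  have -> // : ebox u (edge_of a c') = false.
  rewrite /ebox /edges_in edge_of_ends // /box.
  by apply/negP => /andP[_ h']; move: hc h'; clear -ur; lia.
have {c2}c2 : conn (ostep h (outer l)) p q.
  apply: (conn_trans (y := w)).
    apply: conn_step; case/and4P: rpw => apw bpw _ _; apply/and4P; split => //.
    - exact: cfgE.
    - by rewrite /outer ep; clear -lu ur; lia.
    - by rewrite /outer; move: hw; clear -lu ur; lia.
  apply: conn_sub c2 => a c' /and4P[aac bac oa oc]; apply/and4P; split => //.
  - exact: cfgE.
  - by move: oa; rewrite /outer; clear -lu ur; lia.
  - by move: oc; rewrite /outer; clear -lu ur; lia.
pose K1 := cl b (ann r r.*2) z1; pose K2 := cl b (ann r.*2 r.*2.*2) z2.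
have kk1 v v' : K1 v -> K1 v' -> conn (ostep h (outer l)) v v'.
  move=> /asboolP cv /asboolP cv'; apply: (inH (ann r r.*2)).
    by move=> a; rewrite /ann; clear -ur rl1; lia.
  by apply: (conn_trans (conn_osym cv)).
have kk2 v v' : K2 v -> K2 v' -> conn (ostep h (outer l)) v v'.
  move=> /asboolP cv /asboolP cv'; apply: (inH (ann r.*2 r.*2.*2)).
    by move=> a; rewrite /ann; clear -ur rl1; lia.
  by apply: (conn_trans (conn_osym cv)).
have [||v1 [Kv1 ckv1 _]] := sep_hit s1 (@ra _ _) c1.
  by clear -hk ur; lia.
  by rewrite ey.
have [||v2 [Kv2 _ cv2q]] := sep_hit s2 (@ra _ _) c2.
  by rewrite ep.
  by clear -hq rl1; lia.
have [||v3 [Kv3 cxv3 _]] := sep_hit s1 (@ra _ _) c3.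
  by rewrite ex.
  by rewrite ey'; clear; lia.
have [||v4 [Kv4 cxv4 _]] := sep_hit s2 (@ra _ _) c3.
  by rewrite ex; clear; lia.
  by rewrite ey'; clear; lia.
exists k, q; split => //.
apply: (conn_trans ckv1); apply: (conn_trans (kk1 _ _ Kv1 Kv3)).
apply: (conn_trans (conn_osym cxv3)); apply: (conn_trans cxv4).
by apply: (conn_trans (kk2 _ _ Kv4 Kv2)).
Qed.

Variables (R : realType) (mu : iid_law R) (c : R).
Hypothesis c0 : 0 <= c.
Hypothesis hc : forall r, (5 <= r)%N ->
  [/\ c <= bpr mu (circ r r.*2), bpr mu (escape r r.*2) <= 1 - c &
      c <= bpr mu (escape r (4 * r))].

Let finU (S S' : pred edge) : fin S -> fin S' -> fin (predU S S').
Proof.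
move=> [s hs] [s' hs']; exists (s ++ s') => e /orP[/hs|/hs'];
by rewrite mem_cat => ->; rewrite ?orbT.
Qed.

Let dU (S S' : pred edge) (A B : set cfg) : bdep S A -> bdep S' B -> bdep (predU S S') (A `&` B).
Proof.
by move=> dA dB; apply: bdepI; [apply: bdepS dA|apply: bdepS dB] => e /= ->; rewrite ?orbT.
Qed.

(** Above, the two arms use disjoint sets of edges, within and beyond radius [2 * r]. Below, FKG
    adds two circuits and an arm, each of probability at least [c], which together join the two
    arms. *)
Lemma kernel_bounds sigma : circ l u sigma ->
  c ^+ 3 * (bpr mu (inner_arm sigma) * bpr mu outer_arm) <=
    bpr mu (hub_target l u l1 tau Q sigma) <=
  bpr mu (inner_arm sigma) * bpr mu outer_arm.
Proof.
move=> cs; have uE e : ebox u e -> ebox r.*2 e by apply: ebox_mono; clear -ur; lia.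
have dH := @bdep_hub_target l u l1 tau Q sigma.
have fH := @fin_far u l1.
have dA := @bdep_inner sigma; have dB := bdep_outer.
have iA := @binc_inner sigma; have iB := binc_outer.
have fA := fin_near; have fB := fin_out.
apply/andP; split.
  have [h1 _ h3] := hc r5.
  have [h2 _ _] := hc (leq_trans r5 (leq_addl r r) : (5 <= r + r)%N).
  rewrite addnn in h2.
  have d1 := @bdep_circ r r.*2; have d2 := @bdep_circ r.*2 r.*2.*2.
  have d3 := @bdep_escape r (4 * r).
  have i1 := @binc_circ r r.*2; have i2 := @binc_circ r.*2 r.*2.*2.
  have i3 := @binc_escape r (4 * r).
  have f1 := fin_ann r r.*2; have f2 := fin_ann r.*2 r.*2.*2.
  have f3 := fin_shell r (4 * r).
  have g1 := bpr_fkg mu fA dA iA fB dB iB.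
  have g2 := bpr_fkg mu f1 d1 i1 f2 d2 i2.
  have g3 := bpr_fkg mu (finU f1 f2) (dU d1 d2) (bincI i1 i2) f3 d3 i3.
  have g4 := bpr_fkg mu (finU fA fB) (dU dA dB) (bincI iA iB)
    (finU (finU f1 f2) f3) (dU (dU d1 d2) d3) (bincI (bincI i1 i2) i3).
  apply: (@le_trans _ _ (bpr mu ((inner_arm sigma `&` outer_arm) `&`
     (circ r r.*2 `&` circ r.*2 r.*2.*2 `&` escape r (4 * r))))); last first.
    apply: (bpr_le mu (finU (finU fA fB) (finU (finU f1 f2) f3))
      (dU (dU dA dB) (dU (dU d1 d2) d3)) fH dH).
    by move=> b [[hA hB] [[h4 h5] h6]]; apply: arms_hub_target.
  apply: le_trans g4; rewrite mulrC; apply: ler_pM => //.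
  - by rewrite mulr_ge0 // lpr_ge0.
  - exact: exprn_ge0.
  apply: le_trans g3; rewrite exprSr; apply: ler_pM => //; first exact: exprn_ge0.
  by apply: le_trans g2; rewrite expr2; apply: ler_pM.
rewrite -(bpr_indep mu fA dA fB dB).
  apply: (bpr_le mu fH dH (finU fA fB) (dU dA dB)).
  by move=> b /(hub_target_arms cs).
by move=> e /andP[h1 h2]; rewrite /out_edges h1 andbF.
Qed.

End Kernel.

Lemma rst_agree (S : pred edge) (b b' : cfg) :
  (forall e, S e -> b e = b' e) -> rst S b = rst S b'.
Proof.
by move=> h; apply/funext => e; rewrite /rst; case: (boolP (S e)) => //= /h ->.
Qed.

Section Good.
Variables (R : realType) (mu : iid_law R) (E : set (edge -> R)) (m : nat).
Hypothesis hE : loc (ebox m) E.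

(* [rho] is the approximate conditional probability of [E], uniformly over the
   remote target and the outer configuration. *)
Definition good (l : nat) (delta : R) : Prop := exists rho, 0 <= rho <= 1 /\
  forall tau (Q : pred vertex), (forall q, Q q -> (l < nm q)%N) ->
  `|mu (E `&` bev (target l tau Q)) - rho * bpr mu (target l tau Q)| <=
    delta * bpr mu (target l tau Q).

Lemma good_init l : good l 1.
Proof.
have pmE := proj1 hE.
exists 0; rewrite lexx ler01; split => // tau Q _; rewrite mul0r subr0 mul1r.
have mT : prod_measurable (bev (target l tau Q) : set (edge -> R)).
  exact: pm_bev (fin_ebox l) (@bdep_target _ _ _).
rewrite ger0_norm ?lpr_ge0 //; apply: lpr_le => //; first exact: pmI.
by move=> w _ [].
Qed.

(** Given the hub, the event splits over three disjoint sets of edges: those of the inner box, of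
    the annulus, and beyond. [X] interacts only with the first. *)
Lemma target_mass (X : set (edge -> R)) l u l1 tau (Q : pred vertex) sigma : loc (ebox l) X ->
  (l < u)%N -> (u <= l1)%N -> (forall q, Q q -> (l1 < nm q)%N) -> circ l u sigma ->
  mu (X `&` bev (target l1 tau Q) `&` bev [set b | rst (mid_edges l u) b = sigma]) =
  mu (X `&` bev (target l sigma (hub l u sigma))) *
   (bpr mu [set b | rst (mid_edges l u) b = sigma] *
    bpr mu (hub_target l u l1 tau Q sigma)).
Proof.
move=> lX lu ul1 hQ cs.
have dR : bdep (mid_edges l u) [set b | rst (mid_edges l u) b = sigma].
  exact: (@bdep_rst cfg (mid_edges l u) id sigma).
have dH := @bdep_hub_target l u l1 tau Q sigma.
rewrite -(bpr_indep mu (fin_mid l u) dR (fin_far u l1) dH); last first.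
  by move=> e /andP[h1 h2]; rewrite /far_edges h1 andbF.
have lH : loc (fun e => ~~ ebox l e) (bev ([set b | rst (mid_edges l u) b = sigma] `&`
     hub_target l u l1 tau Q sigma) : set (edge -> R)).
  apply: locI; [apply: locS (loc_bev R (fin_mid l u) dR)|
    apply: locS (loc_bev R (fin_far u l1) dH)] => e /andP[h1 h2] //.
  by apply: contra h2; apply: ebox_mono; exact: ltnW.
have lT : loc (ebox l) (X `&` bev (target l sigma (hub l u sigma))).
  by apply: locI => //; apply: (loc_bev R (fin_ebox l) (@bdep_target _ _ _)).
rewrite /bpr -(lpr_indep mu lT lH) //; last by move=> e ->.
congr (mu _); apply/seteqP; split => w.
  move=> [[Xw Tw] Rw]; have := target_decomp lu tau ul1 hQ cs Rw.
  by move=> [/(_ Tw) [h1 h2] _].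
move=> [[Xw Tw] [Rw Hw]]; have := target_decomp lu tau ul1 hQ cs Rw.
by move=> [_ h]; split => //; split => //; apply: h.
Qed.

Lemma target_sum (X : set (edge -> R)) l u l1 tau (Q : pred vertex) (ks : seq cfg) :
  loc (ebox l) X ->
  (l < u)%N -> (u <= l1)%N -> (forall q, Q q -> (l1 < nm q)%N) ->
  (forall X, prod_measurable X ->
    mu X = \sum_(k <- ks) mu (X `&` bev [set b | rst (mid_edges l u) b = k])) ->
  mu (X `&` bev (target l1 tau Q) `&` bev (circ l u)) =
  \sum_(k <- ks) (if `[< circ l u k >] then
     mu (X `&` bev (target l k (hub l u k))) *
       bpr mu [set b | rst (mid_edges l u) b = k] else 0) *
    bpr mu (hub_target l u l1 tau Q k).
Proof.
move=> lX lu ul1 hQ hks; rewrite hks; last first.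
  apply: pmI; last exact: pm_bev (fin_ann _ _) (@bdep_circ _ _).
  apply: pmI; first by case: lX.
  exact: pm_bev (fin_ebox l1) (@bdep_target _ _ _).
apply: eq_bigr => k _; case: asboolP => hk; last first.
  rewrite mul0r -[RHS](lpr0 mu); congr (mu _); apply/seteqP; split => // w.
  move=> [[_ cw] /= ew]; apply: hk; rewrite -ew.
  by apply/circ_rst.
rewrite -mulrA -target_mass //; congr (mu _); apply/seteqP; split => w.
  by move=> [[[h1 h2] _] h3].
move=> [[h1 h2] h3]; split => //; split => //.
by apply/(circ_rst l u); move: h3; rewrite /bev /= => ->.
Qed.

Variable c : R.
Hypothesis c01 : 0 < c < 1.
Hypothesis hc : forall r, (5 <= r)%N ->
  [/\ c <= bpr mu (circ r r.*2), bpr mu (escape r r.*2) <= 1 - c &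
      c <= bpr mu (escape r (4 * r))].

Lemma good_step l delta e N : (m <= l)%N -> 0 <= delta -> 0 < e -> good l delta ->
  exists l1, [/\ (N <= l1)%N, (l <= l1)%N & good l1 ((1 - c ^+ 3) * delta + e)].
Proof.
move=> ml d0 e0 [rho [hrho hg]].
have [c0 c1] := andP c01.
have [u [lu hu]] := circ_whp mu l e0.
pose r := maxn u.+1 5; pose l1 := maxn (maxn r.*2.*2 N) l.
have ur : (u < r)%N by rewrite /r leq_max leqnn.
have r5 : (5 <= r)%N by rewrite /r leq_max leqnn orbT.
have rl1 : (r.*2.*2 <= l1)%N by rewrite /l1 !leq_max leqnn.
have ul1 : (u <= l1)%N by clear -ur rl1; lia.
exists l1; split; [by rewrite /l1 !leq_max leqnn orbT|by rewrite /l1 leq_max leqnn orbT|].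
have lE : loc (ebox l) E by apply: locS hE => ee; apply: ebox_mono.
have pmE := proj1 lE.
have [ks [uks hks]] := lpr_part mu (fin_mid l u) (@rst_agree (mid_edges l u)).
pose v k := if `[< circ l u k >] then bpr mu (target l k (hub l u k)) *
  bpr mu [set b | rst (mid_edges l u) b = k] else 0.
pose w k := if `[< circ l u k >] then mu (E `&` bev (target l k (hub l u k))) *
  bpr mu [set b | rst (mid_edges l u) b = k] else 0.
pose a k := bpr mu (inner_arm l u r k).
have mT k : prod_measurable (bev (target l k (hub l u k)) : set (edge -> R)).
  exact: pm_bev (fin_ebox l) (@bdep_target _ _ _).
have hw k : 0 <= w k <= v k.
  rewrite /w /v; case: asboolP => _; last by rewrite lexx.
  rewrite mulr_ge0 ?lpr_ge0 //=; apply: ler_wpM2r; first exact: lpr_ge0.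
  by apply: lpr_le => //; [exact: pmI|move=> z _ []].
have hd k : `|w k - rho * v k| <= delta * v k.
  rewrite /w /v; case: asboolP => ck; last by rewrite !mulr0 subr0 normr0.
  rewrite !mulrA -mulrBl normrM [X in _ * X <= _]ger0_norm ?lpr_ge0 //.
  apply: ler_wpM2r; first exact: lpr_ge0.
  by apply: hg => q /(hub_ann ck) /andP[].
have k01 : 0 < c ^+ 3 < 1 by rewrite exprn_gt0 //= exprn_ilt1 // ltW.
(* The new ratio is fixed before [tau] and [Q] enter: they affect only the kernel [M] and the factor
   [b] in the contraction, not [v], [w] or [a]. *)
have [rho' [hrho' H]] := ratio_contraction ks hrho k01 hw (fun k => lpr_ge0 mu _) hd
  (a := a).
exists rho'; split => // tau Q hQ.
pose T := target l1 tau Q.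
(* Off [circ] the weights [v] and [w] vanish, and any value within the required bounds will do. *)
pose M k := if `[< circ l u k >] then bpr mu (hub_target l u l1 tau Q k)
  else a k * bpr mu (outer_arm r l1 tau Q).
have hM k : c ^+ 3 * (a k * bpr mu (outer_arm r l1 tau Q)) <= M k <=
    a k * bpr mu (outer_arm r l1 tau Q).
  rewrite /M; case: asboolP => ck; last first.
    by rewrite lexx andbT ler_piMl ?mulr_ge0 ?lpr_ge0 // ltW //; case/andP: k01.
  by apply: kernel_bounds => //; exact: ltW.
have := H M _ (lpr_ge0 mu _) hM.
have -> : \sum_(k <- ks) w k * M k = mu (E `&` bev T `&` bev (circ l u)).
  rewrite (target_sum tau lE lu ul1 hQ hks); apply: eq_bigr => k _; rewrite /w /M.
  by case: asboolP => // _; rewrite !mul0r.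
have -> : \sum_(k <- ks) v k * M k = mu (bev T `&` bev (circ l u)).
  rewrite -[bev T]setTI (target_sum tau (locT _ _) lu ul1 hQ hks).
  apply: eq_bigr => k _; rewrite /v /M setTI.
  by case: asboolP => // _; rewrite !mul0r.
have mTT : prod_measurable (bev T : set (edge -> R)).
  exact: pm_bev (fin_ebox l1) (@bdep_target _ _ _).
have mC : prod_measurable (bev (circ l u) : set (edge -> R)).
  exact: pm_bev (fin_ann _ _) (@bdep_circ _ _).
have f1 := lprID mu (pmI pmE mTT) mC.
have f2 := lprID mu mTT mC.
have f3 : mu ((E `&` bev T) `\` bev (circ l u)) <= mu (bev T `\` bev (circ l u)).
  apply: lpr_le; [exact: pmD (pmI pmE mTT) mC|exact: pmD|].
  by move=> z _ [[_ h1] h2].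
(* By FKG the target makes a circuit no less likely, so the absence of a circuit costs at most the
   fraction [e] of the target, which is the additive error. *)
have f4 : bpr mu T * bpr mu (circ l u) <= mu (bev T `&` bev (circ l u)).
  exact: bpr_fkg (fin_ebox l1) (@bdep_target _ _ _) (@binc_target _ _ _)
    (fin_ann _ _) (@bdep_circ _ _) (@binc_circ _ _).
have T0 : 0 <= bpr mu T by exact: lpr_ge0.
have f5 : mu (bev T `\` bev (circ l u)) <= e * bpr mu T.
  rewrite /bpr in f4 T0 hu *; nra.
have g0 : 0 <= mu ((E `&` bev T) `\` bev (circ l u)) by exact: lpr_ge0.
have g1 : 0 <= mu (bev T `&` bev (circ l u)) by exact: lpr_ge0.
rewrite /bpr -/T f1 f2.
move: f3 f5 f2 g0 g1; rewrite /bpr.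
set A := mu _; set B := mu (bev T `\` _); set D := mu (bev T).
set F := mu (bev T `&` _); set G := mu (E `&` _ `&` _).
move=> f3 f5 f2 g0 g1 h.
have B0 : 0 <= B by exact: lpr_ge0.
have -> : G + A - rho' * (F + B) = (G - rho' * F) + (A - rho' * B) by ring.
apply: (le_trans (ler_normD _ _)).
have h2 : `|A - rho' * B| <= e * D.
  apply: le_trans f5; rewrite ler_norml; nra.
apply: (le_trans (lerD h h2)).
have h3 : 0 <= (1 - c ^+ 3) * delta by rewrite mulr_ge0 // subr_ge0 ltW //; case/andP: k01.
have := ler_wpM2l h3 (_ : F <= F + B); rewrite lerDl => /(_ B0); rewrite -f2;
  set k := (1 - c ^+ 3) * delta; move=> h4; rewrite mulrDl.
by rewrite lerD2r.
Qed.

Lemma good_small delta N : 0 < delta -> exists l, [/\ (N <= l)%N, (m <= l)%N & good l delta].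
Proof.
move=> d0; have [c0 c1] := andP c01.
have k01 : 0 < c ^+ 3 < 1 by rewrite exprn_gt0 //= exprn_ilt1 // ltW.
have [k0 k1] := andP k01.
(* Half of the contraction [c ^+ 3] is given up to absorb the additive error of [good_step]. *)
pose x := 1 - c ^+ 3 / 2.
have x0 : 0 <= x by rewrite /x; lra.
have x1 : x < 1 by rewrite /x; lra.
have h k : exists l, [/\ (N <= l)%N, (m <= l)%N & good l (x ^+ k)].
  elim: k => [|k [l [Nl ml gl]]].
    exists (maxn N m); rewrite expr0; split;
      [by rewrite leq_max leqnn|by rewrite leq_max leqnn orbT|].
    exact: good_init.
  have xk : 0 < x ^+ k by rewrite exprn_gt0 //; rewrite /x; lra.
  have [|l1 [Nl1 ll1 gl1]] := good_step (e := c ^+ 3 / 2 * x ^+ k) N ml (ltW xk) _ gl.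
    by rewrite mulr_gt0 // divr_gt0.
  exists l1; split => //; first exact: leq_trans ll1.
  suff <- : (1 - c ^+ 3) * x ^+ k + c ^+ 3 / 2 * x ^+ k = x ^+ k.+1 by [].
  by rewrite [x ^+ k.+1]exprS; set y := x ^+ k; rewrite /x; lra.
have [k hk] := exp_small x0 x1 d0.
have [l [Nl ml [rho [hr hg]]]] := h k; exists l; split => //.
exists rho; split => // tau Q hQ; apply: (le_trans (hg _ _ hQ)).
by apply: ler_wpM2r => //; exact: lpr_ge0.
Qed.

End Good.

(** * Cheap paths *)

Section Cost.
Variable R : realType.
Implicit Types w : edge -> R.

Lemma ptime_cat w x s1 s2 :
  ptime w x (s1 ++ s2) = ptime w x s1 + ptime w (last x s1) s2.
Proof. by elim: s1 x => [|y s1 IH] x /=; rewrite ?add0r // IH addrA. Qed.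

Lemma ptime_ge0 w x s : nonneg w -> 0 <= ptime w x s.
Proof. by move=> nw; elim: s x => [|y s IH] x //=; rewrite addr_ge0. Qed.

Lemma ptime_le (r : rel vertex) w w' x s : path r x s ->
  (forall y z, r y z -> w (edge_of y z) <= w' (edge_of y z)) ->
  ptime w x s <= ptime w' x s.
Proof.
move=> ps h; elim: s x ps => [|y s IH] x //= /andP[rxy ps].
by apply: lerD; [exact: h|exact: IH].
Qed.

Lemma ptime0 (r : rel vertex) w x s : path r x s ->
  (forall y z, r y z -> w (edge_of y z) = 0) -> ptime w x s = 0.
Proof.
move=> ps h; elim: s x ps => [|y s IH] x //= /andP[rxy ps].
by rewrite h // IH // addr0.
Qed.

Lemma pm_ptime x s L : prod_measurable [set w : edge -> R | ptime w x s <= L].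
Proof.
pose G : set (set (edge -> R)) := \bigcup_(e in [set: edge])
  preimage_set_system [set: edge -> R] (fun w => w e) (measurable : set (set R)).
have h y s' : measurable_fun [set: g_sigma_algebraType G]
    (fun w : g_sigma_algebraType G => ptime (w : edge -> R) y s').
  elim: s' y => [|z s' IH] y /=; first exact: measurable_cst.
  apply: measurable_funD => // _ B mB; rewrite setTI.
  exact: (@pm_coord R _ B mB).
have := h x s measurableT _ (measurable_itv `]-oo, L]); rewrite setTI.
congr (@prod_measurable R _); apply/seteqP; split => w /=; rewrite in_itv //=.
Qed.

Lemma pm_exists_in (es : seq edge) (Y : edge -> set (edge -> R)) :
  (forall e, prod_measurable (Y e)) ->
  prod_measurable [set w | exists2 e, e \in es & Y e w].
Proof.
move=> hY; have := @pm_exists R edge (fun e => [set w | e \in es] `&` Y e) _.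
rewrite (_ : [set w | exists i, _] = [set w | exists2 e, e \in es & Y e w]).
  by apply => e; apply: pmI => //; exact: pm_const.
by apply/seteqP; split => w; [move=> [e [h1 h2]]; exists e|move=> [e h1 h2]; exists e].
Qed.

Lemma lpr_exists_in (mu : iid_law R) (es : seq edge) (Y : edge -> set (edge -> R)) :
  (forall e, prod_measurable (Y e)) ->
  mu [set w | exists2 e, e \in es & Y e w] <= \sum_(e <- es) mu (Y e).
Proof.
move=> hY; elim: es => [|e es IH].
  rewrite big_nil (_ : [set w | _] = set0) ?lpr0 //.
  by apply/seteqP; split => // w [].
rewrite big_cons; apply: le_trans (lerD (lexx _) IH).
apply: le_trans (lpr_leU mu (hY e) (pm_exists_in es hY)).
apply: lpr_le; [exact: pm_exists_in|by apply: pmU => //; exact: pm_exists_in|].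
move=> w _ [f]; rewrite inE => /orP[/eqP -> Yw|fes Yw]; first by left.
by right; exists f.
Qed.

(** Existence of one cheap path instead of a bound on an infimum: a countable union, and a path that
    can be cut and rerouted. *)
Definition by_path (Q : vertex -> seq vertex -> Prop) (L : R) : set (edge -> R) :=
  [set w | exists x s, Q x s /\ ptime w x s <= L].

Lemma pm_by_path Q L : prod_measurable (by_path Q L).
Proof.
have -> : by_path Q L = [set w | exists p : vertex * seq vertex,
    ([set w : edge -> R | Q p.1 p.2] `&` [set w | ptime w p.1 p.2 <= L]) w].
  apply/seteqP; split => w.
    by move=> [x [s [h1 h2]]]; exists (x, s).
  by move=> [[x s] [/= h1 h2]]; exists x, s.
by apply: pm_exists => p; apply: pmI; [exact: pm_const|exact: pm_ptime].
Qed.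

Lemma by_path_le Q L w w' : (forall e, w e <= w' e) -> by_path Q L w' -> by_path Q L w.
Proof.
move=> h [x [s [Qs hs]]]; exists x, s; split => //; apply: le_trans hs.
have p : path (fun _ _ : vertex => true) x s by elim: s x {Qs} => //=.
by apply: ptime_le p _ => y z _.
Qed.

Definition arrive (n : nat) (x : vertex) (s : seq vertex) : Prop :=
  [/\ x = origin, path adj x s & nm (last x s) = n].

Definition reach (n : nat) (L : R) : set (edge -> R) := by_path (arrive n) L.

Definition slow (l u : nat) (a : R) : set (edge -> R) := [set w |
  forall x s, path adj x s -> (nm x <= l)%N -> (u <= nm (last x s))%N -> a <= ptime w x s].

Lemma pm_slow l u a : prod_measurable (slow l u a).
Proof.
have := pmC (@pm_exists R _ (fun p : vertex * seq vertex =>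
  [set w | [/\ path adj p.1 p.2, (nm p.1 <= l)%N & (u <= nm (last p.1 p.2))%N]] `\`
  ([set w | - ptime w p.1 p.2 <= - a])) _).
rewrite (_ : ~` _ = slow l u a).
  apply => p; apply: pmD; first exact: pm_const.
  rewrite (_ : [set w | _] = ~`
    (\bigcup_(k in setT) [set w | ptime w p.1 p.2 <= a - k.+1%:R^-1])).
    by apply: pmC; apply: pm_bigcup => k; exact: pm_ptime.
  apply/seteqP; split => w /=.
    rewrite lerN2 => h [k _] /= h2.
    have := le_trans h h2; rewrite lerDl oppr_ge0 leNgt => /negP; apply.
    by rewrite invr_gt0 ltr0n.
  move=> h; rewrite lerN2 leNgt; apply/negP => hlt; apply: h.
  have [k hk] := @ltr_add_invr R _ _ hlt; exists k => //=; rewrite lerBrDr; exact: ltW.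
apply/seteqP; split => w.
  move=> h x s ps h1 h2; rewrite -lerN2; apply: contrapT => h3; apply: h.
  by exists (x, s).
by move=> h [[x s] [[/= h1 h2 h3]]]; rewrite lerN2; apply; exact: h.
Qed.

(** Making the edges of [S] free turns a cheap-path event into a larger one that is independent of
    them. *)
Definition zer (S : pred edge) w : edge -> R := fun e => if S e then 0 else w e.

Lemma loc_zer S S' (U : set (edge -> R)) : loc S' U ->
  loc (fun e => S' e && ~~ S e) [set w | U (zer S w)].
Proof.
move=> [mU dU]; split.
  have sg : sigma_algebra setT (@prod_measurable R) by exact: smallest_sigma_algebra.
  apply: (pm_preimage sg _ mU (f := zer S)) => e B mB; rewrite /zer.
  by case: (S e); [exact: pm_const|exact: pm_coord].
move=> w w' ww'; apply: dU => e S'e; rewrite /zer.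
by case: ifP => // nSe; apply: ww'; rewrite S'e nSe.
Qed.

Lemma zer_le S w e : nonneg w -> zer S w e <= w e.
Proof. by move=> nw; rewrite /zer; case: ifP => // _; exact: nw. Qed.

Lemma nonneg_zer S w : nonneg w -> nonneg (zer S w).
Proof. by move=> nw e; rewrite /zer; case: ifP. Qed.

Lemma loc_all (A : set (edge -> R)) : prod_measurable A -> loc predT A.
Proof.
by move=> mA; split => // w w' h; rewrite (_ : w = w') //; apply/funext => e; exact: h.
Qed.

Lemma ptime_exit w x s (F : pred vertex) : nonneg w ->
  path adj x s -> F x -> ~~ F (last x s) -> exists s1 y s2,
  [/\ s = s1 ++ y :: s2, all F (x :: s1), ~~ F y, path (restr adj F) x s1 &
   [/\ adj (last x s1) y, path adj y s2 & ptime w x s =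
      ptime w x s1 + w (edge_of (last x s1) y) + ptime w y s2]].
Proof.
move=> nw ps Fx nF; have [s1 [y [s2 [es a1 ny]]]] := path_first_exit ps Fx nF.
move: ps; rewrite es cat_path /= => /and3P[p1 p2 p3].
exists s1, y, s2; split => //; first exact: path_restr.
by split => //; rewrite ptime_cat /= addrA.
Qed.

End Cost.

(** * Resampling the exits of a cluster *)

Section Resampling.
Variables (R : realType) (mu : iid_law R).
Implicit Types (X : set (edge -> R)) (e f : edge).

Lemma loc_coord e (C : set R) : measurable C -> loc (pred1 e) [set w : edge -> R | C (w e)].
Proof.
move=> mC; split; first exact: pm_coord.
by move=> w w' /(_ e (eqxx _)) /= ->.
Qed.

Definition all_in (C : set R) (l : seq edge) : set (edge -> R) :=
  [set w | forall e, e \in l -> C (w e)].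

Lemma all_in_cons C e l : all_in C (e :: l) = [set w | C (w e)] `&` all_in C l.
Proof.
apply/seteqP; split => w.
  by move=> h; split => [|f fl]; apply: h; rewrite inE ?eqxx // fl orbT.
by move=> [h1 h2] f; rewrite inE => /orP[/eqP -> //|]; exact: h2.
Qed.

Lemma loc_all_in C l : measurable C -> loc [in l] (all_in C l).
Proof.
move=> mC; split; last by move=> w w' ww' h e el; rewrite -ww' //; exact: h.
elim: l => [|e l IH].
  by rewrite (_ : all_in C [::] = setT); [exact: pmT|apply/seteqP; split].
by rewrite all_in_cons; apply: pmI => //; exact: pm_coord.
Qed.

Lemma lpr_coordI X e (C : set R) : loc (predC1 e) X -> measurable C ->
  mu (X `&` [set w | C (w e)]) = mu X * mu [set w | C (w e)].
Proof. by move=> lX mC; apply: (lpr_indep mu lX (loc_coord e mC)) => f /negPf /= ->. Qed.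

Lemma lpr_all_in (C : set R) (l : seq edge) X : measurable C -> uniq l ->
  loc (fun e => e \notin l) X ->
  mu (X `&` all_in C l) = mu X * \prod_(e <- l) mu [set w | C (w e)].
Proof.
move=> mC; elim: l X => [|e l IH] X /=.
  move=> _ _; rewrite big_nil mulr1; congr (mu _).
  by apply/seteqP; split => [w []//|w Xw].
move=> /andP[el ul] lX; rewrite big_cons all_in_cons mulrA -lpr_coordI //; last first.
  by apply: locS lX => f; rewrite inE negb_or => /andP[].
rewrite setIA IH //; apply: locI.
  by apply: locS lX => f; rewrite inE negb_or => /andP[].
by apply: locS (loc_coord e mC) => f /eqP ->.
Qed.

Variables (a s q delta : R).
Hypothesis delta0 : 0 <= delta.
Hypothesis p_low : forall e, mu [set w | 0 < w e <= a] <= delta.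
Hypothesis p_pivot : forall e, q <= mu [set w | a < w e <= s].
Hypothesis q0 : 0 <= q.

Let big_ : set R := [set x | a < x].

Let m_big : measurable big_.
Proof.
rewrite (_ : big_ = [set` `]a, +oo[]); first exact: measurable_itv.
by apply/seteqP; split => x; rewrite /= in_itv /= ?andbT.
Qed.

Let m_nz : measurable [set x : R | x != 0].
Proof.
rewrite (_ : [set x | _] = ~` [set 0]); first by apply: measurableC; exact: measurable_set1.
by apply/seteqP; split => x /= /eqP.
Qed.

Let m_piv : measurable [set x : R | a < x <= s].
Proof.
rewrite (_ : [set x : R | a < x <= s] = [set` `]a, s]]); first exact: measurable_itv.
by apply/seteqP; split => x; rewrite /= in_itv /= ?andbT.
Qed.

Let m_low : measurable [set x : R | 0 < x <= a].
Proof.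
rewrite (_ : [set x : R | 0 < x <= a] = [set` `]0, a]]); first exact: measurable_itv.
by apply/seteqP; split => x; rewrite /= in_itv /= ?andbT.
Qed.

Lemma lpr_nonzero e : mu [set w | w e != 0] = 2^-1.
Proof.
rewrite (_ : [set w | _] = ~` [set w | w e = 0]).
  by rewrite lprC ?lpr_zero; [lra|exact: pm_zero].
by apply/seteqP; split => w /= /eqP.
Qed.

Lemma p_big e : 2^-1 - delta <= mu [set w | big_ (w e)].
Proof.
have h : mu [set w | w e != 0] <= mu [set w | big_ (w e)] + mu [set w | 0 < w e <= a].
  apply: le_trans (lpr_leU mu (pm_coord e m_big) (pm_coord e m_low)).
  apply: lpr_le; first exact: (pm_coord e m_nz).
    by apply: pmU; [exact: (pm_coord e m_big)|exact: (pm_coord e m_low)].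
  move=> w nw /= wn; have [h|h] := leP (w e) a; [right|left] => //=.
  by rewrite ?h ?andbT lt_neqAle eq_sym wn nw.
by have := p_low e; rewrite lpr_nonzero in h; lra.
Qed.

(** Each factor is at least [1/2 - delta], and Bernoulli's inequality bounds the power of
    [1 - 2 * delta]. *)
Lemma prod_big (l : seq edge) :
  2 ^- size l * (1 - (size l)%:R * (2 * delta)) <= \prod_(e <- l) mu [set w | big_ (w e)].
Proof.
elim: l => [|e l IH] /=; first by rewrite big_nil expr0 invr1 mul0r subr0 mulr1.
rewrite big_cons; have [h|h] := leP (2^-1) delta.
  apply: (@le_trans _ _ 0); last by apply: mulr_ge0; rewrite ?lpr_ge0 ?prodr_ge0 // => *;
    exact: lpr_ge0.
  rewrite mulr_ge0_le0 ?invr_ge0 ?exprn_ge0 // subr_le0.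
  rewrite -(natr1 (size l)); have : 0 <= (size l)%:R :> R by [].
  by nra.
have hb := p_big e; have P0 : 0 <= \prod_(e <- l) mu [set w | big_ (w e)].
  by rewrite prodr_ge0 // => *; exact: lpr_ge0.
apply: (@le_trans _ _ ((2^-1 - delta) * \prod_(e <- l) mu [set w | big_ (w e)])); last first.
  exact: ler_wpM2r.
apply: (@le_trans _ _ ((2^-1 - delta) * (2 ^- size l * (1 - (size l)%:R * (2 * delta)))));
  last first.
  by apply: ler_wpM2l => //; lra.
rewrite exprS invfM -(natr1 (size l)); have : 0 <= (size l)%:R :> R by [].
have : 0 < 2 ^- size l :> R by rewrite invr_gt0 exprn_gt0.
move: (2 ^- size l) (size l)%:R => x m x0 m0.
have := mulr_ge0 (ltW x0) (mulr_ge0 m0 (mulr_ge0 delta0 delta0)).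
lra.
Qed.

(* [l] lists the exits of the explored cluster, and [e] is the one that a cheap
   path uses. *)
Definition pivotal (l : seq edge) e : set (edge -> R) :=
  [set w | w e <= s /\ forall f, f \in l -> a < w f].

Lemma pm_pivotal l e : prod_measurable (pivotal l e).
Proof.
rewrite (_ : pivotal l e = [set w | w e <= s] `&` all_in big_ l) //.
apply: pmI; last by case: (loc_all_in l m_big).
exact: (@pm_coord R e _ (measurable_itv `]-oo, s])).
Qed.

(** Both sides compare [X] with a resampling of [l], independent of [X]. All exits closed has
    probability [2 ^- size l]. On the right [e] contributes [q] in place of 1/2, and the condition
    on [delta] keeps half of the product over the other exits; this loss is offset by the power of 2
    gained at [e]. *)
Lemma pivotal_ge (l : seq edge) e X : uniq l -> e \in l ->
  (size l)%:R * (4 * delta) <= 1 -> loc (fun e => e \notin l) X ->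
  q * mu (X `&` all_in [set x | x != 0] l) <= mu (X `&` pivotal l e).
Proof.
move=> ul el hl lX; rewrite lpr_all_in //.
rewrite (eq_bigr (fun=> 2^-1)); last by move=> f _; exact: lpr_nonzero.
rewrite big_const_seq count_predT iter_mulr_1; pose l' := rem e l.
have sl : size l = (size l').+1.
  by rewrite /l' size_rem // prednK //; case: (l) el.
have perm_l : perm_eq l (e :: l') by exact: perm_to_rem.
have -> : X `&` pivotal l e = X `&` [set w | a < w e <= s] `&` all_in big_ l'.
  apply/seteqP; split => w.
    move=> [Xw [h1 h2]]; split; first by split => //=; rewrite h1 h2.
    by move=> f fl; apply: h2; apply: mem_rem fl.
  move=> [[Xw /= /andP[h1 h2]] h3]; split => //; split => // f.
  by rewrite (perm_mem perm_l) inE => /orP[/eqP -> //|]; exact: h3.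
rewrite lpr_all_in ?rem_uniq //; last first.
  apply: locI; first by apply: locS lX => f; rewrite (perm_mem perm_l) inE negb_or => /andP[].
  apply: locS (loc_coord e m_piv) => f /eqP ->.
  by rewrite /l' mem_rem_uniq // inE eqxx.
have lXe : loc (predC1 e) X by apply: locS lX => f; apply: contra => /eqP ->.
rewrite (lpr_coordI lXe m_piv).
have h := prod_big l'; have X0 := lpr_ge0 mu X; have pe := p_pivot e.
apply: (@le_trans _ _ (mu X * q * (2 ^- size l))).
  by rewrite exprVn mulrCA mulrA.
apply: ler_pM; rewrite ?mulr_ge0 ?invr_ge0 ?exprn_ge0 //.
  exact: ler_wpM2l.
apply: le_trans h; rewrite sl exprS invfM mulrC; apply: ler_wpM2l.
  by rewrite invr_ge0 exprn_ge0.
by move: hl; rewrite sl -(natr1 (size l')); move: delta0 (size l')%:R => d0 m;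
  rewrite mulrDl mul1r; set z := m * (4 * delta); rewrite (_ : m * (2 * delta) = z / 2);
    [lra|rewrite /z; field].
Qed.

(** Several exits may serve a cheap path; the events are made disjoint before the single-exit bounds
    are added, so no factor for the number of exits is lost. *)
Lemma pivot_sum (l : seq edge) (A : edge -> set (edge -> R)) : uniq l ->
  (size l)%:R * (4 * delta) <= 1 -> (forall e, loc (fun e => e \notin l) (A e)) ->
  q * mu ([set w | exists2 e, e \in l & A e w] `&` all_in [set x | x != 0] l) <=
  mu [set w | exists2 e, e \in l & (A e `&` pivotal l e) w].
Proof.
move=> ul hl.
have pmA := @pm_exists_in R.
have pmN : prod_measurable (all_in [set x : R | x != 0] l) by case: (loc_all_in l m_nz).
suff main (k : seq edge) : {subset k <= l} -> forall A : edge -> set (edge -> R),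
    (forall e, loc (fun e => e \notin l) (A e)) ->
    q * mu ([set w | exists2 e, e \in k & A e w] `&` all_in [set x | x != 0] l) <=
    mu [set w | exists2 e, e \in k & (A e `&` pivotal l e) w].
  exact: main.
elim: k {A} => [|e k IH] kl A hA.
  rewrite (_ : _ `&` _ = set0); first by rewrite lpr0 mulr0 lpr_ge0.
  by apply/seteqP; split => w // [[e]].
have el : e \in l by apply: kl; rewrite inE eqxx.
(* Removing [A e] keeps the events independent of the edges of [l], as the induction requires. *)
pose A' f := A f `\` A e.
have hA' f : loc (fun e => e \notin l) (A' f) by exact: locD.
have pe := pm_pivotal l.
have pA f := proj1 (hA f).
have pA' f := proj1 (hA' f).
have m1 := pmA k A' pA'.
have m2 : prod_measurable [set w | exists2 e, e \in k & (A' e `&` pivotal l e) w].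
  by apply: pmA => f; exact: pmI.
have m3 : prod_measurable [set w | exists2 f, f \in e :: k & (A f `&` pivotal l f) w].
  by apply: pmA => f; exact: pmI.
have h1 := pivotal_ge ul el hl (hA e).
have kl' : {subset k <= l} by move=> f fk; apply: kl; rewrite inE fk orbT.
have h2 := IH kl' A' hA'.
apply: (@le_trans _ _ (q * (mu (A e `&` all_in [set x | x != 0] l) +
    mu ([set w | exists2 e, e \in k & A' e w] `&` all_in [set x | x != 0] l)))).
  apply: ler_wpM2l => //; rewrite -lprU.
  - apply: lpr_le; [|by apply: pmU; apply: pmI|].
      by apply: pmI => //; apply: pmA => f; case: (hA f).
    move=> w _ [[f]]; rewrite inE => /orP[/eqP -> Aw nz|fk Aw nz]; first by left.
    have [Ae|Ae] := pselect (A e w); first by left.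
    by right; split => //; exists f.
  - exact: pmI.
  - exact: pmI.
  - by move=> w [Aw _] [[f _ [_ nA]] _].
rewrite mulrDr; apply: (le_trans (lerD h1 h2)).
rewrite -lprU => //.
- apply: lpr_le => //; first by apply: pmU => //; exact: pmI.
  move=> w _ [[Aw pw]|[f fk [[Aw _] pw]]].
    by exists e; [rewrite inE eqxx|split].
  by exists f; [rewrite inE fk orbT|split].
- exact: pmI.
- by move=> w [Aw _] [f _ [[_ nA] _]].
Qed.

End Resampling.

Section Pivot.
Variables (l u v n : nat) (K : pred vertex).
Hypothesis uv : (u < v)%N.
Hypothesis Kann : forall x, K x -> (l < nm x < v)%N.
Hypothesis Ksep : sep l u K.

Let off : rel vertex := restr adj (predC K).

Let off_adj x y : off x y -> adj x y.
Proof. by case/and3P. Qed.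

Lemma off_conn_near x y : conn off x y -> (nm x <= l)%N -> ~~ K x -> (nm y < u)%N.
Proof.
move=> c hx nKx; rewrite ltnNge; apply/negP => hy.
have [z [Kz cz _]] := sep_hit Ksep off_adj c hx hy.
by have := conn_predC nKx cz; rewrite Kz.
Qed.

Lemma notK_near x : (nm x <= l)%N -> ~~ K x.
Proof. by move=> hx; apply/negP => /Kann /andP[]; rewrite ltnNge hx. Qed.

Let o_near : (nm origin <= l)%N.
Proof. by rewrite nm0. Qed.

Lemma notK_far x : (v <= nm x)%N -> ~~ K x.
Proof. by move=> hx; apply/negP => /Kann /andP[_]; rewrite ltnNge hx. Qed.

Definition escaping (y : vertex) : Prop :=
  exists z, (v <= nm z)%N /\ conn off y z.

(* The outer boundary only: resampling it does not change what it costs to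
   enter [K]. *)
Definition exits : pred edge := fun e => `[< exists x y,
  [/\ K x, ~~ K y, adj x y, escaping y & edge_of x y = e] >].

(** The edges beyond radius [u] that the exploration of [K] reveals, given the configuration within
    radius [u]. *)
Definition far_touch : pred edge :=
  fun e => [&& ebox v e, ~~ ebox u e & K (src e) || K (tgt e)].

Lemma escaping_far y : ~~ K y -> escaping y -> (l < nm y)%N.
Proof.
move=> nKy [z [hz c]]; rewrite ltnNge; apply/negP => hy.
by have := off_conn_near c hy nKy; rewrite ltnNge ltnW // (leq_trans uv).
Qed.

Lemma exits_touch e : exits e -> K (src e) || K (tgt e).
Proof. by move=> /asboolP[x [y [Kx _ axy _ <-]]]; rewrite edge_of_touch // Kx. Qed.

Lemma exits_box e : exits e -> ebox v e.
Proof.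
move=> /asboolP[x [y [Kx _ axy _ <-]]]; rewrite /ebox /edges_in edge_of_ends //.
have /andP[_ h] := Kann Kx; rewrite /box ltnW //=.
exact: leq_trans (nm_adj axy) h.
Qed.

Lemma off_safe x y : off x y -> predU far_touch exits (edge_of x y) = false.
Proof.
move=> /and3P[axy nx ny]; apply/negP => h.
have : K (src (edge_of x y)) || K (tgt (edge_of x y)).
  by case/orP: h => [/and3P[]//|/exits_touch].
by rewrite edge_of_touch // (negPf nx) (negPf ny).
Qed.

(** Were the entrance also an exit, its end off [K] would be joined to the origin and to radius [v]
    without meeting [K], against separation. It is not in [far_touch] either, because this end lies
    within radius [u]. *)
Lemma entrance_safe x y : conn off origin x -> adj x y -> ~~ K x -> K y ->
  predU far_touch exits (edge_of x y) = false.
Proof.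
move=> c axy nKx Ky; have hx := off_conn_near c o_near (notK_near o_near).
apply/negP => /orP[/and3P[_ + _]|/asboolP[x' [y' [Kx' nKy' ax' [z [hz cz]] ee]]]].
  rewrite /ebox /edges_in edge_of_ends // /box ltnW //= => /negP; apply.
  exact: leq_trans (nm_adj axy) hx.
have yx : y' = x.
  have [[e1 e2]|[e1 e2]] := edge_ofP ax'; have [[e3 e4]|[e3 e4]] := edge_ofP axy;
    rewrite ee in e1 e2.
  - by move: nKy'; rewrite -e2 e4 Ky.
  - by rewrite -e2 e4.
  - by rewrite -e1 e3.
  - by move: nKy'; rewrite -e1 e3 Ky.
rewrite yx in cz.
have := off_conn_near (conn_trans c cz) o_near (notK_near o_near).
by rewrite ltnNge ltnW // (leq_trans uv).
Qed.

Definition exit_by (e : edge) (s1 : seq vertex) (y : vertex) (s2 : seq vertex) (x : vertex) :=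
  [/\ K (last x s1), all (predC K) (y :: s2) & edge_of (last x s1) y = e].

Lemma last_exit x s : path adj x s -> (nm x <= l)%N -> (v <= nm (last x s))%N ->
  exists s1 y s2 e, [/\ s = s1 ++ y :: s2, exits e & exit_by e s1 y s2 x].
Proof.
move=> ps hx hl.
have /hasP[k ks Kk] : has K (x :: s).
  by apply: Ksep => //; apply: leq_trans hl; exact: ltnW.
case/splitPl: ks ps hl => p1 p2 e1; rewrite cat_path last_cat e1 => /andP[h1 h2] hl.
have [s1 [y [s2 [e2 K1 K2]]]] := path_last_exit h2 Kk (notK_far hl).
exists (p1 ++ s1), y, s2, (edge_of (last k s1) y); split.
- by rewrite e2 catA.
- move: h2 hl; rewrite e2 cat_path last_cat /= => /and3P[_ ay ps2] hl.
  apply/asboolP; exists (last k s1), y; split => //; first by case/andP: K2.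
  exists (last y s2); split => //; exists s2; split => //.
  exact: path_restr.
- by split => //; rewrite last_cat e1.
Qed.

Definition exit_path (e : edge) (x : vertex) (s : seq vertex) : Prop :=
  arrive n x s /\ exists s1 y s2, s = s1 ++ y :: s2 /\ exit_by e s1 y s2 x.

(** Between its first entrance into [K] and its last exit the path is replaced by an open path in
    [K]. Up to the entrance and after the exit no edge was made free, so only [e], of cost at most
    [s], is to be added to the budget. *)
Lemma reroute (R : realType) (w : edge -> R) (L s : R) e : nonneg w ->
  (forall x y, K x -> K y -> conn (ostep (bin w) predT) x y) ->
  by_path (exit_path e) (L - s) (zer (predU far_touch exits) w) -> w e <= s ->
  reach n L w.
Proof.
move=> nw Kc [x [p [[[ex pp lp] [s1 [y [s2 [ep [K1 K2 ee]]]]]] hp]]] we.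
rewrite {x}ex in pp lp K1 ee hp.
have nK0 : predC K origin by exact: notK_near.
move: pp lp hp; rewrite ep cat_path last_cat ptime_cat /= => /and3P[ps1 ay ps2] lp hp.
have nK1 : ~~ predC K (last origin s1) by rewrite /= K1.
have [p1 [k [p2 [es a1 /negPn Kk]]]] := path_first_exit ps1 nK0 nK1.
move: ps1 hp; rewrite es cat_path ptime_cat /= => /and3P[pp1 ak pp2] hp.
have [q [pq lq]] := Kc k (last origin s1) Kk K1.
exists origin, (p1 ++ k :: q ++ y :: s2); split.
  split => //.
    rewrite cat_path /= pp1 ak cat_path /= lq ay ps2 !andbT /=.
    by apply: sub_path pq => a b /and4P[].
  by rewrite last_cat /= last_cat.
have r1 : path off origin p1 by apply: path_restr.
have nl : ~~ K (last origin p1) by apply: (allP a1); exact: mem_last.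
have h1 : ptime w origin p1 <= ptime (zer (predU far_touch exits) w) origin p1.
  by apply: (ptime_le r1) => a b /off_safe; rewrite /zer => ->.
have h2 : w (edge_of (last origin p1) k) <=
    zer (predU far_touch exits) w (edge_of (last origin p1) k).
  by rewrite /zer entrance_safe //; exists p1.
have h3 : ptime w k q = 0.
  apply: (ptime0 pq) => a b /and4P[_ /eqP //].
have h4 : ptime w y s2 <= ptime (zer (predU far_touch exits) w) y s2.
  apply: (@ptime_le _ off); first exact: path_restr.
  by move=> a b /off_safe; rewrite /zer => ->.
have nz := nonneg_zer (predU far_touch exits) nw.
have h5 := ptime_ge0 k p2 nz.
have h6 := nz (edge_of (last origin s1) y).
rewrite ptime_cat /= ptime_cat /= h3 lq ee.
move: hp h6; rewrite -es ee => hp h6; lra.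
Qed.

Lemma slow_of_exits (R : realType) (w : edge -> R) a : nonneg w ->
  (forall e, exits e -> a < w e) -> slow l v a w.
Proof.
move=> nw h x s ps hx hl; have [s1 [y [s2 [e [-> ex [_ _ ee]]]]]] := last_exit ps hx hl.
rewrite ptime_cat /= ee; have := h _ ex.
have := ptime_ge0 x s1 nw; have := ptime_ge0 y s2 nw; lra.
Qed.

End Pivot.

Section PivotProb.
Variables (R : realType) (mu : iid_law R) (a s q delta L : R).
Hypothesis a0 : 0 <= a.
Hypothesis delta0 : 0 <= delta.
Hypothesis p_low : forall e, mu [set w | 0 < w e <= a] <= delta.
Hypothesis p_pivot : forall e, q <= mu [set w | a < w e <= s].
Hypothesis q0 : 0 <= q.

(** Leaves open how [K] was found: [G0] only has to ensure that [K] is joined by open edges and that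
    the edges leaving it beyond radius [l] are closed. *)
Lemma pivot_prob (l u v n : nat) (K : pred vertex) (S : pred edge) (G0 : set cfg)
    (es : seq edge) : (u < v)%N -> (v <= n)%N ->
  (forall x, K x -> (l < nm x < v)%N) -> sep l u K -> fin S -> bdep S G0 ->
  (forall b, G0 b -> forall x y, K x -> K y -> conn (ostep b predT) x y) ->
  (forall b, G0 b -> forall x y, K x -> ~~ K y -> adj x y -> (l < nm y)%N ->
     ~~ b (edge_of x y)) ->
  (forall e, ebox v e -> e \in es) -> (size es)%:R * (4 * delta) <= 1 ->
  q * mu (bev G0 `&` [set w | reach n (L - s) (zer (far_touch u v K) w)]) <=
  mu (reach n L `&` slow l v a `&` bev G0).
Proof.
move=> uv vn Kann Ksep fS dG Kc Kclosed hes hsize.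
pose ex := exits v K; pose N := undup [seq e <- es | ex e].
have uN : uniq N by exact: undup_uniq.
have memN e : (e \in N) = ex e.
  rewrite mem_undup mem_filter; case: (boolP (ex e)) => //= /(exits_box Kann) /hes ->.
  by [].
have sN : (size N)%:R * (4 * delta) <= 1.
  apply: le_trans hsize; apply: ler_wpM2r; first by rewrite mulr_ge0.
  by rewrite ler_nat (leq_trans (size_undup _)) // size_filter count_size.
(* [G0] with the exits declared closed: it does not depend on the exits, and agrees with [G0]
   whenever they are indeed nonzero, both before and after resampling. *)
pose B : set cfg := [set b | G0 (fun f => b f && ~~ ex f)].
pose Z := predU (far_touch u v K) ex.
pose A e : set (edge -> R) := bev B `&` [set w | by_path (exit_path n K e) (L - s) (zer Z w)].
have lA e : loc (fun e => e \notin N) (A e).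
  apply: locI.
    apply: locS (loc_bev R (S := fun e => S e && ~~ ex e) _ _).
    - by move=> f /andP[_]; rewrite memN.
    - by apply: finS fS => f /andP[].
    - move=> b b' bb'; apply: dG => f Sf /=.
      by case: (boolP (ex f)) => hf; rewrite ?andbF // bb' // Sf.
  apply: locS (loc_zer Z (loc_all (pm_by_path (exit_path n K e) (L - s)))) => f /= .
  by rewrite negb_or => /andP[_]; rewrite memN.
have G_nz b f : G0 b -> ex f -> ~~ b f.
  move=> Gb /asboolP[x [y [Kx nKy axy ey <-]]]; apply: Kclosed => //.
  exact: (escaping_far uv Ksep).
have pmG := pm_bev (R := R) fS dG.
have pmS := @pm_slow R l v a.
have pmr M : prod_measurable (reach n M : set (edge -> R)) by exact: pm_by_path.
have pmNz : prod_measurable (all_in [set x : R | x != 0] N).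
  apply: proj1 (loc_all_in N _).
  rewrite (_ : [set x | _] = ~` [set 0]); first by apply: measurableC; exact: measurable_set1.
  by apply/seteqP; split => x /= /eqP.
have pmA := @pm_exists_in R N.
have hv : (0 < v)%N by clear -uv; lia.
have hpiv := pivot_sum delta0 p_low p_pivot q0 uN sN lA.
apply: (@le_trans _ _ (q * mu ([set w | exists2 e, e \in N & A e w]
  `&` all_in [set x | x != 0] N))).
  apply: ler_wpM2l => //; apply: lpr_le.
  - apply: pmI => //; apply: proj1 (loc_zer _ (loc_all (pmr _))).
  - by apply: pmI => //; apply: pmA => e; case: (lA e).
  move=> w nw [Gw [x [p [[ex0 pp lp] hp]]]]; split; last first.
    by move=> f; rewrite memN => /(G_nz _ _ Gw).
  have hx : (nm x <= l)%N by rewrite ex0.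
  have hl : (v <= nm (last x p))%N by rewrite lp.
  have [s1 [y [s2 [e [ep exe he]]]]] := last_exit uv Kann Ksep pp hx hl.
  exists e; first by rewrite memN.
  split.
    rewrite /bev /B /= (_ : (fun _ => _) = bin w) //.
    apply/funext => f; case: (boolP (ex f)) => [/(G_nz _ _ Gw) /negPf ->|] //.
    by rewrite andbT.
  exists x, p; split; first by split => //; exists s1, y, s2.
  apply: le_trans hp; apply: (ptime_le pp) => c d _.
  by rewrite /zer /Z /=; case: ifP => [/orP[->|_]|/norP/= [/negPf -> _]] //; case: ifP.
apply: (le_trans hpiv); apply: lpr_le.
- apply: pmA => e; apply: pmI; [by case: (lA e)|exact: pm_pivotal].
- by apply: pmI => //; apply: pmI.
move=> w nw [e eN [[Bw Pw] [we hN]]].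
have Gw : G0 (bin w).
  move: Bw; rewrite /bev /B /= (_ : (fun _ => _) = bin w) //.
  apply/funext => f; case: (boolP (ex f)) => [|]; last by rewrite andbT.
  rewrite andbF -memN => /hN h; rewrite /bin; apply/esym/negbTE.
  by rewrite gt_eqF // (le_lt_trans a0).
split => //; split.
  exact: (reroute uv Kann Ksep nw (Kc _ Gw) Pw we).
by apply: (slow_of_exits uv Kann Ksep nw) => f; rewrite -/ex -memN; exact: hN.
Qed.

End PivotProb.

Lemma cl_in b (V : pred vertex) z x : V z -> cl b V z x -> V x.
Proof. by move=> Vz /asboolP; exact: conn_ostep_in. Qed.

Lemma cl_root b V z : cl b V z z.
Proof. by apply/asboolP; exact: conn_refl. Qed.

Lemma cl_closed b (V : pred vertex) z x y : cl b V z x -> ostep b V x y -> cl b V z y.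
Proof. by move=> /asboolP c h; apply/asboolP; apply: (conn_trans c); exact: conn_step. Qed.

Lemma cl_eq (b b' : cfg) (V : pred vertex) z :
  (forall e, edges_in V e -> cl b V z (src e) || cl b V z (tgt e) -> b e = b' e) ->
  cl b' V z = cl b V z.
Proof.
move=> h; have h' x y : adj x y -> V x -> V y -> cl b V z x ->
    b (edge_of x y) = b' (edge_of x y).
  move=> axy Vx Vy cx; apply: h; first by rewrite /edges_in edge_of_ends // Vx.
  by rewrite edge_of_touch // cx.
apply/funext => x; apply/idP/idP => /asboolP c.
  apply: (conn_closed (F := fun x => cl b V z x)) c; last exact: cl_root.
  move=> p q cp /and4P[apq bpq Vp Vq]; apply: (cl_closed cp).
  by apply/and4P; split => //; rewrite h'.
have [] // : cl b V z x /\ cl b' V z x.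
apply: (conn_closed (F := fun x => cl b V z x /\ cl b' V z x)) c; last first.
  by split; exact: cl_root.
move=> p q [cp cp'] /and4P[apq bpq Vp Vq]; split; first by apply: (cl_closed cp); apply/and4P.
by apply: (cl_closed cp'); apply/and4P; split => //; rewrite -h'.
Qed.

Section HubCluster.
Variables (r : nat) (sigma : cfg).
Hypothesis csigma : circ r r.*2 sigma.
Hypothesis r0 : (0 < r)%N.

Let u := r.*2.
Let v := r.*2.*2.

(** Exploration in two stages: [sigma] reveals the annulus from [r] to [2 * r] and its circuit; the
    cluster of this circuit is then followed up to radius [4 * r], which reveals only edges touching
    it. *)
Definition hub_cluster (b : cfg) : pred vertex :=
  cl (frz (ebox u) sigma b) (ann r v) (hub_root r u sigma).

Let ru : (r < u)%N. Proof. by rewrite /u; clear -r0; lia. Qed.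
Let uv : (u < v)%N. Proof. by rewrite /u /v; clear -r0; lia. Qed.

Let root_ann : ann r v (hub_root r u sigma).
Proof.
have [/andP[h1 h2] _] := hubP csigma.
by rewrite /ann h1 (leq_trans h2) // ltnW.
Qed.

Lemma hub_cluster_ann b x : hub_cluster b x -> ann r v x.
Proof. exact: cl_in. Qed.

Lemma hub_cluster_sep b : sep r u (hub_cluster b).
Proof.
have [_ sK] := hubP csigma; apply: sepS sK => x /asboolP c; apply/asboolP.
apply: conn_sub c => y z /and4P[ayz syz /andP[y1 y2] /andP[z1 z2]]; apply/and4P; split => //.
- by rewrite /frz /ebox /edges_in edge_of_ends // /box y2 z2.
- by rewrite /ann y1 (leq_trans y2) // ltnW.
- by rewrite /ann z1 (leq_trans z2) // ltnW.
Qed.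

Lemma hub_cluster_frz b e : rst (mid_edges r u) b = sigma -> edges_in (ann r v) e ->
  frz (ebox u) sigma b e = b e.
Proof.
move=> hs /andP[/andP[h _] _]; rewrite /frz; case: ifP => // he.
rewrite -hs /rst /mid_edges he /ebox /edges_in /box.
by rewrite (leqNgt (nm (src e))) h.
Qed.

Lemma hub_cluster_conn b x y : rst (mid_edges r u) b = sigma ->
  hub_cluster b x -> hub_cluster b y -> conn (ostep b predT) x y.
Proof.
move=> hs /asboolP cx /asboolP cy.
have : conn (ostep (frz (ebox u) sigma b) (ann r v)) x y.
  by apply: conn_trans cy; exact: conn_osym.
apply: conn_sub => p q /and4P[apq bpq Vp Vq]; apply/and4P; split => //.
by rewrite -(hub_cluster_frz hs) // /edges_in edge_of_ends // Vp.
Qed.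

Lemma hub_cluster_closed b x y : rst (mid_edges r u) b = sigma ->
  hub_cluster b x -> (nm x < v)%N -> ~~ hub_cluster b y -> adj x y -> (r < nm y)%N ->
  ~~ b (edge_of x y).
Proof.
move=> hs cx hx ny axy hy; apply: contra ny => bxy.
have Vx := hub_cluster_ann cx.
have Vy : ann r v y by rewrite /ann hy /=; apply: leq_trans (nm_adj axy) hx.
apply: (cl_closed cx); apply/and4P; split => //.
by rewrite hub_cluster_frz // /edges_in edge_of_ends // Vx.
Qed.

(** Exploration property beyond radius [2 * r]: the edges touching the cluster determine it. *)
Lemma hub_cluster_agree b b' :
  (forall e, far_touch u v (hub_cluster b) e -> b e = b' e) -> hub_cluster b' = hub_cluster b.
Proof.
move=> h; apply: cl_eq => e /andP[/andP[_ h1] /andP[_ h2]] ht; rewrite /frz.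
case: (boolP (ebox u e)) => // nu; apply: h; apply/and3P; split => //.
by rewrite /ebox /edges_in /box h1 h2.
Qed.

Lemma hub_cluster_dep b b' : (forall e, far_edges u v e -> b e = b' e) ->
  hub_cluster b = hub_cluster b'.
Proof.
by move=> h; apply/esym/hub_cluster_agree => e /and3P[h1 h2 _]; apply: h; rewrite /far_edges h1.
Qed.

Lemma hub_cluster_escape b x : hub_cluster b x -> (v <= nm x)%N -> escape u v b.
Proof.
move=> /asboolP c hx; pose F (y : vertex) := (nm y <= u)%N.
have Fr : F (hub_root r u sigma) by have [/andP[_ h] _] := hubP csigma.
have nF : ~~ F x by rewrite /F -ltnNge (leq_trans uv).
have [p [q [_ Fp nFq /and4P[apq bpq Vp Vq] cq]]] := conn_last_exit c Fr nF.
have hq : (u < nm q)%N by rewrite ltnNge.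
have hp : nm p = u.
  by move: (leq_trans hq (nm_adj apq)) (Fp : (nm p <= u)%N); clear; lia.
have nux y z : (u < nm y)%N || (u < nm z)%N -> adj y z ->
  frz (ebox u) sigma b (edge_of y z) = b (edge_of y z).
  move=> h ayz; rewrite /frz /ebox /edges_in edge_of_ends // /box.
  by case/orP: h => h; rewrite [X in X && _]leqNgt ?[X in _ && X]leqNgt h ?andbF.
have Vx : ann r v x by apply: cl_in root_ann _; apply/asboolP; exact: c.
exists p, x; split => //.
  by apply/eqP; rewrite eqn_leq hx andbT; case/andP: Vx.
apply: (conn_trans (y := q)).
  apply: conn_step; apply/and4P; split => //.
  - by rewrite -nux // hq orbT.
  - by rewrite /shell hp leqnn ltnW.
  - by case/andP: Vq => _ h; rewrite /shell h andbT ltnW.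
apply: conn_sub cq => y z /and3P[/and4P[ayz byz Vy Vz] ny nz].
move: ny nz; rewrite /= /F -!ltnNge => ny nz; apply/and4P; split => //.
- by rewrite -nux // ny.
- by case/andP: Vy => _ h; rewrite /shell h andbT ltnW.
- by case/andP: Vz => _ h; rewrite /shell h andbT ltnW.
Qed.

End HubCluster.

Section Scale.
Variables (R : realType) (mu : iid_law R) (a s q delta L c : R).
Hypothesis a0 : 0 <= a.
Hypothesis delta0 : 0 <= delta.
Hypothesis p_low : forall e, mu [set w | 0 < w e <= a] <= delta.
Hypothesis p_pivot : forall e, q <= mu [set w | a < w e <= s].
Hypothesis q0 : 0 <= q.
Hypothesis hc : forall r, (5 <= r)%N ->
  c <= bpr mu (circ r r.*2) /\ bpr mu (escape r r.*2) <= 1 - c.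
Hypothesis c0 : 0 <= c.

(** One factor [c] is a circuit between [r] and [2 * r], gained by FKG; the other is that its
    cluster stops before [4 * r], gained by independence; [q] is the price of the pivotal exit. *)
Lemma pivot_scale (r n : nat) (es : seq edge) : (5 <= r)%N -> (r.*2.*2 <= n)%N ->
  (forall e, ebox r.*2.*2 e -> e \in es) -> (size es)%:R * (4 * delta) <= 1 ->
  mu (reach n (L - s)) * (c * c * q) <= mu (reach n L `&` slow r r.*2.*2 a).
Proof.
move=> r5 vn hes hsize; pose u := r.*2; pose v := r.*2.*2.
have r0 : (0 < r)%N by exact: leq_trans r5.
have ru : (r < u)%N by rewrite /u; clear -r0; lia.
have uv : (u < v)%N by rewrite /u /v; clear -r0; lia.
have u5 : (5 <= u)%N by exact: leq_trans (ltnW ru).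
have [hcirc _] := hc r5; have [_ hesc] := hc u5.
have pmr M : prod_measurable (reach n M : set (edge -> R)) by exact: pm_by_path.
have pmS := @pm_slow R r v a.
have pmC' : prod_measurable (bev (circ r u) : set (edge -> R)).
  exact: pm_bev (fin_ann _ _) (@bdep_circ _ _).
pose X := reach n (L - s) `&` bev (circ r u); pose Z := reach n L `&` slow r v a.
have mX : prod_measurable X by exact: pmI.
have mZ : prod_measurable Z by exact: pmI.
have hX : mu (reach n (L - s)) * c <= mu X.
  apply: (@le_trans _ _ (mu (reach n (L - s)) * bpr mu (circ r u))).
    by apply: ler_wpM2l => //; exact: lpr_ge0.
  apply: (fkg mu _ _ (fin_ann _ _) (@bdep_circ _ _) (@binc_circ _ _)) => //.
  by move=> w w' _; exact: by_path_le.
suff h : mu X * (c * q) <= mu Z.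
  apply: le_trans h; rewrite -(mulrA c) mulrA; apply: ler_wpM2r => //.
  exact: mulr_ge0.
apply: (lpr_part_le (g := rst (mid_edges r u)) (fin_mid r u)) => //.
  exact: rst_agree.
move=> sigma; pose Rs : set cfg := [set b | rst (mid_edges r u) b = sigma].
have dR : bdep (mid_edges r u) Rs by exact: (@bdep_rst cfg (mid_edges r u) id sigma).
have mR : prod_measurable (bev Rs : set (edge -> R)) by exact: pm_bev (fin_mid r u) dR.
rewrite -/Rs; have [cs|ncs] := pselect (circ r u sigma); last first.
  rewrite (_ : X `&` bev Rs = set0) ?lpr0 ?mul0r ?lpr_ge0 //.
  apply/seteqP; split => // w [[_ cw] Rw]; apply: ncs.
  by rewrite -Rw; apply/circ_rst.
pose g b : vertex -> bool := hub_cluster r sigma b.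
have hg b b' : (forall e, far_edges u v e -> b e = b' e) -> g b = g b'.
  exact: hub_cluster_dep.
have [ks [_ hks]] := lpr_part mu (fin_far u v) hg.
pose blocked (k : vertex -> bool) := forall x, k x -> (nm x < v)%N.
have dk k : bdep (far_edges u v) [set b | g b = k] by move=> b b' /hg /= ->.
have mk k : prod_measurable (bev [set b | g b = k] : set (edge -> R)).
  exact: pm_bev (fin_far u v) (dk k).
have dB : bdep (far_edges u v) [set b | blocked (g b)] by move=> b b' /hg /= ->.
have mB : prod_measurable (bev [set b | blocked (g b)] : set (edge -> R)).
  exact: pm_bev (fin_far u v) dB.
(* A cluster that reaches radius [v] contains an open path from radius [u] to radius [v], which is
   absent with probability at least [c]. *)
have hB : c <= \sum_(k <- ks) (if `[< blocked k >] then bpr mu [set b | g b = k] else 0).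
  apply: (@le_trans _ _ (bpr mu [set b | blocked (g b)])).
    apply: (@le_trans _ _ (bpr mu (~` escape u v))).
      by rewrite (bprC mu (fin_shell _ _) (@bdep_escape _ _)) /u /v; lra.
    apply: (bpr_le mu (fin_shell _ _) (bdepC (@bdep_escape _ _)) (fin_far u v) dB).
    move=> b nb x gx; rewrite ltnNge; apply/negP => hx; apply: nb.
    exact: (hub_cluster_escape cs r0 gx).
  rewrite /bpr hks //; apply: ler_sum => k _; case: asboolP => hk.
    by apply: lpr_le => //; [exact: pmI|move=> w _ []].
  rewrite (_ : _ `&` _ = set0) ?lpr0 //.
  by apply/seteqP; split => // w [h /= e]; apply: hk; rewrite -e.
have XR0 := lpr_ge0 mu (X `&` bev Rs).
apply: (@le_trans _ _ (\sum_(k <- ks) q * (mu (X `&` bev Rs) *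
    (if `[< blocked k >] then bpr mu [set b | g b = k] else 0)))).
  rewrite -mulr_sumr -mulr_sumr (mulrC c) mulrCA.
  by apply: ler_wpM2l => //; apply: ler_wpM2l.
rewrite (hks _ (pmI mZ mR)); apply: ler_sum => k _.
case: asboolP => hk; last by rewrite !mulr0 lpr_ge0.
have [[b0 gb0]|nb] := pselect (exists b, g b = k); last first.
  rewrite (_ : bpr mu _ = 0) ?mulr0 ?lpr_ge0 //.
  rewrite /bpr -[RHS](lpr0 mu); congr (mu _); apply/seteqP; split => // w /= e.
  by apply: nb; exists (bin w).
pose G0 := Rs `&` [set b | g b = k].
have dG : bdep (predU (mid_edges r u) (far_edges u v)) G0.
  by apply: bdepI; [apply: bdepS dR|apply: bdepS (dk k)] => e /= ->; rewrite ?orbT.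
have fG : fin (predU (mid_edges r u) (far_edges u v)).
  apply: finS (fin_ebox v) => e /orP[/andP[h _]|/andP[]//].
  by apply: ebox_mono h; exact: ltnW.
have kann x : k x -> (r < nm x < v)%N.
  move=> kx; rewrite hk // andbT.
  by move: kx; rewrite -gb0 => /(hub_cluster_ann cs r0) /andP[].
have ksep : sep r u k by rewrite -gb0; exact: (hub_cluster_sep cs r0).
have kconn b : G0 b -> forall x y, k x -> k y -> conn (ostep b predT) x y.
  by move=> [h <-] x y; exact: hub_cluster_conn.
have kclosed b : G0 b -> forall x y, k x -> ~~ k y -> adj x y -> (r < nm y)%N ->
    ~~ b (edge_of x y).
  move=> [h h'] x y kx; have hx := hk _ kx; move: kx; rewrite -h' => kx.
  exact: (hub_cluster_closed cs r0 h kx hx).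
have hp := pivot_prob L a0 delta0 p_low p_pivot q0 uv vn kann ksep fG dG kconn
  kclosed hes hsize.
apply: (@le_trans _ _ (mu (Z `&` bev G0))); last first.
  by apply: lpr_le; [apply: pmI => //; exact: pm_bev fG dG|apply: pmI => //; exact: pmI|
    move=> w _ [h1 [h2 h3]]; split].
apply: le_trans hp; apply: ler_wpM2l => //.
(* With the edges of [far_touch] free, the cheap path is independent of the shape [k] of the
   cluster, although a blocked cluster hinders cheap paths. *)
pose U := [set w : edge -> R | reach n (L - s) (zer (far_touch u v k) w)].
have lU : loc (fun e => ~~ far_touch u v k e) U.
  by apply: locS (loc_zer (far_touch u v k) (loc_all (pmr (L - s)))) => e /andP[].
have lR : loc (fun e => ~~ far_touch u v k e) (bev Rs : set (edge -> R)).
  apply: locS (loc_bev R (fin_mid r u) dR) => e /andP[h _].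
  by rewrite /far_touch h andbF.
have lk : loc (far_touch u v k) (bev [set b | g b = k] : set (edge -> R)).
  split => // w w' ww' /= hw; rewrite -hw; apply: (hub_cluster_agree (r := r)) => e.
  by rewrite -/(g (bin w)) hw => /ww' h; rewrite /bin h.
have -> : bev G0 `&` U = (U `&` bev Rs) `&` bev [set b | g b = k].
  by apply/seteqP; split => w; [move=> [[h1 h2] h3]|move=> [[h1 h2] h3]].
rewrite (lpr_indep mu (locI lU lR) lk); last by move=> e h; exact: h.
apply: ler_wpM2r; first exact: lpr_ge0.
apply: lpr_le; [exact: pmI| |].
  by apply: pmI => //; case: lU.
move=> w nw [[Xw _] Rw]; split => //.
by apply: by_path_le Xw => e; exact: zer_le.
Qed.

End Scale.

Lemma ebox_list (n : nat) : exists es : seq edge,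
  (forall e, ebox n e -> e \in es) /\ size es = ((n.*2.+1 * n.*2.+1) * 2)%N.
Proof.
pose zs := [seq k%:Z - n%:Z | k <- iota 0 n.*2.+1].
pose vs : seq vertex := [seq (i, j) | i <- zs, j <- zs].
exists [seq (v, b) | v <- vs, b <- [:: false; true]]; split; last first.
  by rewrite !size_allpairs /= size_map size_iota.
move=> [[i j] b] /andP[h _]; apply/allpairsP; exists ((i, j), b); split => //=;
  last by case: b {h}.
have {}h : (nm (i, j) <= n)%N by [].
have hz (x : int) : (absz x <= n)%N -> x \in zs.
  move=> hx; apply/mapP; exists (absz (x + n%:Z)%R); last by clear -hx; lia.
  by rewrite mem_iota; clear -hx; lia.
by apply/allpairsP; exists (i, j); split => //; apply: hz; clear -h; move: h; rewrite /nm /=; lia.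
Qed.

(** * Adding the payments over all scales *)

Section Sums.
Variables (R : realType) (mu : iid_law R).

(** Cut at its first visit to radius [4 ^ K], the path pays for the smaller scales before and for
    scale [K] after, so that no edge is charged twice. *)
Lemma slow_sum (w : edge -> R) (a : nat -> R) (k0 K : nat) s : nonneg w ->
  path adj origin s -> (4 ^ K <= nm (last origin s))%N ->
  \sum_(k0 <= k < K) a k * (`[< slow (4 ^ k) (4 ^ k.+1) (a k) w >])%:R <= ptime w origin s.
Proof.
move=> nw; elim: K s => [|K IH] s ps hs; first by rewrite big_geq //; exact: ptime_ge0.
have [hk|hk] := leqP k0 K; last by rewrite big_geq //; exact: ptime_ge0.
have h4 : (4 ^ K < 4 ^ K.+1)%N by rewrite ltn_exp2l.
rewrite big_nat_recr //=.
pose F (x : vertex) := (nm x < 4 ^ K)%N.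
have F0 : F origin by rewrite /F nm0 expn_gt0.
have nF : ~~ F (last origin s) by rewrite /F -leqNgt (leq_trans (ltnW h4)).
have [s1 [y [s2 [es a1 nFy _ [ay ps2 ->]]]]] := ptime_exit nw ps F0 nF.
have hy : (4 ^ K <= nm y)%N by rewrite leqNgt.
have hy' : (nm y <= 4 ^ K)%N.
  apply: leq_trans (nm_adj ay) _; apply: (allP a1); exact: mem_last.
apply: lerD.
  have := IH (rcons s1 y); rewrite last_rcons -cats1 ptime_cat /= addr0; apply => //.
  by move: ps; rewrite es !cat_path /= => /and3P[-> -> _].
case: asboolP => [hs'|_]; last by rewrite mulr0 ptime_ge0.
rewrite mulr1; apply: hs' => //; move: hs; by rewrite es last_cat.
Qed.

(** The expectation over [U] of the pointwise bound, obtained by splitting [U] along one [W i] at a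
    time: on [W i] the remaining budget is [L - a i]. *)
Lemma sum_events (I : seq nat) (W : nat -> set (edge -> R)) (a : nat -> R) U L :
  (forall i, prod_measurable (W i)) -> prod_measurable U ->
  (forall w, nonneg w -> U w -> \sum_(i <- I) a i * (`[< W i w >])%:R <= L) ->
  \sum_(i <- I) a i * mu (U `&` W i) <= L * mu U.
Proof.
move=> mW; elim: I U L => [|i I IH] U L mU h.
  rewrite big_nil; have [[w [nw Uw]]|nU] := pselect (exists w, nonneg w /\ U w).
    by apply: mulr_ge0; [have := h w nw Uw; rewrite big_nil|exact: lpr_ge0].
  suff -> : mu U = 0 by rewrite mulr0.
  apply/eqP; rewrite eq_le lpr_ge0 andbT -(lpr0 mu); apply: lpr_le => //; first exact: pm0.
  by move=> w nw Uw; apply: nU; exists w.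
have m1 : prod_measurable (U `&` W i) by exact: pmI.
have m2 : prod_measurable (U `\` W i) by exact: pmD.
have h1 := IH (U `&` W i) (L - a i) m1.
have h2 := IH (U `\` W i) L m2.
rewrite big_cons (eq_bigr (fun j =>
  a j * mu (U `&` W i `&` W j) + a j * mu ((U `\` W i) `&` W j))).
  rewrite big_split /= [in X in _ <= X](lprID mu mU (mW i)).
  have {}h1 : \sum_(j <- I) a j * mu (U `&` W i `&` W j) <= (L - a i) * mu (U `&` W i).
    apply: h1 => w nw [Uw Ww]; have := h w nw Uw; rewrite big_cons.
    by case: asboolP => // _; rewrite mulr1 => h1; lra.
  have {}h2 : \sum_(j <- I) a j * mu ((U `\` W i) `&` W j) <= L * mu (U `\` W i).
    apply: h2 => w nw [Uw Ww]; have := h w nw Uw; rewrite big_cons.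
    by case: asboolP => // _; rewrite mulr0 add0r.
  have := lerD h1 h2; rewrite mulrBl mulrDr; set s1 := \sum_(j <- I) _;
    set s2 := \sum_(j <- I) _; lra.
move=> j _; rewrite -mulrDr; congr (_ * _).
rewrite (lprID mu (pmI mU (mW j)) (mW i)); congr (mu _ + mu _); apply/seteqP; split => w.
- by move=> [[h3 h4] h5].
- by move=> [[h3 h4] h5].
- by move=> [[h3 h4] h5].
- by move=> [[h3 h4] h5].
Qed.

Variable al : nat -> R.
Hypothesis al_gt0 : forall j, (2 <= j)%N -> 0 < al j.
Hypothesis al_mono : forall i j, (2 <= i)%N -> (i <= j)%N -> al j <= al i.
Hypothesis al_ge : forall j, (2 <= j)%N -> forall e, 2 ^- j <= mu [set w | 0 < w e <= al j].
Hypothesis al_lt : forall j, (2 <= j)%N -> forall e, mu [set w | 0 < w e < al j] <= 2 ^- j.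
Hypothesis al_div : forall M, exists n, M <= \sum_(2 <= k < n) al k.

(** By monotonicity four consecutive terms of the divergent series are together at most four times
    the first. *)
Lemma sparse_div (k0 : nat) M : exists K, (k0 <= K)%N /\
  M <= \sum_(k0 <= k < K) al (4 * k + 12)%N.
Proof.
pose B := \sum_(2 <= i < 4 * k0 + 12) al i.
have h K : (k0 <= K)%N -> \sum_(2 <= i < 4 * K + 12) al i <=
    B + 4 * \sum_(k0 <= k < K) al (4 * k + 12)%N.
  move=> /subnKC <-; elim: (K - k0)%N => [|m IH].
    by rewrite addn0 [in X in _ <= X]big_geq // mulr0 addr0.
  rewrite (addnS k0 m) [in X in _ <= X]big_nat_recr ?leq_addr //=.
  set p := (k0 + m)%N in IH *.
  have -> : (4 * p.+1 + 12 = (4 * p + 12).+4)%N by lia.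
  do 4 (rewrite big_nat_recr /=; last by lia).
  have m1 : al (4 * p + 12).+1 <= al (4 * p + 12)%N by apply: al_mono; lia.
  have m2 : al (4 * p + 12).+2 <= al (4 * p + 12)%N by apply: al_mono; lia.
  have m3 : al (4 * p + 12).+3 <= al (4 * p + 12)%N by apply: al_mono; lia.
  move: IH m1 m2 m3.
  set x0 := al _; set x1 := al _; set x2 := al _; set x3 := al _.
  move: (\sum_(2 <= i < _) _) (\sum_(k0 <= i < _) _) => S1 S2; lra.
have [n hn] := al_div (B + 4 * M); exists (maxn k0 n); split; first exact: leq_maxl.
have := h _ (leq_maxl k0 n); set K := maxn k0 n => hK.
have : \sum_(2 <= k < n) al k <= \sum_(2 <= i < 4 * K + 12) al i.
  have [n2|n2] := leqP n 2.
    rewrite [X in X <= _]big_geq // big_nat_cond; apply: sumr_ge0 => i /andP[/andP[h2 _] _].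
    by apply: ltW; exact: al_gt0.
  rewrite [X in _ <= X](@big_cat_nat _ _ _ n) //=; [|exact: ltnW|]; last first.
    by have := leq_maxr k0 n; rewrite -/K; lia.
  rewrite lerDl big_nat_cond; apply: sumr_ge0 => i /andP[/andP[h2 _] _].
  by apply: ltW; apply: al_gt0; apply: leq_trans h2; exact: ltnW.
lra.
Qed.

Lemma reach_shift (j : nat) L eta : (2 <= j)%N -> 0 < eta ->
  exists N, forall n, (N <= n)%N -> mu (reach n (L - al j)) <= eta * mu (reach n L).
Proof.
move=> j2 eta0; have [c [c0 c1 hc]] := annulus_bounds mu.
(* Halving avoids a possible atom at the quantile, since only the mass strictly below it is
   controlled. *)
pose b k := al (4 * k + 12)%N / 2.
pose k0 := maxn 2 j.
have b0 k : 0 < b k by rewrite divr_gt0 // al_gt0 // addnC.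
have b_low k e : mu [set w | 0 < w e <= b k] <= 2 ^- (4 * k + 12).
  apply: le_trans (al_lt (_ : 2 <= 4 * k + 12)%N e); last by rewrite addnC.
  apply: lpr_le.
  - rewrite (_ : [set w | _] = [set w | [set` `]0, b k]] (w e)]); first by apply: pm_coord;
    exact: measurable_itv.
    by apply/seteqP; split => w; rewrite /= in_itv.
  - rewrite (_ : [set w | _] = [set w | [set` `]0, al (4 * k + 12)%N[] (w e)]);
    first by apply: pm_coord; exact: measurable_itv.
    by apply/seteqP; split => w; rewrite /= in_itv.
  move=> w _ /= /andP[-> h] /=; apply: (le_lt_trans h).
  by rewrite /b ltr_pdivrMr // ltr_pMr ?ltr1n // al_gt0 // addnC.
(* The mass of []0, al j]] is at least [2 ^- j], of which at most half lies in []0, b k]] for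
   [k >= k0]. *)
pose q : R := 2 ^- j.+1.
have q0 : 0 < q by rewrite invr_gt0 exprn_gt0.
have pmc (I : interval R) e : prod_measurable [set w | [set` I] (w e)].
  by apply: pm_coord; exact: measurable_itv.
have b_piv k e : (k0 <= k)%N -> q <= mu [set w | b k < w e <= al j].
  move=> hk; have h1 := al_ge j2 e; have h2 := b_low k e.
  have h3 : mu [set w | 0 < w e <= al j] <=
      mu [set w | 0 < w e <= b k] + mu [set w | b k < w e <= al j].
    have e1 : [set w : edge -> R | 0 < w e <= b k] = [set w | [set` `]0, b k]] (w e)].
      by apply/seteqP; split => w; rewrite /= in_itv.
    have e2 : [set w : edge -> R | b k < w e <= al j] = [set w | [set` `]b k, al j]] (w e)].
      by apply/seteqP; split => w; rewrite /= in_itv.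
    have e3 : [set w : edge -> R | 0 < w e <= al j] = [set w | [set` `]0, al j]] (w e)].
      by apply/seteqP; split => w; rewrite /= in_itv.
    apply: le_trans (lpr_leU mu _ _); last 2 first.
    - by rewrite e1; exact: pmc.
    - by rewrite e2; exact: pmc.
    apply: lpr_le; first by rewrite e3; exact: pmc.
      by rewrite e1 e2; apply: pmU; exact: pmc.
    move=> w _ /= /andP[w0 ws]; have [h|h] := leP (w e) (b k); [left|right].
      by rewrite w0.
    by rewrite ws.
  have h4 : 2 ^- (4 * k + 12) <= q.
    rewrite /q lef_pV2 ?posrE ?exprn_gt0 //; apply: ler_weXn2l; first by rewrite ler1n.
    by move: hk; rewrite /k0; clear; lia.
  have h5 : 2 ^- j = 2 * q by rewrite /q exprS invfM mulVKf.
  lra.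
pose C := c * c * q.
have C0 : 0 < C by rewrite /C !mulr_gt0.
have step n k : (k0 <= k)%N -> (4 ^ k.+1 <= n)%N ->
    mu (reach n (L - al j)) * C <= mu (reach n L `&` slow (4 ^ k) (4 ^ k.+1) (b k)).
  move=> hk hn; pose r := (4 ^ k)%N.
  have e4 : (4 ^ k.+1 = r.*2.*2)%N by rewrite /r expnS; lia.
  have r16 : (4 ^ 2 <= r)%N.
    by rewrite leq_exp2l //; move: hk; rewrite /k0; clear; lia.
  have r5 : (5 <= r)%N by apply: leq_trans r16.
  have [es [hes ses]] := ebox_list r.*2.*2.
  have d0 : 0 <= 2 ^- (4 * k + 12) :> R by rewrite invr_ge0 exprn_ge0.
  have hc' r' : (5 <= r')%N ->
      c <= bpr mu (circ r' r'.*2) /\ bpr mu (escape r' r'.*2) <= 1 - c by move=> /hc [].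
  (* With [r = 4 ^ k] the box of radius [4 * r] has at most [2 * (8 * r + 1) ^ 2] listed edges, and
     four times this is below [4096 * r ^ 2 = 2 ^ (4 * k + 12)]. *)
  have hsz : (size es)%:R * (4 * 2 ^- (4 * k + 12)) <= 1 :> R.
    rewrite ses mulrA ler_pdivrMr ?exprn_gt0 // mul1r -natrM -natrX ler_nat.
    have -> : (2 ^ (4 * k + 12) = r * r * 4096)%N.
      rewrite (_ : 4 * k + 12 = k + k + (k + k) + 12)%N; last by clear; lia.
      by rewrite /r (expnMn 2 2 k) !(expnD 2).
    clear -r5; nia.
  rewrite e4 in hn *.
  exact: (pivot_scale L (ltW (b0 k)) d0 (b_low k) (fun e => b_piv k e hk) (ltW q0) hc'
    (ltW c0) r5 hn hes hsz).
(* Chosen so that total payments [M] turn the budget bound into the factor [eta]; the 1 keeps [M]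
   positive when [L = 0]. *)
pose M := (`|L| + 1) / (C * eta).
have [K [hK hM]] := sparse_div k0 (2 * M).
have M0 : 0 < M by rewrite /M divr_gt0 ?mulr_gt0 // ltr_wpDl.
exists (4 ^ K)%N => n hn.
have hs : \sum_(k0 <= k < K) b k * mu (reach n L `&` slow (4 ^ k) (4 ^ k.+1) (b k)) <=
    L * mu (reach n L).
  apply: sum_events; [by move=> i; exact: pm_slow|exact: pm_by_path|].
  move=> w nw [x [p [[ex pp lp] hp]]]; apply: le_trans hp; rewrite ex in pp lp *.
  by apply: slow_sum => //; rewrite lp.
have hs2 : M * (mu (reach n (L - al j)) * C) <= L * mu (reach n L).
  apply: le_trans hs.
  apply: (@le_trans _ _ ((\sum_(k0 <= k < K) b k) * (mu (reach n (L - al j)) * C))).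
    apply: ler_wpM2r; first by rewrite mulr_ge0 ?lpr_ge0 // ltW.
    by rewrite /b -mulr_suml; lra.
  rewrite mulr_suml big_nat_cond [X in _ <= X]big_nat_cond.
  apply: ler_sum => k /andP[/andP[h1 h2] _]; apply: ler_wpM2l; first exact: ltW.
  by apply: step => //; apply: leq_trans hn; rewrite leq_exp2l.
have U0 := lpr_ge0 mu (reach n L).
have hs3 : M * (mu (reach n (L - al j)) * C) <= (M * C) * (eta * mu (reach n L)).
  apply: (le_trans hs2); rewrite mulrA; apply: ler_wpM2r => //.
  rewrite -mulrA /M divfK ?mulf_neq0 ?gt_eqF //.
  by apply: (le_trans (ler_norm _)); rewrite lerDl.
move: hs3; rewrite (mulrC _ C) mulrA ler_pM2l // mulr_gt0 //.
Qed.

End Sums.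

(** * Zero arms given a small passage time *)

Definition zero_arm (u : nat) : set cfg :=
  [set b | exists q, nm q = u /\ conn (ostep b (box u)) origin q].

Lemma bdep_zero_arm u : bdep (ebox u) (zero_arm u).
Proof.
move=> b b' bb' [q [hq c]]; exists q; split => //.
by apply: conn_osub c => // e /bb' ->.
Qed.

Lemma ray n : conn (restr adj (box n)) origin (n%:Z, 0).
Proof.
suff h k : (k <= n)%N -> conn (restr adj (box n)) origin (k%:Z, 0) by exact: h.
elim: k => [|k IH] kn; first exact: conn_refl.
apply: (conn_trans (IH (ltnW kn))); apply: conn_step; rewrite /restr /box /nm /adj /=.
by clear -kn; lia.
Qed.

Lemma zero_or_slow (R : realType) (w : edge -> R) (V : pred vertex) s x p : nonneg w ->
  path (restr adj V) x p -> (forall e, edges_in V e -> w e = 0 \/ s <= w e) ->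
  conn (ostep (bin w) V) x (last x p) \/ s <= ptime w x p.
Proof.
move=> nw + h; elim: p x => [|y p IH] x /=; first by left; exact: conn_refl.
move=> /andP[/and3P[axy Vx Vy] pp].
have [w0|sw] : w (edge_of x y) = 0 \/ s <= w (edge_of x y).
- by apply: h; rewrite /edges_in edge_of_ends // Vx.
- have [c|hs] := IH _ pp; last by right; rewrite w0 add0r.
  left; apply: conn_trans c; apply: conn_step; apply/and4P; split => //.
  by rewrite /bin w0.
- by right; apply: (le_trans sw); rewrite lerDl ptime_ge0.
Qed.

Section FarReach.
Variables (R : realType) (mu : iid_law R).

Lemma open_pos (S : pred edge) : fin S -> 0 < bpr mu [set b | forall e, S e -> b e].
Proof.
move=> [es hes]; pose N := undup es.
have m0 : measurable [set (0 : R)] by exact: measurable_set1.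
have := lpr_all_in mu m0 (undup_uniq es) (locT _ _); rewrite setTI lprT mul1r => h.
apply: (@lt_le_trans _ _ (mu (all_in [set 0] N))).
  rewrite h prodr_gt0 // => e _; rewrite (_ : [set w | _] = [set w | w e = 0]) //.
  by rewrite lpr_zero.
apply: lpr_le; first by case: (loc_all_in N m0).
  apply: (pm_bev (S := S)); first by exists es.
  by move=> b b' bb' h' e Se; rewrite -bb' // h'.
by move=> w _ hw e /hes he; apply/eqP; apply: hw; rewrite mem_undup.
Qed.

Lemma pm_reach n L : prod_measurable (reach n L : set (edge -> R)).
Proof. exact: pm_by_path. Qed.

Lemma reach_pos n L : 0 <= L -> 0 < mu (reach n L).
Proof.
move=> L0; apply: (lt_le_trans (open_pos (fin_ebox n))); apply: lpr_le.
- apply: (pm_bev (fin_ebox n)).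
  by move=> b b' bb' h' e Se; rewrite -bb' // h'.
- exact: pm_reach.
move=> w nw hw; have [p [pp lp]] := ray n; exists origin, p; split.
  split => //; last by rewrite lp /nm /= maxn0.
  by apply: sub_path pp => x y /and3P[].
rewrite (ptime0 pp) // => x y /and3P[axy bx bp]; apply/eqP; apply: hw.
by rewrite /ebox /edges_in edge_of_ends // bx.
Qed.

(** Conditioning on [reach] at most doubles the probability of an event about one edge: making the
    edge free gives an independent event, which implies [reach] once the edge is zero, with
    probability 1/2. *)
Lemma low_edge e (C : set R) n L : measurable C ->
  mu (reach n L `&` [set w | C (w e)]) <= 2 * mu [set w | C (w e)] * mu (reach n L).
Proof.
move=> mC; pose U := [set w : edge -> R | reach n L (zer (pred1 e) w)].
have lU : loc (predC1 e) U.
  by apply: locS (loc_zer (pred1 e) (loc_all (pm_reach n L))) => f /andP[].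
have mU := proj1 lU.
have h1 : mu (reach n L `&` [set w | C (w e)]) <= mu U * mu [set w | C (w e)].
  rewrite -lpr_coordI //; apply: lpr_le.
  - by apply: pmI; [exact: pm_reach|exact: pm_coord].
  - by apply: pmI => //; exact: pm_coord.
  move=> w nw [h Cw]; split => //; apply: by_path_le h => f; exact: zer_le.
have h2 : mu U / 2 <= mu (reach n L).
  rewrite -(lpr_zeroI mu (e := e) lU) /= ?eqxx //; apply: lpr_le.
  - by apply: pmI => //; exact: pm_zero.
  - exact: pm_reach.
  move=> w nw [Uw w0]; move: Uw; rewrite /U /= (_ : zer _ w = w) //.
  by apply/funext => f; rewrite /zer /=; case: eqP => // ->.
apply: (le_trans h1); rewrite mulrAC; apply: ler_wpM2r; first exact: lpr_ge0.
lra.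
Qed.

(** Without a zero arm, the path up to its first visit to radius [u] contains a nonzero edge and so
    pays at least [s]; what follows costs at most [L - s]. *)
Lemma zero_prefix (w : edge -> R) u n L s : nonneg w -> (u <= n)%N -> reach n L w ->
  ~ zero_arm u (bin w) -> (forall e, ebox u e -> w e = 0 \/ s <= w e) ->
  reach n (L - s) (zer (ebox u) w).
Proof.
move=> nw un [x [p [[ex pp lp] hp]]] nz hs; rewrite {x}ex in pp lp hp.
case: u un nz hs => [|u] un nz hs.
  by case: nz; exists origin; split => //; exact: conn_refl.
pose F (x : vertex) := (nm x < u.+1)%N.
have nF : ~~ F (last origin p) by rewrite /F -leqNgt lp.
have [s1 [y [s2 [es a1 nFy ps1 [ay ps2 et]]]]] := ptime_exit nw pp (isT : F origin) nF.
have Fl : F (last origin s1) by apply: (allP a1); exact: mem_last.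
have hy : nm y = u.+1.
  by move: (leq_trans (nm_adj ay) Fl) nFy; rewrite /F; clear; lia.
have pbox : path (restr adj (box u.+1)) origin (rcons s1 y).
  rewrite rcons_path; apply/andP; split.
    by apply: sub_path ps1 => a b /and3P[aab Fa Fb]; apply/and3P; split => //; exact: ltnW.
  by apply/and3P; split => //; rewrite /box ?hy //; exact: ltnW.
have hpre : ptime w origin (rcons s1 y) = ptime w origin s1 + w (edge_of (last origin s1) y).
  by rewrite -cats1 ptime_cat /= addr0.
have [c|hc] := zero_or_slow nw pbox hs.
  by case: nz; exists y; split => //; move: c; rewrite last_rcons.
exists origin, p; split => //; rewrite es -cat_rcons ptime_cat (ptime0 pbox); last first.
  move=> a b /and3P[aab Fa Fb]; rewrite /zer.
  by rewrite /ebox /edges_in (edge_of_ends (box u.+1)) // Fa Fb.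
have h2 : ptime (zer (ebox u.+1) w) (last origin (rcons s1 y)) s2 <= ptime w y s2.
  by rewrite last_rcons; apply: (ptime_le ps2) => a b _; exact: zer_le.
rewrite add0r; apply: (le_trans h2); move: hp; rewrite et -hpre; lra.
Qed.

Variable al : nat -> R.
Hypothesis al_lt : forall j, (2 <= j)%N -> forall e, mu [set w | 0 < w e < al j] <= 2 ^- j.
Hypothesis shift : forall j L eta, (2 <= j)%N -> 0 < eta ->
  exists N, forall n, (N <= n)%N -> mu (reach n (L - al j)) <= eta * mu (reach n L).

Lemma zero_arm_likely (u : nat) L eta : 0 < eta -> exists N, forall n, (N <= n)%N ->
  mu (reach n L `\` bev (zero_arm u)) <= eta * mu (reach n L).
Proof.
move=> eta0; have [es hes] := fin_ebox u.
pose m : R := (size es)%:R; have m0 : 0 <= m by [].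
(* Half of [eta] is for the [m] edges of the box being positive but below [al j], each of
   conditional probability at most [2 * 2 ^- j]. *)
have e0 : 0 < eta / (4 * (m + 1)) by rewrite divr_gt0 // mulr_gt0 // ltr_wpDl.
have [k hk] := @exp_small R 2^-1 _ ltac:(lra) ltac:(lra) e0.
pose j := maxn 2 k; have j2 : (2 <= j)%N by exact: leq_maxl.
have hj : 2 ^- j <= eta / (4 * (m + 1)).
  apply: le_trans hk; rewrite exprVn lef_pV2 ?posrE ?exprn_gt0 //.
  by apply: ler_weXn2l; [rewrite ler1n|exact: leq_maxr].
pose op : set cfg := [set b | forall e, ebox u e -> b e].
have dop : bdep (ebox u) op by move=> b b' bb' h' e Se; rewrite -bb' // h'.
have kap := open_pos (fin_ebox u); set kappa := bpr _ _ in kap.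
(* [kappa] is the price of an entirely open box, which converts the event with the box made free
   back into [reach]. *)
have [N hN] := shift (j := j) L j2 (mulr_gt0 kap (divr_gt0 eta0 (ltr0Sn _ 1%N : 0 < 2))).
exists (maxn N u) => n; rewrite geq_max => /andP[/hN hn un].
pose low e := [set w : edge -> R | 0 < w e < al j].
have mlow : measurable [set x : R | 0 < x < al j].
  rewrite (_ : [set x | _] = [set` `]0, al j[]); first exact: measurable_itv.
  by apply/seteqP; split => x; rewrite /= in_itv.
pose V := [set w : edge -> R | reach n (L - al j) (zer (ebox u) w)].
have lV : loc (fun e => ~~ ebox u e) V.
  by apply: locS (loc_zer (ebox u) (loc_all (pm_reach n (L - al j)))) => f /andP[].
have mV := proj1 lV.
have hV : mu V * kappa <= mu (reach n (L - al j)).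
  rewrite /kappa /bpr -(lpr_indep mu lV (loc_bev R (fin_ebox u) dop)); last by move=> e /negPf ->.
  apply: lpr_le; [by apply: pmI => //; exact: pm_bev (fin_ebox u) dop|exact: pm_reach|].
  move=> w nw [Vw ow]; move: Vw; rewrite /V /= (_ : zer _ w = w) //.
  by apply/funext => f; rewrite /zer; case: ifP => // /ow /eqP.
pose Y e := reach n L `&` low e.
have mY e : prod_measurable (Y e) by apply: pmI; [exact: pm_reach|exact: (pm_coord e mlow)].
have mZ : prod_measurable (bev (zero_arm u) : set (edge -> R)).
  exact: pm_bev (fin_ebox u) (@bdep_zero_arm u).
have U0 := lpr_ge0 mu (reach n L).
have h1 : mu (reach n L `\` bev (zero_arm u)) <= mu [set w | exists2 e, e \in es & Y e w] + mu V.
  apply: le_trans (lpr_leU mu (pm_exists_in es mY) mV).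
  apply: lpr_le.
  - by apply: pmD => //; exact: pm_reach.
  - by apply: pmU => //; exact: pm_exists_in.
  move=> w nw [Uw nz]; have [[e ees lw]|nl] := pselect (exists2 e, e \in es & low e w).
    by left; exists e.
  right; apply: zero_prefix => // e /hes ees.
  have [h|h] := leP (al j) (w e); first by right.
  left; apply/eqP; apply: contrapT => /negP wn; apply: nl; exists e => //=.
  by rewrite /low /= h andbT lt_neqAle eq_sym wn nw.
have h2 : mu [set w | exists2 e, e \in es & Y e w] <= m * (2 * 2 ^- j * mu (reach n L)).
  apply: (le_trans (lpr_exists_in mu es mY)).
  rewrite /m mulr_natl -iter_addr_0 -(count_predT es) -big_const_seq.
  apply: ler_sum => e _; apply: (le_trans (low_edge e n L mlow)).
  by apply: ler_wpM2r => //; apply: ler_wpM2l => //; exact: al_lt.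
have h3 : mu V <= eta / 2 * mu (reach n L).
  rewrite -(ler_pM2r kap); apply: (le_trans hV); apply: (le_trans hn).
  by rewrite [X in _ <= X]mulrC [X in _ <= X]mulrA.
apply: (le_trans h1); apply: (le_trans (lerD h2 h3)).
have h4 : m * (2 * 2 ^- j) <= eta / 2.
  have x0 : 0 <= 2 ^- j :> R by rewrite invr_ge0 exprn_ge0.
  move: hj; rewrite ler_pdivlMr ?mulr_gt0 ?ltr_wpDl //.
  by move: (2 ^- j) x0 => x x0 hx; lra.
have := ler_wpM2r U0 h4; rewrite -mulrA; lra.
Qed.

End FarReach.

(** * Splitting cheap paths at the hub *)

Section HubReach.
Variables (R : realType) (l u n : nat) (L : R).
Hypotheses (lu : (l < u)%N) (un : (u < n)%N).

Definition out_path (sigma : cfg) (x : vertex) (s : seq vertex) : Prop :=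
  [/\ hub l u sigma x, path (restr adj (outer l)) x s & nm (last x s) = n].

(* A consequence of [zero_arm] and [circ] which, unlike [zero_arm], splits
   exactly at the hub. *)
Definition hub_arm : set cfg := [set b | circ l u b /\
  target l (rst (mid_edges l u) b) (hub l u (rst (mid_edges l u) b)) b].

Lemma bdep_hub_arm : bdep (ebox u) hub_arm.
Proof.
move=> b b' bb' [cb tb]; have e : rst (mid_edges l u) b = rst (mid_edges l u) b'.
  by apply: rst_agree => f /andP[/bb'].
split.
  by apply: bdep_circ cb => f /ann_mid /andP[/bb'].
rewrite -e; apply: bdep_target tb => f /ebox_mono h; apply: bb'; apply: h; exact: ltnW.
Qed.

Lemma loc_out_path sigma :
  loc (fun e => ~~ ebox l e) (by_path (out_path sigma) L : set (edge -> R)).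
Proof.
split; first exact: pm_by_path.
move=> w w' ww' [x [s [[hx ps ls] hs]]]; exists x, s; split => //.
apply: le_trans hs; apply: (ptime_le ps) => y z /and3P[ayz oy oz].
by rewrite ww' // ebox_outer // /edges_in edge_of_ends // oy.
Qed.

Lemma hub_arm_of_zero_arm b : circ l u b -> zero_arm u b -> hub_arm b.
Proof.
move=> cb [q [hq c]]; split => //; set sigma := rst _ b.
have cs : circ l u sigma by apply/circ_rst.
have [_ sK] := hubP cs.
have hK v : hub l u sigma v -> ann l u v by exact: hub_ann.
have ra x y : ostep b (box u) x y -> adj x y by case/and4P.
have hq' : (u <= nm q)%N by rewrite hq.
have [k [Kk c1 _]] := sep_first sK hK ra lu c (leq0n _ : (nm origin <= l)%N) hq'.
exists k; split => //; apply: conn_sub c1 => x y /and3P[/and4P[axy bxy bx bY] _ _].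
apply/and4P; split => //; rewrite /frz; case: (boolP (ebox l _)) => // nl.
by rewrite /sigma /rst /mid_edges bxy nl /ebox /edges_in edge_of_ends // bx bY.
Qed.

(** The part of a cheap path after its last exit from the hub stays beyond radius [l] and costs no
    more than the whole. Conversely the zero-cost arm to the hub and the hub itself supply the
    beginning, so the budget is [L] on both sides. *)
Lemma reach_hub_arm (w : edge -> R) sigma : nonneg w -> circ l u sigma ->
  rst (mid_edges l u) (bin w) = sigma ->
  reach n L w /\ hub_arm (bin w) <->
  target l sigma (hub l u sigma) (bin w) /\ by_path (out_path sigma) L w.
Proof.
move=> nw cs hs; have [_ sK] := hubP cs.
have hK v : hub l u sigma v -> ann l u v by exact: hub_ann.
have cb : circ l u (bin w) by apply/(circ_rst l u); rewrite hs.
split.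
  move=> [[x [p [[ex pp lp] hp]]] [_]]; rewrite hs => tb; split => //.
  rewrite {x}ex in pp lp hp.
  have /hasP[v vp Kv] : has (hub l u sigma) (origin :: p).
    by apply: sK => //; rewrite lp ltnW.
  case/splitPl: vp pp lp hp => p1 p2 e1;
    rewrite cat_path last_cat ptime_cat e1 => /andP[pp1 pp2] lp hp.
  have nKl : ~~ hub l u sigma (last v p2).
    by apply/negP => /hK /andP[_]; rewrite lp leqNgt un.
  have [s1 [y [s2 [e2 K1 K2]]]] := path_last_exit pp2 Kv nKl.
  move: pp2 lp hp; rewrite e2 cat_path last_cat ptime_cat /= => /and3P[ps1 ay ps2] lp hp.
  exists (last v s1), (y :: s2); split; last first.
    by move: hp (ptime_ge0 origin p1 nw) (ptime_ge0 v s1 nw) => /=; lra.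
  split => //; apply: path_restr; first by rewrite /= ay.
  have h0 : outer l (last v s1) by case/andP: (hK _ K1).
  apply/allP => z; rewrite inE => /orP[/eqP -> //|zs].
  rewrite /outer ltnNge; apply/negP => hz.
  case/splitPl: zs ps2 K2 lp => q1 q2 e3; rewrite cat_path last_cat e3 => /andP[_ pq2] K2 lp.
  have : has (hub l u sigma) (z :: q2) by apply: sK => //; rewrite lp ltnW.
  move=> /hasP[k kq Kk]; have : k \in y :: q1 ++ q2.
    move: kq; rewrite inE => /orP[/eqP ->|kq].
      by rewrite -cat_cons mem_cat -e3 mem_last.
    by rewrite -cat_cons mem_cat kq orbT.
  by move=> /(allP K2); rewrite /= Kk.
move=> [tb [x [s [[hx ps ls] hp]]]]; split; last by split => //; rewrite hs.
have [q [Kq c]] := tb.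
have sE e : sigma e -> bin w e by rewrite -hs /rst => /andP[].
have [z [pz lz]] : conn (ostep (bin w) predT) origin x.
  apply: (conn_trans (y := q)).
    by apply: conn_osub c => // e _; rewrite /frz; case: ifP => // _; exact: sE.
  by apply: conn_osub (hub_conn Kq hx) => // e _; exact: sE.
exists origin, (z ++ s); split.
  split => //; last by rewrite last_cat lz.
  rewrite cat_path lz; apply/andP; split.
    by apply: sub_path pz => a b /and4P[].
  by apply: sub_path ps => a b /and3P[].
rewrite ptime_cat lz (ptime0 pz) ?add0r //.
by move=> a b /and4P[_ /eqP].
Qed.

Variables (mu : iid_law R).

Lemma hub_arm_sum (X : set (edge -> R)) (ks : seq cfg) : loc (ebox l) X ->
  (forall X, prod_measurable X ->
    mu X = \sum_(k <- ks) mu (X `&` bev [set b | rst (mid_edges l u) b = k])) ->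
  mu (X `&` (reach n L `&` bev hub_arm)) =
  \sum_(k <- ks) mu (X `&` bev (target l k (hub l u k))) *
    (if `[< circ l u k >] then
       mu (bev [set b | rst (mid_edges l u) b = k] `&` by_path (out_path k) L) else 0).
Proof.
move=> lX hks; have mX := proj1 lX.
have mJ : prod_measurable (bev hub_arm : set (edge -> R)).
  exact: pm_bev (fin_ebox u) bdep_hub_arm.
have mU := @pm_reach R n L.
rewrite hks; last by apply: pmI => //; exact: pmI.
apply: eq_bigr => k _; case: asboolP => ck; last first.
  rewrite mulr0 -[RHS](lpr0 mu); congr (mu _); apply/seteqP; split => // w.
  move=> [[_ [_ [cb _]]] /= e]; apply: ck; rewrite -e.
  by apply/circ_rst.
have dR : bdep (mid_edges l u) [set b | rst (mid_edges l u) b = k].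
  exact: (@bdep_rst cfg (mid_edges l u) id k).
have mR : prod_measurable (bev [set b | rst (mid_edges l u) b = k] : set (edge -> R)).
  exact: pm_bev (fin_mid l u) dR.
have lT : loc (ebox l) (X `&` bev (target l k (hub l u k))).
  by apply: locI => //; apply: (loc_bev R (fin_ebox l) (@bdep_target _ _ _)).
have lO : loc (fun e => ~~ ebox l e)
    (bev [set b | rst (mid_edges l u) b = k] `&` by_path (out_path k) L : set (edge -> R)).
  apply: locI; last exact: loc_out_path.
  by apply: locS (loc_bev R (fin_mid l u) dR) => e /andP[].
rewrite -(lpr_indep mu lT lO); last by move=> e ->.
apply: lpr_eq.
- by apply: pmI => //; apply: pmI => //; exact: pmI.
- by apply: pmI; [case: lT|case: lO].
move=> w nw; split.
  move=> [[Xw UJ] Rw]; have [h _] := reach_hub_arm nw ck Rw.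
  by have [h1 h2] := h UJ.
move=> [[Xw Tw] [Rw Ow]]; have [_ h] := reach_hub_arm nw ck Rw.
by split => //; split => //; exact: h.
Qed.

End HubReach.

(** [rho] comes from zero connections to the hub and is fixed before [L]. The three thirds of [eps]
    pay for its accuracy, for the absence of a circuit and for the absence of a zero arm. *)
Lemma ratio_close (R : realType) (mu : iid_law R) (m : nat) (E : set (edge -> R)) (eps : R) :
  (forall u L eta, 0 < eta -> exists N, forall n, (N <= n)%N ->
    mu (reach n L `\` bev (zero_arm u)) <= eta * mu (reach n L)) ->
  loc (ebox m) E -> 0 < eps ->
  exists rho, forall L, exists N, forall n, (N <= n)%N ->
    `|mu (E `&` reach n L) - rho * mu (reach n L)| <= eps * mu (reach n L).
Proof.
move=> zl lE eps0; have [c [c0 c1 hc]] := annulus_bounds mu.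
have e3 : 0 < eps / 3 by lra.
have c01 : 0 < c < 1 by rewrite c0.
have [l [_ ml [rho [/andP[r0 r1] hrho]]]] := good_small lE c01 hc 0%N e3.
have [u [lu hu]] := circ_whp mu l e3.
exists rho => L; have [N hN] := zl u L _ e3.
exists (maxn N u.+1) => n; rewrite geq_max => /andP[/hN hn un].
have [ks [_ hks]] := lpr_part mu (fin_mid l u) (@rst_agree (mid_edges l u)).
have lE' : loc (ebox l) E by apply: locS lE => e; exact: ebox_mono.
have mE := proj1 lE.
set U := reach n L; pose J : set (edge -> R) := bev (hub_arm l u).
have mU : prod_measurable U by exact: pm_reach.
have mJ : prod_measurable J by apply: pm_bev (fin_ebox u) (@bdep_hub_arm l u lu).
have mC : prod_measurable (bev (circ l u) : set (edge -> R)).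
  exact: pm_bev (fin_ann _ _) (@bdep_circ _ _).
have mZ : prod_measurable (bev (zero_arm u) : set (edge -> R)).
  exact: pm_bev (fin_ebox u) (@bdep_zero_arm u).
have mUJ := pmI mU mJ; have mUJ' := pmD mU mJ.
have f1 : `|mu (E `&` (U `&` J)) - rho * mu (U `&` J)| <= eps / 3 * mu (U `&` J).
  have hT := hub_arm_sum L lu un (locT R (ebox l)) hks; rewrite setTI in hT.
  rewrite (hub_arm_sum L lu un lE' hks) hT !mulr_sumr -sumrB.
  apply: (le_trans (ler_norm_sum _ _ _)); apply: ler_sum => k _.
  case: asboolP => ck; last by rewrite !mulr0 subr0 normr0.
  rewrite setTI !mulrA -mulrBl normrM [X in _ * X <= _]ger0_norm ?lpr_ge0 //.
  apply: ler_wpM2r; first exact: lpr_ge0.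
  by apply: hrho => q /(hub_ann ck) /andP[].
have f2 : mu (U `\` bev (circ l u)) <= eps / 3 * mu U.
  have h1 := lprID mu mU mC.
  have h2 : mu U * bpr mu (circ l u) <= mu (U `&` bev (circ l u)).
    apply: (fkg mu mU _ (fin_ann _ _) (@bdep_circ _ _) (@binc_circ _ _)).
    by move=> w w' _; exact: by_path_le.
  have U0 := lpr_ge0 mu U.
  have := ler_wpM2l U0 hu; lra.
have f3 : mu (U `\` J) <= mu (U `\` bev (circ l u)) + mu (U `\` bev (zero_arm u)).
  have m1 := pmD mU mC; have m2 := pmD mU mZ.
  apply: le_trans (lpr_leU mu m1 m2); apply: lpr_le => //; first exact: pmU.
  move=> w _ [Uw nJ]; have [cw|ncw] := pselect (circ l u (bin w)); last by left.
  right; split => // zw; apply: nJ; exact: hub_arm_of_zero_arm.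
have g1 := lprID mu (pmI mE mU) mJ.
have g2 := lprID mu mU mJ.
have g3 : mu ((E `&` U) `\` J) <= mu (U `\` J).
  by apply: lpr_le => //; [apply: pmD => //; exact: pmI|move=> w _ [[_ h1] h2]].
have g4 := lpr_ge0 mu ((E `&` U) `\` J).
have U0 := lpr_ge0 mu (U `&` J).
rewrite -setIA in g1; rewrite g1 g2.
move: f1 f2 f3 hn g2 g3 g4 U0; rewrite -/U.
set x1 := mu (E `&` (U `&` J)); set x2 := mu ((E `&` U) `\` J); set y1 := mu (U `&` J).
set y2 := mu (U `\` J); move=> f1 f2 f3 hn g2 g3 g4 U0.
have y20 : 0 <= y2 by exact: le_trans g3.
have -> : x1 + x2 - rho * (y1 + y2) = (x1 - rho * y1) + (x2 - rho * y2) by ring.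
apply: (le_trans (ler_normD _ _)).
have k1 : `|x2 - rho * y2| <= y2.
  have h1 := mulr_ge0 r0 y20; have h2 : rho * y2 <= 1 * y2 by exact: ler_wpM2r.
  rewrite ler_norml; lra.
rewrite g2 in f2 hn; have := mulr_ge0 (ltW eps0) y20; lra.
Qed.

(** * Passage times and quantiles *)

Section PassageTime.
Variable R : realType.

Lemma shorten_ptime (w : edge -> R) x s : nonneg w -> path adj x s ->
  exists s', [/\ path adj x s', last x s' = last x s, uniq (x :: s'),
    {subset s' <= s} & ptime w x s' <= ptime w x s].
Proof.
move=> nw; elim: s x => [|y s IH] x; first by move=> _; exists [::]; split.
move=> /= /andP[axy /IH [s' [ps' ls' us' sub hs']]].
have sub' : {subset y :: s' <= y :: s}.
  by move=> z; rewrite !inE => /orP[->//|/sub ->]; rewrite orbT.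
case: (boolP (x \in y :: s')) => [xs|nxs]; last first.
  exists (y :: s'); split => //; rewrite ?cons_uniq ?nxs //= ?axy //.
  by rewrite lerD2l.
have hw := nw (edge_of x y).
move: xs; rewrite inE => /orP[/eqP exy|xs].
  subst y; exists s'; split => //; last by lra.
  by move=> z zs; apply: sub'; rewrite inE zs orbT.
case/splitPr: xs ps' ls' us' sub' hs' => p1 p2.
rewrite cat_path last_cat /= mem_cat cat_uniq ptime_cat => /and3P[_ _ pp2] lp2.
move=> /and3P[_ _ /= /andP[u1 /andP[u2 u3]]] sub' hs'; exists p2; split => //=.
- by rewrite u2.
- by move=> z zp; apply: sub'; rewrite inE mem_cat inE zp !orbT.
have := ptime_ge0 y p1 nw; have := nw (edge_of (last y p1) x).
by move: hs' hw => /=; lra.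
Qed.

Lemma box_seq (n : nat) : exists vs : seq vertex, forall x, box n x -> x \in vs.
Proof.
have [es [hes _]] := ebox_list n.+1; exists (map src es) => -[i j] hx.
pose e : edge := ((i, j), false).
have he : ebox n.+1 e.
  move: hx; rewrite /e /ebox /edges_in /box /src /tgt /nm /=; clear; lia.
by apply/mapP; exists e => //; exact: hes.
Qed.

Lemma seqs_upto (T : eqType) (vs : seq T) (N : nat) :
  exists ss : seq (seq T), forall s, (size s <= N)%N -> {subset s <= vs} -> s \in ss.
Proof.
elim: N => [|N [ss hss]]; first by exists [:: [::]] => -[].
exists ([::] :: [seq x :: s | x <- vs, s <- ss]) => -[//|x s] hs sub.
rewrite inE /=; apply/allpairsP; exists (x, s); split => //=.
  by apply: sub; rewrite inE eqxx.
by apply: hss => // y ys; apply: sub; rewrite inE ys orbT.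
Qed.

Lemma min_above (T : eqType) (ss : seq T) (Q : T -> Prop) (f : T -> R) L :
  (forall s, s \in ss -> Q s -> L < f s) ->
  exists M, L < M /\ forall s, s \in ss -> Q s -> M <= f s.
Proof.
elim: ss => [|s ss IH] h; first by exists (L + 1); split => //; rewrite ltrDl.
have [|M [LM hM]] := IH; first by move=> s' hs'; apply: h; rewrite inE hs' orbT.
have [Qs|nQs] := pselect (Q s); last first.
  exists M; split => // s'; rewrite inE => /orP[/eqP ->//|]; exact: hM.
exists (Num.min M (f s)); split.
  by rewrite lt_min LM h // inE eqxx.
move=> s'; rewrite inE => /orP[/eqP -> _|hs' Qs']; rewrite ge_min ?lexx ?orbT //.
by rewrite hM.
Qed.

(** Stopping at the first visit to radius [n] and then erasing loops does not raise the cost, and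
    only finitely many self-avoiding paths stay in the box. *)
Lemma reach_short (n : nat) : exists ss : seq (seq vertex),
  forall (w : edge -> R) s, nonneg w -> arrive n origin s ->
  exists s', [/\ s' \in ss, arrive n origin s' & ptime w origin s' <= ptime w origin s].
Proof.
have [vs hvs] := box_seq n; have [ss hss] := seqs_upto vs (size vs).
exists ss => w s nw [_ ps ls].
suff [s0 [ps0 ls0 sub0 hs0]] : exists s0, [/\ path adj origin s0, nm (last origin s0) = n,
    {subset s0 <= vs} & ptime w origin s0 <= ptime w origin s].
  have [s1 [ps1 ls1 us1 sub1 hs1]] := shorten_ptime nw ps0; exists s1; split => //.
  - apply: hss; last by move=> z /sub1 /sub0.
    apply: uniq_leq_size; last by move=> z /sub1 /sub0.
    by case/andP: us1.
  - by split => //; rewrite ls1.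
  - exact: le_trans hs0.
case: n ls hvs {hss} => [|n] ls hvs.
  by exists [::]; split => //; exact: ptime_ge0.
pose F (x : vertex) := (nm x < n.+1)%N.
have nF : ~~ F (last origin s) by rewrite /F -leqNgt ls.
have [s1 [y [s2 [es a1 nFy _ [ay ps2 et]]]]] := ptime_exit nw ps (isT : F origin) nF.
have Fl : F (last origin s1) by apply: (allP a1); exact: mem_last.
have hy : nm y = n.+1.
  by move: (leq_trans (nm_adj ay) Fl) nFy; rewrite /F; clear; lia.
exists (rcons s1 y); split.
- by move: ps; rewrite es -cat_rcons cat_path => /andP[].
- by rewrite last_rcons.
- move=> z; rewrite mem_rcons inE => /orP[/eqP ->|zs]; apply: hvs; rewrite /box ?hy //.
  by apply: ltnW; apply: (allP a1); rewrite inE zs orbT.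
- rewrite -cats1 ptime_cat /= addr0 et lerDl; exact: ptime_ge0.
Qed.

(* The infimum is attained: only finitely many paths compete once loops and
   excursions outside the box are removed. *)
Lemma passage_time_le (w : edge -> R) n L : nonneg w ->
  (passage_time w [set origin] (bdbox n) <= L) <-> reach n L w.
Proof.
move=> nw; rewrite /passage_time; set S := [set r | _].
have lb0 : lbound S 0 by move=> r [x [s [_ _ _ ->]]]; exact: ptime_ge0.
split; last first.
  move=> [x [s [[-> ps ls] hs]]]; apply: le_trans hs; apply: ge_inf; first by exists 0.
  by exists origin, s; split => //; apply/bdboxE.
move=> h; apply: contrapT => nr.
have [ss hss] := reach_short n.
have [|M [LM hM]] := @min_above _ ss (arrive n origin) (ptime w origin) L.
  move=> s _ as_; rewrite ltNge; apply/negP => hs; apply: nr.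
  by exists origin, s.
have : M <= inf S.
  apply: lb_le_inf.
    have [s [ps ls]] := ray n; exists (ptime w origin s), origin, s; split => //.
      by apply: sub_path ps => a b /and3P[].
    by apply/bdboxE; rewrite ls /nm /= maxn0.
  move=> r [x [s [-> ps ls ->]]].
  have [|s' [s's as' hs']] := hss w s nw; first by split => //; apply/bdboxE.
  by apply: le_trans hs'; exact: hM.
by rewrite leNgt (le_lt_trans h LM).
Qed.

Lemma passage_time_eq0 (w : edge -> R) n : nonneg w ->
  (passage_time w [set origin] (bdbox n) = 0) <-> reach n 0 w.
Proof.
move=> nw; rewrite -passage_time_le //; split => [->//|h].
apply/eqP; rewrite eq_le h /=; apply: lb_le_inf; last first.
  by move=> r [x [s [_ _ _ ->]]]; exact: ptime_ge0.
have [s [ps ls]] := ray n; exists (ptime w origin s), origin, s; split => //.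
  by apply: sub_path ps => a b /and3P[].
by apply/bdboxE; rewrite ls /nm /= maxn0.
Qed.

End PassageTime.

(** * Mass near zero from the quantiles *)

Section Quantile.
Variables (R : realType) (mu : iid_law R) (F : R -> R).
Hypothesis mu_bigcup : forall (G : nat -> set (edge -> R)) c,
  (forall k, prod_measurable (G k)) -> (forall k w, G k w -> G k.+1 w) ->
  (forall k, mu (G k) <= c) -> mu (\bigcup_k G k) <= c.
Hypothesis hF : forall e x, mu [set w | w e <= x] = F x.

Let e0 : edge := (origin, false).

Let pm_le e x : prod_measurable [set w : edge -> R | w e <= x].
Proof. exact: (pm_coord e (measurable_itv `]-oo, x])). Qed.

Let pm_gt e x : prod_measurable [set w : edge -> R | x < w e].
Proof.
rewrite (_ : [set w | _] = ~` [set w | w e <= x]); first exact: pmC.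
by apply/seteqP; split => w /=; rewrite ltNge => /negP.
Qed.

Lemma quantile_ge0 p x : 0 < p -> p <= F x -> 0 <= x.
Proof.
move=> p0 px; rewrite leNgt; apply/negP => x0.
suff h : F x <= 0 by have := lt_le_trans p0 (le_trans px h); rewrite ltxx.
rewrite -(hF e0) -(lpr0 mu); apply: lpr_le; [exact: pm_le|exact: pm0|].
by move=> w nw /= h; have := le_lt_trans (le_trans (nw e0) h) x0; rewrite ltxx.
Qed.

Lemma quantile_lbound p : 0 < p -> lbound [set x | p <= F x] 0.
Proof. by move=> p0 x; exact: quantile_ge0. Qed.

Lemma quantile_nonempty p : p < 1 -> [set x | p <= F x] !=set0.
Proof.
move=> p1; apply: contrapT => h; have : mu setT <= p; last by rewrite lprT leNgt p1.
rewrite (_ : setT = \bigcup_k [set w : edge -> R | w e0 <= k%:R]).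
  apply: mu_bigcup => [k|k w /= hw|k]; first exact: pm_le.
    by apply: (le_trans hw); rewrite ler_nat.
  by rewrite hF leNgt; apply/negP => /ltW pF; apply: h; exists k%:R.
apply/seteqP; split => w // _; exists (Num.truncn (w e0)).+1 => //=.
by rewrite ltW // truncnS_gt.
Qed.

(** Right continuity of [F]: the event of exceeding the quantile is the increasing union of the
    events of exceeding it by [1 / (k + 1)]. *)
Lemma quantile_le p : 0 < p -> p < 1 -> p <= F (Finv F p).
Proof.
move=> p0 p1; set a := Finv F p.
suff h : mu [set w | a < w e0] <= 1 - p.
  have := lprC mu (pm_le e0 a); rewrite hF (_ : ~` _ = [set w | a < w e0]); first by lra.
  by apply/seteqP; split => w /=; rewrite ltNge => /negP.
rewrite (_ : [set w | _] = \bigcup_k [set w : edge -> R | a + k.+1%:R^-1 < w e0]).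
  apply: mu_bigcup => [k|k w /= hw|k]; first exact: pm_gt.
    apply: le_lt_trans hw; rewrite lerD2l lef_pV2 ?posrE ?ltr0Sn // ler_nat //.
  have [|x px xa] := @inf_lt R [set x | p <= F x] (a + k.+1%:R^-1) (quantile_nonempty p1).
    by rewrite ltrDl invr_gt0.
  apply: (@le_trans _ _ (mu (~` [set w | w e0 <= x]))).
    apply: lpr_le; [exact: pm_gt|apply: pmC; exact: pm_le|].
    by move=> w _ /= h; rewrite leNgt (lt_trans xa h).
  by rewrite lprC ?hF; [move: px => /=; lra|exact: pm_le].
apply/seteqP; split => w /=; last first.
  by move=> [k _ /= h]; apply: le_lt_trans h; rewrite lerDl invr_ge0.
by move=> h; have [k hk] := ltr_add_invr h; exists k.
Qed.

Lemma quantile_lt p e : 0 < p -> mu [set w | w e < Finv F p] <= p.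
Proof.
move=> p0; set a := Finv F p.
rewrite (_ : [set w | _] = \bigcup_k [set w : edge -> R | w e <= a - k.+1%:R^-1]).
  apply: mu_bigcup => [k|k w /= hw|k]; first exact: pm_le.
    by apply: (le_trans hw); rewrite lerD2l lerN2 lef_pV2 ?posrE ?ltr0Sn // ler_nat.
  rewrite hF leNgt; apply/negP => /ltW pF.
  have : a <= a - k.+1%:R^-1 by apply: ge_inf => //; exists 0; exact: quantile_lbound.
  by rewrite lerDl oppr_ge0 leNgt invr_gt0 ltr0Sn.
apply/seteqP; split => w /=; last first.
  by move=> [k _ /= h]; apply: le_lt_trans h _; rewrite ltrBlDr ltrDl invr_gt0.
by move=> h; have [k hk] := ltr_add_invr h; exists k => //=; rewrite lerBrDr ltW.
Qed.

Lemma quantile_mono p p' : 0 < p -> p <= p' -> p' < 1 -> Finv F p <= Finv F p'.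
Proof.
move=> p0 pp' p1; apply: lb_le_inf; first exact: quantile_nonempty.
move=> x /= px; apply: ge_inf; first by exists 0; exact: quantile_lbound.
exact: le_trans px.
Qed.

Hypothesis F0 : F 0 = 2^-1.

Let al (k : nat) : R := Finv F (2^-1 + 2 ^- k).

Let half (k : nat) : (2 <= k)%N -> 0 < 2^-1 + 2 ^- k :> R /\ 2^-1 + 2 ^- k < 1 :> R.
Proof.
move=> k2; have h0 : 0 < 2 ^- k :> R by rewrite invr_gt0 exprn_gt0.
have h1 : 2 ^- k <= 2 ^- 2 :> R.
  by rewrite lef_pV2 ?posrE ?exprn_gt0 //; apply: ler_weXn2l; rewrite ?ler1n.
by move: h0 h1; rewrite expr2 invfM; move: (2 ^- k) => x; split; lra.
Qed.

Lemma al_gt0 j : (2 <= j)%N -> 0 < al j.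
Proof.
move=> j2; have [h0 h1] := half j2; have h := quantile_le h0 h1.
rewrite lt_neqAle (quantile_ge0 h0 h) andbT; apply/eqP => e.
have x0 : 0 < 2 ^- j :> R by rewrite invr_gt0 exprn_gt0.
by move: h; rewrite -/(al j) -e F0; lra.
Qed.

Lemma al_mono i j : (2 <= i)%N -> (i <= j)%N -> al j <= al i.
Proof.
move=> i2 ij; have [_ h1] := half i2; have [h0 _] := half (leq_trans i2 ij).
apply: quantile_mono => //; rewrite lerD2l lef_pV2 ?posrE ?exprn_gt0 //.
by apply: ler_weXn2l; rewrite ?ler1n.
Qed.

Let positive_part e (B : set R) : measurable B -> B 0 ->
  mu [set w | B (w e)] = 2^-1 + mu [set w | w e != 0 /\ B (w e)].
Proof.
move=> mB B0; rewrite (lprID mu (pm_coord e mB) (pm_zero e)) -(lpr_zero mu e).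
congr (mu _ + mu _); apply/seteqP; split => w /=.
- by move=> [].
- by move=> ->.
- by move=> [h /eqP].
- by move=> [/eqP].
Qed.

Let pm_pos e (B : set R) : measurable B -> prod_measurable [set w | 0 < w e /\ B (w e)].
Proof. by move=> mB; apply: pmI; [exact: pm_gt|exact: pm_coord]. Qed.

Let pm_nz e (B : set R) : measurable B -> prod_measurable [set w | w e != 0 /\ B (w e)].
Proof.
move=> mB; rewrite (_ : [set w | _] = [set w | B (w e)] `\` [set w | w e = 0]).
  by apply: pmD; [exact: pm_coord|exact: pm_zero].
by apply/seteqP; split => w /= [h1 h2]; split => //; [apply/eqP|apply/eqP].
Qed.

(** The mass up to the quantile is at least [1/2 + 2 ^- j], and the atom at 0 takes exactly 1/2 of
    it. *)
Lemma al_ge j : (2 <= j)%N -> forall e, 2 ^- j <= mu [set w | 0 < w e <= al j].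
Proof.
move=> j2 e; have [h0 h1] := half j2; have h := quantile_le h0 h1.
have mB := measurable_itv `]-oo, al j].
have := @positive_part e _ mB; rewrite /= in_itv /= => /(_ (ltW (al_gt0 j2))).
rewrite (_ : [set w | _] = [set w | w e <= al j]) // hF => hm.
apply: (@le_trans _ _ (mu [set w | w e != 0 /\ [set` `]-oo, al j]] (w e)])).
  by move: h hm; rewrite -/(al j); lra.
apply: lpr_le; first exact: pm_nz.
  rewrite (_ : [set w | _] = [set w | 0 < w e /\ [set` `]-oo, al j]] (w e)]); first exact: pm_pos.
  by apply/seteqP; split => w /=; rewrite in_itv /= => /andP.
by move=> w nw /= [w0]; rewrite in_itv /= => ->; rewrite andbT lt_neqAle eq_sym w0 nw.
Qed.

Lemma al_lt j : (2 <= j)%N -> forall e, mu [set w | 0 < w e < al j] <= 2 ^- j.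
Proof.
move=> j2 e; have [h0 h1] := half j2; have h := quantile_lt e h0.
have mB := measurable_itv `]-oo, al j[.
have := @positive_part e _ mB; rewrite /= in_itv /= => /(_ (al_gt0 j2)).
rewrite (_ : [set w | _] = [set w | w e < al j]) // => hm.
apply: (@le_trans _ _ (mu [set w | w e != 0 /\ [set` `]-oo, al j[] (w e)])); last first.
  by move: h hm; rewrite -/(al j); lra.
apply: lpr_le; last 2 first.
- exact: pm_nz.
- by move=> w nw /= /andP[w0 wa]; rewrite in_itv /= wa gt_eqF.
rewrite (_ : [set w | _] = [set w | 0 < w e /\ [set` `]-oo, al j[] (w e)]); first exact: pm_pos.
by apply/seteqP; split => w /=; rewrite in_itv /= => /andP.
Qed.

End Quantile.

(** [rho] may vary with [eps], but it forces [g] to be a Cauchy sequence; thus [limn g] is a true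
    limit and no default value. *)
Lemma common_limit (R : realType) (f g : nat -> R) :
  (forall eps, 0 < eps -> exists rho, exists N, forall n, (N <= n)%N ->
     `|f n - rho| <= eps /\ `|g n - rho| <= eps) ->
  f @ \oo --> limn g.
Proof.
move=> h.
have cg : cvgn g.
  apply/cauchy_cvgP/cauchy_exP => e e0; have [rho [N hN]] := h (e / 2) ltac:(lra).
  exists rho; exists N => // n /= /hN [_ hg]; rewrite /ball /= distrC.
  by apply: (le_lt_trans hg); lra.
apply/cvgrPdist_le => e e0; have [rho [N hN]] := h (e / 3) ltac:(lra).
move/cvgrPdist_le : cg => /(_ (e / 3) ltac:(lra)) [M _ hM].
exists (maxn N M) => // n /=; rewrite geq_max => /andP[/hN [hf hg] /hM /=] hl.
rewrite (_ : limn g - f n = (limn g - g n) + (g n - rho) - (f n - rho)); last by ring.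
apply: (le_trans (ler_normB _ _)); apply: (le_trans (lerD (ler_normD _ _) hf)).
by move: hl hg; lra.
Qed.

Lemma pr_bigcup_le (R : realType) (d : measure_display) (Omega : measurableType d)
  (P : probability Omega R) (t : edge -> Omega -> R)
  (t_meas : forall e, measurable_fun [set: Omega] (t e))
  (G : nat -> set (edge -> R)) (c : R) :
  (forall k, prod_measurable (G k)) -> (forall k w, G k w -> G k.+1 w) ->
  (forall k, pr P t (G k) <= c) -> pr P t (\bigcup_k G k) <= c.
Proof.
move=> mG incG hG; pose H k := config t @^-1` G k.
have mH k : measurable (H k) by exact: config_measurable.
have mU : measurable (\bigcup_k H k) by exact: bigcup_measurable.
have hom : {homo H : n k / (n <= k)%N >-> (n <= k)%O}.
  apply: homo_leq => // [x y z xy yz|k]; first exact: le_trans xy yz.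
  by apply/subsetPset => omega; exact: incG.
have cv := nondecreasing_cvg_mu (mu := P) mH mU hom.
have fP A : measurable A -> P A = (fine (P A))%:E by move=> mA; rewrite fineK // fin_num_measure.
rewrite /pr preimage_bigcup -lee_fin -fP //.
rewrite -(cvg_lim _ cv) //; apply: lime_le; first by apply/cvg_ex; exists (P (\bigcup_k H k)).
by exists 0%N => // k _ /=; rewrite fP // lee_fin; exact: hG.
Qed.

Theorem theorem1p2 (R : realType) (d : measure_display)
  (Omega : measurableType d) (P : probability Omega R)
  (t : edge -> Omega -> R) (F : R -> R)
  (t_meas : forall e, measurable_fun [set: Omega] (t e))
  (t_nonneg : forall e omega, 0 <= t e omega)
  (t_indep : mutually_independent P t)
  (t_law : forall e x, P (t e @^-1` [set y | y <= x]) = (F x)%:E)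
  (F0 : F 0 = 2^-1)
  (a_div : (fun n : nat => \sum_(2 <= k < n) Finv F (2^-1 + 2 ^- k))
             @ \oo --> +oo)
  (E : set (edge -> R)) (cylE : cylinder E) (L : R) (L0 : 0 <= L) :
  (fun n : nat => condP P (config t @^-1` E)
     [set omega | passage_time (config t omega) [set origin] (bdbox n) <= L])
    @ \oo --> nu_tilde P t E.
Proof.
have law_le e x : pr P t [set w | w e <= x] = F x by rewrite /pr t_law.
have law_zero e : pr P t [set w | w e = 0] = 2^-1.
  rewrite -F0 -(law_le e); apply: (pr_eq P t_meas t_nonneg).
  - exact: pm_zero.
  - exact: (pm_coord e (measurable_itv `]-oo, 0])).
  by move=> w nw /=; split => [->//|h]; apply/eqP; rewrite eq_le h nw.
pose mu : iid_law R := IidLaw (pr_ge0 P t) (prT P t) (pr_le P t_meas t_nonneg)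
  (prID P t_meas) (pr_indep t_meas t_indep) law_zero.
have hcont := pr_bigcup_le t_meas (P := P) : forall (G : nat -> set (edge -> R)) c,
  (forall k, prod_measurable (G k)) -> (forall k w, G k w -> G k.+1 w) ->
  (forall k, mu (G k) <= c) -> mu (\bigcup_k G k) <= c.
have hF : forall e x, mu [set w | w e <= x] = F x by exact: law_le.
have agt0 := al_gt0 hcont hF F0.
have amono := al_mono hcont hF.
have age := al_ge hcont hF F0.
have alt := al_lt hcont hF F0.
have adiv M : exists n, M <= \sum_(2 <= k < n) Finv F (2^-1 + 2 ^- k).
  move/cvgryPge : a_div => /(_ M) [n _ hn]; exists n; exact: (hn n (leqnn n)).
have hshift := reach_shift agt0 amono age alt adiv.
have zl := zero_arm_likely alt hshift.
(* Any finite set of edges lies in some box. *)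
have [m lE] : exists m, loc (ebox m) E.
  case: cylE => mE [S hS]; pose f (e : edge) := maxn (nm (src e)) (nm (tgt e)).
  exists (\max_(e <- S) f e)%N; split => // w w' ww' Ew; apply/(hS w w') => // e eS.
  apply: ww'; have : (f e <= \max_(e <- S) f e)%N by exact: leq_bigmax_seq.
  by rewrite /ebox /edges_in /box geq_max.
have condE (M : R) n : condP P (config t @^-1` E)
    [set omega | passage_time (config t omega) [set origin] (bdbox n) <= M] =
    mu (E `&` reach n M) / mu (reach n M).
  rewrite /condP (_ : [set omega | _] = config t @^-1` reach n M) ?preimage_setI //.
  by apply/seteqP; split => omega /=; move/(passage_time_le n M (config_nonneg t_nonneg _)).
have cond0E n : condP P (config t @^-1` E)
    [set omega | passage_time (config t omega) [set origin] (bdbox n) = 0] =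
    mu (E `&` reach n 0) / mu (reach n 0).
  rewrite /condP (_ : [set omega | _] = config t @^-1` reach n 0) ?preimage_setI //.
  by apply/seteqP; split => omega /=; move/(passage_time_eq0 n (config_nonneg t_nonneg _)).
apply: common_limit => eps eps0.
(* One [rho] is compared with the budget [L] and with the budget 0, whose conditional probabilities
   define [nu_tilde]. *)
have [rho hrho] := ratio_close zl lE eps0; exists rho.
have [N hN] := hrho L; have [N' hN'] := hrho 0.
(* The conditioning event has positive probability, so the quotient is a genuine conditional
   probability. *)
have close M n : 0 <= M ->
    `|mu (E `&` reach n M) - rho * mu (reach n M)| <= eps * mu (reach n M) ->
    `|mu (E `&` reach n M) / mu (reach n M) - rho| <= eps.
  move=> M0 h; have p := reach_pos mu n M0.
  rewrite -(ler_pM2r p) -[X in _ * X <= _](gtr0_norm p) -normrM mulrBl divfK ?gt_eqF //.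
exists (maxn N N') => n; rewrite geq_max => /andP[h h'].
by rewrite condE cond0E; split; apply: close => //; [exact: hN|exact: hN'].
Qed.
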